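(* There is an algorithm which, given an undirected graph $G$ with $m$ edges, lists all $6$-cycles (subgraphs isomorphic to $C_6$) of $G$ in time $\widetilde{O}(m^{1.6}+t)$, where $t$ is the number of $6$-cycles in $G$.
   Context: $\widetilde{O}(\cdot)$ hides factors polylogarithmic in the number of vertices $n$ of $G$ (with $m\ge n$ assumed). Running time is measured in the word-RAM model. *)

(* Defs.v *)
From HB Require Import structures.
From mathcomp Require Import all_boot all_order all_algebra.
From mathcomp Require Import reals exp.

Set Implicit Arguments.
Unset Strict Implicit.
Unset Printing Implicit Defensive.

(** * Graphs *)

Record sgraph (T : finType) := SGraph {
  adj :> rel T;
  adj_sym : symmetric adj;
  adj_irrefl : irreflexive adj
}.

Definition edges (T : finType) (G : sgraph T) : {set {set T}} :=
  [set [set p.1; p.2] | p : T * T & G p.1 p.2].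

Section Subgraphs.
Variable T : finType.

(* A pair (vertex set, edge set). *)
Definition subgraph_data : finType := ({set T} * {set {set T}})%type.

Definition is_subgraph (G : sgraph T) (H : subgraph_data) : bool :=
  (H.2 \subset edges G) && [forall e in H.2, e \subset H.1].

Definition graph_image (U : finType) (F : sgraph U) (f : U -> T) :
    subgraph_data :=
  (f @: [set: U], [set f @: (e : {set U}) | e in edges F]).

Definition isomorphic_to (U : finType) (F : sgraph U) (H : subgraph_data) :
    bool :=
  [exists f : {ffun U -> T}, injectiveb f && (H == graph_image F f)].

End Subgraphs.

(* [ordS] is the cyclic successor on ['I_6]. *)
Definition C6_adj : rel 'I_6 := [rel i j | (j == ordS i) || (i == ordS j)].

Fact C6_adj_sym : symmetric C6_adj.
Proof. by move=> i j; rewrite /C6_adj /= orbC. Qed.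

Fact C6_adj_irrefl : irreflexive C6_adj.
Proof. by case=> [[|[|[|[|[|[|i]]]]]] hi]. Qed.

Definition C6 : sgraph 'I_6 := SGraph C6_adj_sym C6_adj_irrefl.

Definition six_cycles (T : finType) (G : sgraph T) : {set subgraph_data T} :=
  [set H | is_subgraph G H && isomorphic_to C6 H].

(** * Word RAM

    The machine has [w]-bit words, registers and memory cells holding one word
    each, and a write-only output stream.  A program is a finite list of
    instructions that does not depend on [w]; it halts when the program counter
    leaves the program.  Every executed instruction costs one time unit. *)

Inductive binop :=
  | OpAdd | OpSub | OpMul | OpDiv | OpMod
  | OpAnd | OpOr | OpXor | OpShl | OpShr | OpEq | OpLt.

(* [r], [a], [b] are register names; [M[a]] is the memory cell whose address is
   the content of register [a]. *)
Inductive instr :=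
  | Iconst (r c : nat)                (* r := c *)
  | Ibinop (o : binop) (r a b : nat)  (* r := a o b *)
  | Iload (r a : nat)                 (* r := M[a] *)
  | Istore (a r : nat)                (* M[a] := r *)
  | Ijump (l : nat)                   (* goto l *)
  | Ijumpz (r l : nat)                (* if r = 0 then goto l *)
  | Ioutput (r : nat).                (* append r to the output *)

Definition program := seq instr.

Record state := State {
  pc : nat;
  regs : nat -> nat;
  mem : nat -> nat;
  out : seq nat
}.

Definition update (f : nat -> nat) (a v : nat) : nat -> nat :=
  fun x => if x == a then v else f x.

Section Machine.
Variable w : nat.

Definition wrap (x : nat) : nat := x %% 2 ^ w.

(* Division by 0 yields 0, and [x] modulo 0 is [x]. *)
Definition eval_binop (o : binop) (x y : nat) : nat :=
  match o with
  | OpAdd => wrap (x + y)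
  | OpSub => wrap (x + 2 ^ w - y)
  | OpMul => wrap (x * y)
  | OpDiv => x %/ y
  | OpMod => x %% y
  | OpAnd => Nat.land x y
  | OpOr => Nat.lor x y
  | OpXor => Nat.lxor x y
  | OpShl => wrap (x * 2 ^ y)
  | OpShr => x %/ 2 ^ y
  | OpEq => x == y
  | OpLt => x < y
  end.

Definition exec (i : instr) (s : state) : state :=
  let: State p rg M o := s in
  match i with
  | Iconst r c => State p.+1 (update rg r (wrap c)) M o
  | Ibinop b r x y => State p.+1 (update rg r (eval_binop b (rg x) (rg y))) M o
  | Iload r a => State p.+1 (update rg r (M (rg a))) M o
  | Istore a r => State p.+1 rg (update M (rg a) (rg r)) o
  | Ijump l => State l rg M o
  | Ijumpz r l => State (if rg r == 0 then l else p.+1) rg M o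
  | Ioutput r => State p.+1 rg M (rcons o (rg r))
  end.

Definition halted (P : program) (s : state) : bool := size P <= pc s.

(* A halted state is left unchanged. *)
Definition step (P : program) (s : state) : state :=
  if onth P (pc s) is Some i then exec i s else s.

Definition run (P : program) (k : nat) (s : state) : state := iter k (step P) s.

(* The input occupies the first memory cells; all other cells and all registers
   are 0. *)
Definition init (input : seq nat) : state :=
  State 0 (fun=> 0) (fun a => wrap (nth 0 input a)) [::].

End Machine.

(** * Input and output conventions *)

Section Encoding.
Variable n : nat.

(* [s] lists every edge exactly once, in any order, with either orientation. *)
Definition is_edge_list (G : sgraph 'I_n) (s : seq ('I_n * 'I_n)) : bool :=
  perm_eq [seq [set p.1; p.2] | p <- s] (enum (edges G)).

(* n, m, u_1, v_1, ..., u_m, v_m *)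
Definition encode_input (s : seq ('I_n * 'I_n)) : seq nat :=
  n :: size s :: flatten [seq [:: val p.1; val p.2] | p <- s].

(* The output is a concatenation of 6-tuples of vertices, each one giving the
   vertices of a 6-cycle in cyclic order, and every 6-cycle of [G], as a
   subgraph, is given by exactly one of these tuples. *)
Definition lists_six_cycles (G : sgraph 'I_n) (o : seq nat) : Prop :=
  exists L : seq (6.-tuple 'I_n),
    o = flatten [seq [seq val x | x <- tval c] | c <- L] /\
    perm_eq [seq graph_image C6 (tnth c) | c <- L] (enum (six_cycles G)).

End Encoding.

(* Main.v *)
Require Import Defs.
From HB Require Import structures.
From mathcomp Require Import all_boot all_order all_algebra.
From mathcomp Require Import reals exp zify lra.

Set Implicit Arguments.
Unset Strict Implicit.
Unset Printing Implicit Defensive.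

(* Let D be about m ^ (1/5). Call a vertex heavy if its degree exceeds D ^ 2 and
   say that it lies in S if its degree exceeds D. A 2-walk x0 x1 x2 is of kind 0
   if its edge x1 x2 is poor (degree product at most D ^ 3), of kind 1 if x0 is
   heavy, of kind 2 if it lies inside S; a degree count bounds the number of
   extensions of such walks to paths x0 x1 x2 x3 by O(D ^ 8) = O(m ^ 1.6), once
   the 2-walks whose end points have many common middles ("fat" pairs) are stored
   only once and the remaining ("thin") ones individually. Every 6-cycle splits
   at some antipodal pair (x0, x3) into two stored items, and two items stored at
   the same pair form a 6-cycle unless they collide. A fat item avoids most
   collisions because it has at least six middles, and a thin item collides with
   few others, so trying all pairs of items in a bucket costs O(D ^ 8 + t).
   A 6-cycle is then produced boundedly often; the duplicates are removed by
   marking the twelve rotations and reflections of each tuple.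

   The algorithm is written as a list of rules over tables of lists, and these
   rules are compiled to the word RAM: a table entry is stored at the address
   obtained by reading its key in base n ^ 24, so no hashing is needed. *)

(** The thresholds come from a balance. With [m <= D ^ 5] there are at most [2 * D ^ 3] heavy
    vertices and [2 * D ^ 4] vertices in S, so that a heavy vertex times an edge, a poor edge times
    its degree product, and a pair of vertices of S each account for O(D ^ 8). They also fit
    together: an edge from a vertex outside S to one that is not heavy is poor since
    [D * D ^ 2 = D ^ 3], so a rich edge between vertices that are not heavy lies inside S. The
    obstacle is kind 2, where degrees bound neither the 2-walks inside S nor their extensions. These
    are charged to pairs of vertices of S and to 6-cycles: three pairwise fat vertices lie
    alternately on many 6-cycles, and a bucket of kind 2 with more than constantly many items yields
    6-cycles. Six middles are asked of a fat pair because a middle has to avoid at most three given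
    vertices, which leaves at least half of the choices. *)

Local Notation memory := Defs.mem.

(** * The rule language and its semantics *)

Inductive atom := AC of nat | AV of nat.
Inductive aop := OAdd | OMul | OEq | OLt.
Inductive expr :=
  | EA of atom | ELen of seq atom | EHd of seq atom
  | EOp of aop & expr & expr | EIn of expr.
Inductive binder :=
  | BIf of expr | BR of nat & expr | BL of nat & seq atom | BLet of nat & expr.
(** An action appends a value to the list at a key. The empty key stands for the output stream, so
    that output and tables share one semantics. *)
Definition act := (seq atom * atom)%type.
Definition rule := (seq binder * seq act)%type.
Definition table := seq nat -> seq nat.

Definition va (env : seq nat) (a : atom) : nat :=
  match a with AC c => c | AV x => nth 0 env x end.
Definition vk env (k : seq atom) : seq nat := [seq va env a | a <- k].
Definition vo o x y : nat :=
  match o with OAdd => x + y | OMul => x * y | OEq => x == y | OLt => x < y end.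

Section Semantics.
Variables (inp : seq nat) (L : table).

Fixpoint ve (env : seq nat) (e : expr) : nat :=
  match e with
  | EA a => va env a
  | ELen k => size (L (vk env k))
  | EHd k => head 0 (L (vk env k))
  | EOp o a b => vo o (ve env a) (ve env b)
  | EIn a => nth 0 inp (ve env a)
  end.

Fixpoint envs (c : seq binder) (env : seq nat) : seq (seq nat) :=
  match c with
  | [::] => [:: env]
  | BIf e :: c' => if ve env e != 0 then envs c' env else [::]
  | BR x e :: c' =>
      flatten [seq envs c' (set_nth 0 env x i) | i <- iota 0 (ve env e)]
  | BL x k :: c' =>
      flatten [seq envs c' (set_nth 0 env x v) | v <- L (vk env k)]
  | BLet x e :: c' => envs c' (set_nth 0 env x (ve env e))
  end.

(** One unit pays for at most one code size of executed instructions (see [ctx_spec]); the 1 inside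
    the sums pays for the bookkeeping of a loop round. *)
Fixpoint gcost (c : seq binder) (env : seq nat) (f : seq nat -> nat) : nat :=
  match c with
  | [::] => f env
  | BIf e :: c' => 1 + (if ve env e != 0 then gcost c' env f else 0)
  | BR x e :: c' =>
      2 + \sum_(i <- iota 0 (ve env e)) (1 + gcost c' (set_nth 0 env x i) f)
  | BL x k :: c' =>
      2 + \sum_(v <- L (vk env k)) (1 + gcost c' (set_nth 0 env x v) f)
  | BLet x e :: c' => 1 + gcost c' (set_nth 0 env x (ve env e)) f
  end.

Definition acts_events (a : seq act) (env : seq nat) : seq (seq nat * nat) :=
  [seq (vk env x.1, va env x.2) | x <- a].

Definition ctx_events (c : seq binder) (a : seq act) env :=
  flatten [seq acts_events a e | e <- envs c env].

Definition env0 : seq nat := nseq 7 0.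
Definition rule_events (r : rule) := ctx_events r.1 r.2 env0.
Definition rule_cost (r : rule) := gcost r.1 env0 (fun=> 1).

End Semantics.

Definition at_key (k : seq nat) (E : seq (seq nat * nat)) : seq nat :=
  [seq e.2 | e <- E & e.1 == k].
Definition addev (L : table) E : table := fun k => L k ++ at_key k E.

Lemma at_key_cat k E1 E2 : at_key k (E1 ++ E2) = at_key k E1 ++ at_key k E2.
Proof. by rewrite /at_key filter_cat map_cat. Qed.

Lemma addev_cat L E1 E2 k : addev L (E1 ++ E2) k = addev (addev L E1) E2 k.
Proof. by rewrite /addev at_key_cat catA. Qed.

Lemma ctx_events_cons_if inp L e c a env :
  ctx_events inp L (BIf e :: c) a env =
  if ve inp L env e != 0 then ctx_events inp L c a env else [::].
Proof. by rewrite /ctx_events /=; case: ifP. Qed.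

Lemma ctx_events_flatten inp L c a (f : nat -> seq nat) (s : seq nat) :
  flatten [seq acts_events a e | e <- flatten [seq envs inp L c (f i) | i <- s]]
  = flatten [seq ctx_events inp L c a (f i) | i <- s].
Proof. by elim: s => //= x s IH; rewrite map_cat flatten_cat IH. Qed.

(** * Static checks *)

(** The bound 729 is [3 ^ 6], which is at most [n ^ 6] for [n > 2]: constants obey the bound
    [q = n ^ 6] required of all stored numbers. *)
Definition chk_a (sc : seq nat) (a : atom) : bool :=
  match a with AC c => c < 729 | AV x => x \in sc end.
(** The head of a key names its table. [W] collects the tags that are still to be written, so a list
    with a fresh tag is already final. *)
Definition fresh_tag (W : seq nat) (k : seq nat) : bool :=
  if k is t :: _ then t \notin W else false.
Definition chk_k sc (W : seq nat) (k : seq atom) : bool :=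
  [&& all (chk_a sc) k, size k <= 8 & if k is AC t :: _ then t \notin W else false].

(** A value of degree [d] is below [q ^ d] (see [chk_safe]). Loop variables need degree 1; an input
    address may have degree 4 because the input region is the part of memory below [q ^ 4]. *)
Fixpoint deg (e : expr) : nat :=
  match e with
  | EOp OAdd a b => (maxn (deg a) (deg b)).+1
  | EOp OMul a b => deg a + deg b
  | _ => 1
  end.
Fixpoint chk_e sc (W : seq nat) (e : expr) : bool :=
  match e with
  | EA a => chk_a sc a
  | ELen k | EHd k => chk_k sc W k
  | EOp o a b => [&& chk_e sc W a, chk_e sc W b & deg (EOp o a b) <= 9]
  | EIn a => chk_e sc W a && (deg a <= 4)
  end.
Definition chk_act sc (W : seq nat) (a : act) : bool :=
  chk_a sc a.2 &&
  [&& all (chk_a sc) a.1, size a.1 <= 8 &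
    match a.1 with [::] => true | AC t :: _ => t \in W | _ => false end].
Fixpoint chk_c sc (W : seq nat) (c : seq binder) (a : seq act) : bool :=
  match c with
  | [::] => all (chk_act sc W) a
  | BIf e :: c' => chk_e sc W e && chk_c sc W c' a
  | BR x e :: c' | BLet x e :: c' =>
     [&& chk_e sc W e, deg e <= 1, x < 7, x \notin sc & chk_c (x :: sc) W c' a]
  | BL x k :: c' =>
     [&& chk_k sc W k, x < 7, x \notin sc & chk_c (x :: sc) W c' a]
  end.

(** * Compilation to the word RAM *)

(* Registers 0 to 6 hold the loop variables and register [RB] the base of the
   positional encoding of keys as addresses. *)
Definition RB := 7.

Definition kfold B acc (k : seq nat) := foldl (fun a x => a * B + x) acc k.
(* Cell 0 of the list stored at key [k] holds its length, cell [i.+1] its item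
   of index [i]. *)
Definition cell B (k : seq nat) (j : nat) := kfold B 1 k * B + j.

Definition ca r (a : atom) : instr :=
  match a with AC c => Iconst r c | AV x => Ibinop OpAnd r x x end.
Definition kc1 r (a : atom) :=
  [:: Ibinop OpMul r r RB; ca r.+1 a; Ibinop OpAdd r r r.+1].
Definition kcell r (k : seq atom) : seq instr :=
  Iconst r 1 :: flatten [seq kc1 r a | a <- k] ++ [:: Ibinop OpMul r r RB].
Arguments kcell : simpl never.
Definition bo o :=
  match o with OAdd => OpAdd | OMul => OpMul | OEq => OpEq | OLt => OpLt end.
Fixpoint ce r (e : expr) : seq instr :=
  match e with
  | EA a => [:: ca r a]
  | ELen k => kcell r k ++ [:: Iload r r]
  | EHd k => kcell r k ++ [:: Iconst r.+1 1; Ibinop OpAdd r r r.+1; Iload r r]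
  | EOp o a b => ce r a ++ ce r.+1 b ++ [:: Ibinop (bo o) r r r.+1]
  | EIn a => ce r a ++ [:: Iload r r]
  end.
Definition cact r (a : act) : seq instr :=
  if a.1 is [::] then [:: ca r a.2; Ioutput r]
  else kcell r a.1 ++
    [:: Iload r.+1 r; Iconst r.+2 1; Ibinop OpAdd r.+1 r.+1 r.+2; Istore r r.+1;
        Ibinop OpAdd r r r.+1; ca r.+1 a.2; Istore r r.+1].
Definition cacts r (a : seq act) := flatten [seq cact r x | x <- a].

(** Register [r] holds the number of rounds, [r.+1] the counter and [r.+2] is scratch; in a loop
    over a list, [r.+3] holds the address of its length cell. The 5 counts the instructions around
    the body. *)
Definition loop_code r h (body : seq instr) : seq instr :=
  Ibinop OpLt r.+2 r.+1 r :: Ijumpz r.+2 (h + size body + 5) ::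
  body ++ [:: Iconst r.+2 1; Ibinop OpAdd r.+1 r.+1 r.+2; Ijump h].
Definition fetch r x : seq instr :=
  [:: Iconst r.+2 1; Ibinop OpAdd r.+2 r.+2 r.+1;
      Ibinop OpAdd r.+2 r.+2 r.+3; Iload x r.+2].

(** Jumps are absolute, hence the parameter [p] for the address of the code. Registers from [r] on
    are free; a loop occupies four of them and leaves the rest to its body. *)
Fixpoint cctx (a : seq act) (c : seq binder) r p : seq instr :=
  match c with
  | [::] => cacts r a
  | BIf e :: c' =>
      let p' := p + size (ce r e) + 1 in
      let b := cctx a c' r p' in
      ce r e ++ Ijumpz r (p' + size b) :: b
  | BLet x e :: c' =>
      ce r e ++ Ibinop OpAnd x r r :: cctx a c' r (p + size (ce r e) + 1)
  | BR x e :: c' =>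
      let h := p + size (ce r e) + 1 in
      ce r e ++ Iconst r.+1 0 ::
      loop_code r h (Ibinop OpAnd x r.+1 r.+1 :: cctx a c' r.+4 (h + 2 + 1))
  | BL x k :: c' =>
      let pre := kcell r.+3 k in
      let h := p + size pre + 2 in
      pre ++ Iload r r.+3 :: Iconst r.+1 0 ::
      loop_code r h (fetch r x ++ cctx a c' r.+4 (h + 2 + 4))
  end.

Fixpoint crules (rs : seq rule) p : seq instr :=
  if rs is r :: rs' then
    let c := cctx r.2 r.1 8 p in c ++ crules rs' (p + size c)
  else [::].

(* Register [RB] receives n ^ 24. *)
Definition preamble : seq instr :=
  [:: Iconst 8 0; Iload 8 8; Iconst RB 1] ++ nseq 24 (Ibinop OpMul RB RB 8).
Definition compile (rs : seq rule) : program :=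
  preamble ++ crules rs (size preamble).

(** * Key encoding *)

Lemma kfold_rcons B acc k x : kfold B acc (rcons k x) = kfold B acc k * B + x.
Proof. by rewrite /kfold -cats1 foldl_cat. Qed.

Lemma kfold_gt0 B k : 0 < B -> 0 < kfold B 1 k.
Proof.
move=> B0; elim/last_ind: k => // k x IH.
by rewrite kfold_rcons addn_gt0 muln_gt0 IH B0.
Qed.

(** The initial accumulator 1 acts as a leading digit, so that keys of different lengths also
    receive different numbers. *)
Lemma kfold_inj B k1 k2 : 1 < B -> all (fun x => x < B) k1 ->
  all (fun x => x < B) k2 -> kfold B 1 k1 = kfold B 1 k2 -> k1 = k2.
Proof.
move=> B1; have B0 : 0 < B by lia.
elim/last_ind: k1 k2 => [|k1 x IH] k2; case/lastP: k2 => [|k2 y] //.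
- move=> _ _; rewrite kfold_rcons => E; have := kfold_gt0 k2 B0.
  by have {}E : 1 = kfold B 1 k2 * B + y := E; nia.
- move=> _ _; rewrite kfold_rcons => E; have := kfold_gt0 k1 B0.
  by have {}E : kfold B 1 k1 * B + x = 1 := E; nia.
rewrite !all_rcons !kfold_rcons => /andP[xB H1] /andP[yB H2] E.
have E1 : kfold B 1 k1 = kfold B 1 k2.
  by have := congr1 (divn^~ B) E; rewrite !divnMDl // !divn_small // !addn0.
by rewrite (IH _ H1 H2 E1); congr rcons; rewrite E1 in E; lia.
Qed.

Lemma kfold_lt B acc i k : acc < 2 * B ^ i -> all (fun x => x < B) k ->
  kfold B acc k < 2 * B ^ (i + size k).
Proof.
elim: k acc i => [|x k IH] acc i; first by rewrite addn0.
move=> Ha /= /andP[xB Hk]; rewrite addnS -addSn; apply: IH => //.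
by rewrite expnS; nia.
Qed.

Lemma cell_inj B k1 k2 j1 j2 : 1 < B -> all (fun x => x < B) k1 ->
  all (fun x => x < B) k2 -> j1 < B -> j2 < B ->
  cell B k1 j1 = cell B k2 j2 -> k1 = k2 /\ j1 = j2.
Proof.
move=> B1 H1 H2 J1 J2; rewrite /cell -!kfold_rcons => /kfold_inj E.
by have /rcons_inj[] := E B1 ltac:(by rewrite all_rcons J1) ltac:(by rewrite all_rcons J2).
Qed.

(** Keeps the tables apart from the input, which lies below [B]. *)
Lemma cell_ge B k j : 0 < B -> B <= cell B k j.
Proof. by move=> B0; have := kfold_gt0 k B0; rewrite /cell; nia. Qed.

(** With [B = q ^ 4], the cells of a key of length at most 8 lie below [2 * B ^ 9]; the tenth factor
    is slack. *)
Definition word_large w q := 2 * (q ^ 4) ^ 10 <= 2 ^ w.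

(** * Running straight-line code *)

Definition code_at (P c : seq instr) p :=
  forall i, i < size c -> onth P (p + i) = onth c i.

Lemma code_at_cat P a b p :
  code_at P (a ++ b) p -> code_at P a p /\ code_at P b (p + size a).
Proof.
move=> H; split=> i Hi.
  by rewrite H ?size_cat ?(leq_trans Hi) ?leq_addr // !onthE map_cat nth_cat size_map Hi.
rewrite -addnA H ?size_cat ?ltn_add2l // !onthE map_cat nth_cat size_map.
by rewrite ltnNge leq_addr /= addKn.
Qed.

Lemma code_at_cons P x b p :
  code_at P (x :: b) p -> onth P p = Some x /\ code_at P b p.+1.
Proof.
move=> H; split; first by have := H 0 isT; rewrite addn0.
by move=> i Hi; rewrite addSnnS H.
Qed.

Section Run.
Variables (w : nat) (P : program).

Lemma run_add a b s : run w P (a + b) s = run w P b (run w P a s).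
Proof. by rewrite /run addnC iterD. Qed.

Definition execs (c : seq instr) s := foldl (fun s i => exec w i s) s c.

Lemma execs_cat a b s : execs (a ++ b) s = execs b (execs a s).
Proof. exact: foldl_cat. Qed.

Definition straight i :=
  match i with Ijump _ | Ijumpz _ _ => false | _ => true end.

Lemma run_straight c s : all straight c -> code_at P c (pc s) ->
  run w P (size c) s = execs c s /\ pc (execs c s) = pc s + size c.
Proof.
elim: c s => [|i c IH] s /=; first by rewrite addn0.
move=> /andP[Hi Hc] /code_at_cons[H1 H2].
have E : pc (exec w i s) = (pc s).+1 by case: s {H1 H2} => ????; case: i Hi.
have [||R1 R2] := IH (exec w i s) => //; first by rewrite E.
split; last by rewrite R2 E addSnnS.
by rewrite /run -iterS iterSr {2}/step H1 -[RHS]R1.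
Qed.

Lemma straight_ca r a : straight (ca r a). Proof. by case: a. Qed.

Lemma straight_kcell r k : all straight (kcell r k).
Proof.
by rewrite /kcell /= all_cat andbT; elim: k => //= a k ->; rewrite straight_ca.
Qed.

Lemma straight_ce r e : all straight (ce r e).
Proof.
elim: e r => [a|k|k|o a IHa b IHb|a IHa] r.
- by rewrite /= straight_ca.
- by rewrite (all_cat _ (kcell r k)) straight_kcell.
- by rewrite (all_cat _ (kcell r k)) straight_kcell.
- by rewrite /= !all_cat IHa IHb.
- by rewrite /= all_cat IHa.
Qed.

Lemma straight_cacts r a : all straight (cacts r a).
Proof.
elim: a => //= -[k v] a IH; rewrite /cacts /= all_cat IH andbT.
case: k => [|x k]; rewrite /cact; first by rewrite /= straight_ca.
by rewrite (all_cat _ (kcell r (x :: k))) straight_kcell /= straight_ca.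
Qed.

(** * Machine memory as a table of lists *)

Section Exec.
Variables (q : nat) (inp : seq nat).
Let B := q ^ 4.
Hypothesis q_gt : 728 < q.
Hypothesis w_large : word_large w q.

Definition wfk (k : seq nat) := [&& size k <= 8, all (fun x => x < q) k & k != [::]].

(** All [B] cells of a key are specified, those behind the end of its list being 0 through the
    default of [nth]. The addresses below [B] belong to the input. *)
Definition memok (L : table) (M : nat -> nat) :=
  (forall k, wfk k -> forall j, j < B ->
     M (cell B k j) = nth 0 (size (L k) :: L k) j) /\
  (forall a, a < B -> M a = nth 0 inp a).

Lemma qB : q <= B.
Proof. by rewrite -[leqLHS]expn1 leq_pexp2l //; lia. Qed.

Lemma B_gt1 : 1 < B. Proof. by have := qB; lia. Qed.

Lemma pow_lt_w i x : i <= 10 -> x < 2 * B ^ i -> x < 2 ^ w.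
Proof.
move=> i10 Hx; apply: leq_trans Hx (leq_trans _ w_large).
by rewrite leq_mul2l leq_pexp2l // ltnW // B_gt1.
Qed.

Lemma all_ltB k : all (fun x => x < q) k -> all (fun x => x < B) k.
Proof. by apply: sub_all => x Hx; apply: leq_trans Hx qB. Qed.

Definition okreg (sc env : seq nat) s :=
  (forall x, x \in sc -> regs s x = nth 0 env x) /\ regs s RB = B.

Definition same r s s' :=
  [/\ forall x, x < r -> regs s' x = regs s x, memory s' = memory s & out s' = out s].

Lemma same_trans r r' s s' s'' : r <= r' ->
  same r s s' -> same r' s' s'' -> same r s s''.
Proof.
move=> rr [a b c] [a' b' c']; split; rewrite ?b' ?c' // => x Hx.
by rewrite a' ?a // (leq_trans Hx).
Qed.

Definition writes_ge r i : bool :=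
  match i with
  | Iconst x _ | Ibinop _ x _ _ | Iload x _ => r <= x
  | _ => false
  end.

Lemma same_execs r c s : all (writes_ge r) c -> same r s (execs c s).
Proof.
elim: c s => [|i c IH] s //= /andP[Hi Hc].
apply: same_trans (leqnn r) _ (IH _ Hc).
by case: s => p rg M o; case: i Hi => //= *; split=> // x Hx /=; rewrite /update ltn_eqF //; lia.
Qed.

Lemma okreg_regs sc env r s s' : all (fun x => x < 7) sc -> 8 <= r ->
  (forall x, x < r -> regs s' x = regs s x) -> okreg sc env s -> okreg sc env s'.
Proof.
move=> /allP Hsc r8 a [H1 H2]; split=> [x Hx|]; rewrite a //; first exact: H1.
by apply: leq_trans r8; rewrite ltnS ltnW // Hsc.
Qed.

Lemma okreg_same sc env r s s' : all (fun x => x < 7) sc -> 8 <= r ->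
  same r s s' -> okreg sc env s -> okreg sc env s'.
Proof. by move=> Hsc r8 [a _ _]; exact: okreg_regs a. Qed.

Lemma wrap_small x : x < 2 ^ w -> Defs.wrap w x = x.
Proof. by move=> H; rewrite /Defs.wrap modn_small. Qed.

Lemma ca_ok sc env r a s : all (fun x => x < 7) sc -> okreg sc env s ->
  chk_a sc a ->
  regs (exec w (ca r a) s) r = va env a /\ same r s (exec w (ca r a) s).
Proof.
move=> _ [H _]; case: a => [c|x] /= Hc; case: s H => p rg M o /= H.
  rewrite /same /= /update eqxx wrap_small; last first.
    by apply: (@pow_lt_w 1) => //; have := qB; rewrite expn1; lia.
  by split=> //; split=> // x Hx; rewrite ltn_eqF.
rewrite /same /= /update eqxx PeanoNat.Nat.land_diag H //; split=> //.
by split=> // y Hy; rewrite ltn_eqF.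
Qed.

Lemma va_lt sc env a : all (fun x => x < q) env -> chk_a sc a -> va env a < q.
Proof.
case: a => [c|x] /= He; first by move=> H; lia.
by move=> _; have [/(mem_nth 0)/(allP He)|/(nth_default 0)->] := ltnP x (size env) => //; lia.
Qed.

Lemma kc_ok sc env r k acc i s : all (fun x => x < 7) sc -> 8 <= r ->
  okreg sc env s -> all (fun x => x < q) env -> all (chk_a sc) k ->
  regs s r = acc -> acc < 2 * B ^ i -> i + size k <= 9 ->
  let s' := execs (flatten [seq kc1 r a | a <- k]) s in
  regs s' r = kfold B acc (vk env k) /\ same r s s'.
Proof.
move=> Hsc r8 Hr He; elim: k acc i s Hr => [|a k IH] acc i s Hr /=.
  by move=> _ -> _ _; split.
move=> /andP[Ha Hk] Hacc Hlt Hi.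
set s1 := exec w (Ibinop OpMul r r RB) s.
have R1 : regs s1 r = acc * B.
  rewrite /s1; case: s Hr Hacc {s1} => p rg M o /= [_ /= HB] Hacc.
  rewrite /update eqxx Hacc /= HB wrap_small //.
  apply: (@pow_lt_w i.+1); first lia.
  by rewrite expnS; have := B_gt1; nia.
have S1 : same r s s1.
  by apply: (@same_execs _ [:: _]); rewrite /= leqnn.
have Hr1 := okreg_same Hsc r8 S1 Hr.
have [R2 S2] := ca_ok r.+1 Hsc Hr1 Ha.
set s2 := exec w (ca r.+1 a) s1 in R2 S2.
have Hva := va_lt He Ha.
set s3 := exec w (Ibinop OpAdd r r r.+1) s2.
have R2' : regs s2 r = acc * B by case: S2 => -> //; lia.
have lt3 : acc * B + va env a < 2 * B ^ i.+1.
  by rewrite expnS; have := qB; nia.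
have R3 : regs s3 r = acc * B + va env a.
  rewrite /s3; case: s2 R2 R2' {S2 s3} => p rg M o /= R2 R2'.
  rewrite /update eqxx R2 R2' wrap_small //.
  by apply: (@pow_lt_w i.+1); first lia.
have S3 : same r s s3.
  apply: (same_trans (leqnn r)) (_ : same r s2 s3).
    by apply: same_trans S1 S2; lia.
  by apply: (@same_execs _ [:: _]); rewrite /= leqnn.
have Hr3 := okreg_same Hsc r8 S3 Hr.
have [|R4 S4] := IH _ i.+1 _ Hr3 Hk R3 lt3; first by move: Hi => /=; lia.
by split; [exact: R4 | exact: same_trans S3 S4].
Qed.

Lemma kcell_ok sc env r k s : all (fun x => x < 7) sc -> 8 <= r ->
  okreg sc env s -> all (fun x => x < q) env -> all (chk_a sc) k ->
  size k <= 8 ->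
  let s' := execs (kcell r k) s in
  regs s' r = cell B (vk env k) 0 /\ same r s s'.
Proof.
move=> Hsc r8 Hr He Hk k8; rewrite /kcell -cat1s !execs_cat.
set s1 := execs [:: Iconst r 1] s.
have [R1 S1] : regs s1 r = 1 /\ same r s s1.
  rewrite /s1; case: s {Hr s1} => p rg M o; rewrite /same /= /update eqxx wrap_small.
    by split=> //; split=> // x Hx; rewrite ltn_eqF.
  by apply: (@pow_lt_w 0).
have Hr1 := okreg_same Hsc r8 S1 Hr.
have [|||R2 S2] // := @kc_ok sc env r k 1 0 s1 Hsc r8 Hr1 He Hk.
  by rewrite add0n; lia.
set s2 := execs _ s1 in R2 S2 *; set s' := execs _ s2.
have S12 := same_trans (leqnn r) S1 S2.
have [_ HB] := okreg_same Hsc r8 S12 Hr.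
split; last first.
  apply: same_trans S12 _; first exact: leqnn.
  by apply: (@same_execs _ [:: _]); rewrite /= leqnn.
rewrite /s' /cell addn0; case: s2 R2 HB {s' S2 S12} => p rg M o /= R2 HB.
rewrite /update eqxx R2 HB wrap_small //.
have Hvk : all (fun x => x < B) (vk env k).
  apply: all_ltB; rewrite /vk all_map; apply: sub_all Hk => a; exact: va_lt.
have := @kfold_lt B 1 0 (vk env k) isT Hvk; rewrite size_map add0n => H.
apply: (@pow_lt_w (size k).+1); first lia.
by rewrite expnS; have := B_gt1; nia.
Qed.

(** Rules out wrap-around and reads outside the specified cells, so that word arithmetic agrees with
    arithmetic on natural numbers. *)
Fixpoint safe_e (L : table) env (e : expr) : bool :=
  match e with
  | EA a => true
  | ELen k | EHd k => wfk (vk env k)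
  | EOp o a b => [&& safe_e L env a, safe_e L env b &
                     vo o (ve inp L env a) (ve inp L env b) < 2 ^ w]
  | EIn a => safe_e L env a && (ve inp L env a < B)
  end.

Lemma cell_lt k j : wfk k -> j < B -> cell B k j < 2 ^ w.
Proof.
move=> /and3P[k8 kq _] jB.
have := @kfold_lt B 1 0 k isT (all_ltB kq); rewrite add0n => H.
apply: (@pow_lt_w (size k).+1); first lia.
by rewrite /cell expnS; have := B_gt1; nia.
Qed.

Lemma ce_ok sc env W L r e s : all (fun x => x < 7) sc -> 8 <= r ->
  okreg sc env s -> all (fun x => x < q) env -> memok L (memory s) ->
  chk_e sc W e -> safe_e L env e ->
  let s' := execs (ce r e) s in regs s' r = ve inp L env e /\ same r s s'.
Proof.
move=> Hsc r8 Hr He; elim: e r s r8 Hr => [a|k|k|o a IHa b IHb|a IHa] r s r8 Hr HM.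
- by move=> Ha _; exact: ca_ok Hr Ha.
- move=> /and3P[Hk k8 _] wk; rewrite (execs_cat (kcell r k)).
  have [R1 S1] := kcell_ok Hsc r8 Hr He Hk k8.
  set s1 := execs _ s in R1 S1 *.
  have M1 : memory s1 = memory s by case: S1.
  have E := HM.1 _ wk 0 (ltnW B_gt1).
  split; last first.
    apply: same_trans S1 _; first exact: leqnn.
    by apply: (@same_execs _ [:: _]); rewrite /= leqnn.
  by case: s1 R1 M1 {S1} => p rg M o /= R1 M1; rewrite /update eqxx R1 M1 E.
- move=> /and3P[Hk k8 _] wk; rewrite (execs_cat (kcell r k)).
  have [R1 S1] := kcell_ok Hsc r8 Hr He Hk k8.
  set s1 := execs _ s in R1 S1 *.
  have M1 : memory s1 = memory s by case: S1.
  have E := HM.1 _ wk 1 B_gt1.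
  split; last first.
    apply: same_trans S1 _; first exact: leqnn.
    by apply: same_execs; rewrite /= leqnn leqnSn.
  case: s1 R1 M1 {S1} => p rg M o /= R1 M1.
  have lt1 : 1 < 2 ^ w by apply: (@pow_lt_w 0).
  rewrite /update !eqxx ltn_eqF // R1 M1 !(wrap_small lt1).
  have C1 : cell B (vk env k) 0 + 1 = cell B (vk env k) 1 by rewrite /cell addn0.
  by rewrite C1 wrap_small ?E ?cell_lt ?B_gt1 //= nth0.
- move=> /= /and3P[Ha Hb _] /and3P[Sa Sb lt]; rewrite !execs_cat.
  have [R1 S1] := IHa r s r8 Hr HM Ha Sa.
  set s1 := execs _ s in R1 S1 *.
  have Hr1 := okreg_same Hsc r8 S1 Hr.
  have [R2 S2] := IHb r.+1 s1 ltac:(lia) Hr1 ltac:(by case: S1 => _ -> _) Hb Sb.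
  set s2 := execs _ s1 in R2 S2 *.
  have S12 := same_trans (leqnSn r) S1 S2.
  have R2' : regs s2 r = ve inp L env a by case: S2 => -> //.
  split; last first.
    apply: same_trans S12 _; first exact: leqnn.
    by apply: (@same_execs _ [:: _]); rewrite /= leqnn.
  case: s2 R2 R2' {S2 S12} => p rg M o' /= R2 R2'.
  rewrite /update eqxx R2 R2'.
  by case: o lt => //= lt; rewrite wrap_small.
- move=> /= /andP[Ha _] /andP[Sa lt]; rewrite execs_cat.
  have [R1 S1] := IHa r s r8 Hr HM Ha Sa.
  set s1 := execs _ s in R1 S1 *.
  have M1 : memory s1 = memory s by case: S1.
  split; last first.
    apply: same_trans S1 _; first exact: leqnn.
    by apply: (@same_execs _ [:: _]); rewrite /= leqnn.
  case: s1 R1 M1 {S1} => p rg M o /= R1 M1.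
  by rewrite /update eqxx R1 M1 HM.2.
Qed.

(** The empty key is exempt: the output is not kept in memory and may be longer than any stored
    list. *)
Definition Lok (L : table) := forall k, k != [::] ->
  (size (L k)).+1 < q /\ all (fun x => x < q) (L k).

Hypothesis inp_lt : forall a, nth 0 inp a < q.

Lemma chk_wfk sc W env k : all (fun x => x < q) env -> chk_k sc W k -> wfk (vk env k).
Proof.
move=> He /and3P[Hk k8 Ht]; apply/and3P; split; first by rewrite size_map.
  by rewrite all_map; apply: sub_all Hk => a; exact: va_lt.
by case: k Ht {Hk k8}.
Qed.

Lemma qpow_lt_w d x : d <= 9 -> x < q ^ d -> x < 2 ^ w.
Proof.
move=> d9 Hx; apply: (@pow_lt_w 10) => //; apply: leq_trans Hx _.
rewrite /B -expnM; apply: leq_trans (leq_pmull _ _) => //.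
by apply: leq_pexp2l; lia.
Qed.

Lemma chk_safe sc W L env e : all (fun x => x < q) env -> Lok L ->
  chk_e sc W e -> safe_e L env e /\ ve inp L env e < q ^ deg e.
Proof.
move=> He HL; have q0 : 0 < q by lia.
elim: e => [a|k|k|o a IHa b IHb|a IHa] /=; rewrite ?expn1.
- by move=> Ha; split=> //; exact: va_lt Ha.
- move=> Hk; have wk := chk_wfk He Hk; split=> //.
  by have [|H _] := HL (vk env k); [case/and3P: wk | lia].
- move=> Hk; have wk := chk_wfk He Hk; split=> //.
  have [|_ H] := HL (vk env k); first by case/and3P: wk.
  by case: (L _) H => //= x l /andP[].
- move=> /and3P[/IHa[Sa La] /IHb[Sb Lb] d9].
  set x := ve _ _ _ a in La *; set y := ve _ _ _ b in Lb *.
  suff H : vo o x y < q ^ deg (EOp o a b).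
    by rewrite Sa Sb /= (qpow_lt_w d9 H); split.
  have P0 d : 0 < q ^ d by rewrite expn_gt0 q0.
  case: o {d9} => /=.
  + rewrite expnS; have H1 := leq_maxl (deg a) (deg b).
    have H2 := leq_maxr (deg a) (deg b).
    have := leq_pexp2l q0 H1; have := leq_pexp2l q0 H2.
    by have := P0 (maxn (deg a) (deg b)); nia.
  + by rewrite expnD; nia.
  + by rewrite expn1; case: (x == y) => //=; lia.
  + by rewrite expn1; case: (x < y) => //=; lia.
- move=> /andP[/IHa[Sa La] d4]; rewrite Sa /=; split=> //.
  by apply: leq_trans La _; rewrite /B leq_pexp2l.
Qed.

Definition agree (W : seq nat) (L1 L2 : table) :=
  forall k, fresh_tag W k -> L1 k = L2 k.

Lemma chk_k_agree sc W L1 L2 env k : agree W L1 L2 -> chk_k sc W k ->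
  L1 (vk env k) = L2 (vk env k).
Proof. by move=> HA /and3P[_ _ Hk]; apply: HA; case: k Hk => //= -[]. Qed.

Lemma ve_agree sc W L1 L2 env e : agree W L1 L2 -> chk_e sc W e ->
  ve inp L1 env e = ve inp L2 env e.
Proof.
move=> HA; elim: e => [a|k|k|o a IHa b IHb|a IHa] //=.
- by move/(chk_k_agree env HA)->.
- by move/(chk_k_agree env HA)->.
- by move=> /and3P[/IHa-> /IHb->].
- by move=> /andP[/IHa->].
Qed.

Definition rep (L : table) s := memok L (memory s) /\ out s = L [::].

Lemma nth_push (l : seq nat) v j : nth 0 ((size l).+1 :: rcons l v) j =
  if j == 0 then (size l).+1 else if j == (size l).+1 then v else nth 0 (size l :: l) j.
Proof.
case: j => [|j] //=; rewrite nth_rcons eqSS.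
by case: ltngtP => // H; rewrite nth_default // ltnW.
Qed.

Lemma cact_ok sc W env r k v L s : all (fun x => x < 7) sc -> 8 <= r ->
  okreg sc env s -> all (fun x => x < q) env -> rep L s ->
  chk_act sc W (k, v) -> (vk env k != [::] -> (size (L (vk env k))).+2 < q) ->
  let s' := execs (cact r (k, v)) s in
  rep (addev L [:: (vk env k, va env v)]) s' /\
  forall x, x < r -> regs s' x = regs s x.
Proof.
move=> Hsc r8 Hr He HL /andP[/= Hv /and3P[Hk k8 Ht]].
case: k Hk k8 Ht => [|x k] Hk k8 Ht Hlen.
  have [R S] := ca_ok r Hsc Hr Hv.
  rewrite /=; set s2 := exec w (ca r v) s in R S *.
  case: S => S1 S2 S3; case: HL => -[H1 H2] H3.
  case: s2 R S1 S2 S3 => p rg M o /= -> S1 -> ->; split; last first.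
    by move=> x Hx; rewrite S1.
  split; first split=> // k wk j jB.
    by rewrite H1 // /addev /at_key /=; case/and3P: wk => _ _; case: k => // ???; rewrite cats0.
  by rewrite /= H3 /addev /at_key /= cats1.
rewrite [cact r _](erefl : _ = kcell r (x :: k) ++
  [:: Iload r.+1 r; Iconst r.+2 1; Ibinop OpAdd r.+1 r.+1 r.+2; Istore r r.+1;
      Ibinop OpAdd r r r.+1; ca r.+1 v; Istore r r.+1]).
move: (x :: k) (isT : (0 < size (x :: k))) Hk k8 {Ht} Hlen => {x}k k0 Hk k8 Hlen.
rewrite (execs_cat (kcell r k)).
have [R1 S1] := kcell_ok Hsc r8 Hr He Hk k8.
set s2 := execs _ s in R1 S1 *.
have Hr2 := okreg_same Hsc r8 S1 Hr.
have wk : wfk (vk env k).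
  rewrite /wfk size_map k8 /=; apply/andP; split.
    by rewrite all_map; apply: sub_all Hk => a'; exact: va_lt.
  by case: (k) k0.
have {}Hlen := Hlen ltac:(by case/and3P: wk).
have [[M1 M2] M3] := HL.
have S1m : memory s2 = memory s by case: S1.
have S1o : out s2 = out s by case: S1.
set l := L (vk env k) in Hlen.
rewrite -cat1s -[[:: Iconst _ _, _, _, _ & _]]cat1s.
have lenB : (size l).+1 < B by have := qB; lia.
have E1 : memory s2 (cell B (vk env k) 0) = size l by rewrite S1m M1 //; lia.
set s3 := execs ([:: Iload r.+1 r] ++ [:: Iconst r.+2 1] ++ [:: Ibinop OpAdd r.+1 r.+1 r.+2;
  Istore r r.+1; Ibinop OpAdd r r r.+1]) s2.
have c1 : (cell B (vk env k) (size l).+1) < 2 ^ w by exact: cell_lt.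
have l1 : (size l).+1 < 2 ^ w by apply: (@pow_lt_w 1); rewrite ?expn1 //; lia.
have lt1 : 1 < 2 ^ w by apply: (@pow_lt_w 0).
have cc : cell B (vk env k) 0 + (size l).+1 = cell B (vk env k) (size l).+1.
  by rewrite /cell addn0.
have [R3 [S3 [S3m S3o]]] : regs s3 r = cell B (vk env k) (size l).+1 /\
   (forall x, x < r -> regs s3 x = regs s2 x) /\
   memory s3 = update (memory s2) (cell B (vk env k) 0) (size l).+1 /\ out s3 = out s2.
  rewrite /s3; case: s2 R1 E1 {S1 Hr2 S1m S1o s3} => p rg M o /= R1 E1.
  have N1 : r.+1 == r.+2 = false by lia.
  have N2 : r == r.+1 = false by lia.
  have N3 : r == r.+2 = false by lia.
  rewrite /update /= !eqxx N1 N2 N3 R1 E1 (wrap_small lt1) addn1 (wrap_small l1) cc (wrap_small c1).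
  split=> //; split=> // x Hx.
  by rewrite !ltn_eqF //; lia.
have -> : execs ([:: Iload r.+1 r] ++ [:: Iconst r.+2 1] ++ [:: Ibinop OpAdd r.+1 r.+1 r.+2;
  Istore r r.+1; Ibinop OpAdd r r r.+1; ca r.+1 v; Istore r r.+1]) s2 =
  execs [:: ca r.+1 v; Istore r r.+1] s3 by [].
have Hr3 := okreg_regs Hsc r8 S3 Hr2.
have [R4 [S4 S4m S4o]] := ca_ok r.+1 Hsc Hr3 Hv.
rewrite /=; set s4 := exec w (ca r.+1 v) s3 in R4 S4 S4m S4o *.
have R4r : regs s4 r = cell B (vk env k) (size l).+1 by rewrite S4.
have M4 : memory (exec w (Istore r r.+1) s4) =
  update (update (memory s) (cell B (vk env k) 0) (size l).+1)
    (cell B (vk env k) (size l).+1) (va env v).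
  case: s4 R4 R4r S4m {S4 S4o} => p rg M o /= -> -> ->.
  by rewrite S3m S1m.
split; last first.
  move=> x Hx; have -> : regs (exec w (Istore r r.+1) s4) x = regs s4 x by case: (s4).
  rewrite S4 ?S3 //; last by lia.
  by case: S1 => ->.
split; last first.
  have -> : out (exec w (Istore r r.+1) s4) = out s4 by case: (s4).
  rewrite S4o S3o S1o M3 /addev /at_key /=.
  by case: eqP => [E|]; rewrite ?cats0 //; case/and3P: wk; rewrite E.
rewrite M4; split=> [k' wk' j jB|a' a'B]; last first.
  rewrite /update !ltn_eqF ?M2 //; apply: leq_trans a'B (cell_ge _ _ _);
  by have := B_gt1; lia.
(* Distinct pairs of key and index have distinct addresses, so the two writes change only the list
   at [k]. *)
have D k1 k2 j1 j2 : wfk k1 -> wfk k2 -> j1 < B -> j2 < B ->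
  (cell B k1 j1 == cell B k2 j2) = (k1 == k2) && (j1 == j2).
  move=> /and3P[_ a1 _] /and3P[_ a2 _] b1 b2; apply/eqP/andP; last by case=> /eqP-> /eqP->.
  by move=> /(cell_inj B_gt1 (all_ltB a1) (all_ltB a2) b1 b2)[-> ->].
rewrite /update !D //; last by have := B_gt1; lia.
rewrite /addev /at_key /= [vk env k == k']eq_sym M1 //.
case: eqP => [->|_] /=; last by rewrite cats0.
rewrite -/l cats1 size_rcons nth_push.
by case: j {jB} => [|j] /=.
Qed.

Lemma cacts_ok sc W env r a L s : all (fun x => x < 7) sc -> 8 <= r ->
  okreg sc env s -> all (fun x => x < q) env -> rep L s ->
  all (chk_act sc W) a ->
  (forall k, k != [::] ->
     (size (L k) + size (at_key k (acts_events a env))).+1 < q) ->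
  let s' := execs (cacts r a) s in
  rep (addev L (acts_events a env)) s' /\ forall x, x < r -> regs s' x = regs s x.
Proof.
move=> Hsc r8 Hr He; elim: a L s Hr => [|[k v] a IH] L s Hr HL Ha Hsz.
  split=> //; case: HL => -[H1 H2] H3; split; first split=> // k wk j jB.
    by rewrite H1 // /addev cats0.
  by rewrite /addev cats0.
move: Ha => /= /andP[Hact Ha].
rewrite /cacts /= execs_cat -/(cacts r a).
set ev1 := (vk env k, va env v).
have ac1 : ev1 :: acts_events a env = [:: ev1] ++ acts_events a env by [].
have Hlen : vk env k != [::] -> (size (L (vk env k))).+2 < q.
  move=> /Hsz; rewrite /= -/ev1 ac1 at_key_cat size_cat /at_key /= eqxx /=; lia.
have [HL1 S1] := cact_ok Hsc r8 Hr He HL Hact Hlen.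
rewrite -/ev1 in HL1; set s1 := execs (cact r (k, v)) s in HL1 S1 *.
have Hr1 := okreg_regs Hsc r8 S1 Hr.
have Hsz1 k' : k' != [::] ->
  (size (addev L [:: ev1] k') + size (at_key k' (acts_events a env))).+1 < q.
  move=> Hk'; have := Hsz k' Hk'; rewrite /= -/ev1 /addev ac1 at_key_cat !size_cat.
  by lia.
have [H1 H2] := IH _ _ Hr1 HL1 Ha Hsz1.
rewrite ac1; split; last by move=> x Hx; rewrite H2 // S1.
case: H1 => -[H11 H12] H13; split; first split=> // k' wk' j jB.
  by rewrite H11 // -addev_cat.
by rewrite H13 -addev_cat.
Qed.

Lemma run_step s i : onth P (pc s) = Some i -> run w P 1 s = exec w i s.
Proof. by rewrite /run /= /step => ->. Qed.

Lemma pc_jumpz r l s :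
  pc (exec w (Ijumpz r l) s) = if regs s r == 0 then l else (pc s).+1.
Proof. by case: s. Qed.

(** Each round costs five instructions besides the body, namely test and conditional jump before it,
    and a constant, an addition and a jump after it; the final test costs two. [Inv] has to survive
    changes of the counter and the scratch register only, since that is all the loop frame
    touches. *)
Lemma loop_run N h r (Inv : nat -> state -> Prop) (f : nat -> nat) body :
  code_at P (loop_code r h body) h -> N < 2 ^ w ->
  (forall i s s', Inv i s ->
     (forall x, x != r.+1 -> x != r.+2 -> regs s' x = regs s x) ->
     memory s' = memory s -> out s' = out s -> Inv i s') ->
  (forall i s, i < N -> Inv i s -> pc s = h + 2 -> regs s r = N -> regs s r.+1 = i ->
     exists t s', [/\ run w P t s = s', pc s' = h + 2 + size body, Inv i.+1 s',
       regs s' r = N /\ regs s' r.+1 = i & t <= f i]) ->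
  forall s, Inv 0 s -> pc s = h -> regs s r = N -> regs s r.+1 = 0 ->
  exists t s', [/\ run w P t s = s', pc s' = h + size (loop_code r h body),
     Inv N s' & t <= 2 + \sum_(i <- iota 0 N) (5 + f i)].
Proof.
move=> HC HN HI HB.
have [C1 /code_at_cons[C2 /code_at_cat[_]]] := code_at_cons HC.
rewrite -[h.+2]addn2 => /code_at_cons[C3] /code_at_cons[C4] /code_at_cons[C5 _].
have lt1 : 1 < 2 ^ w by apply: (@pow_lt_w 0).
have Hsz : size (loop_code r h body) = size body + 5.
  by rewrite /loop_code /= size_cat /=; lia.
suff H i s : i <= N -> Inv i s -> pc s = h -> regs s r = N -> regs s r.+1 = i ->
  exists t s', [/\ run w P t s = s', pc s' = h + size (loop_code r h body),
     Inv N s' & t <= 2 + \sum_(i <- iota i (N - i)) (5 + f i)].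
  by move=> s *; have := H 0 s; rewrite subn0; apply.
move Ed : (N - i) => d; elim: d i s Ed => [|d IH] i s Ed iN Hi Hp Hr Hr1.
  have Ei : i = N by lia.
  set s1 := exec w (Ibinop OpLt r.+2 r.+1 r) s.
  have R1 : regs s1 r.+2 = 0.
    by rewrite /s1; case: s Hr Hr1 {Hi Hp s1} => p rg M o /= -> ->; rewrite /update eqxx Ei ltnn.
  have P1 : pc s1 = h.+1 by rewrite /s1; case: s Hp {Hi Hr Hr1 s1 R1} => p rg M o /= ->.
  exists 2, (exec w (Ijumpz r.+2 (h + size body + 5)) s1); split=> //.
  - rewrite (run_add 1 1) [run w P 1 s](_ : _ = s1); last by apply: run_step; rewrite Hp.
    by apply: run_step; rewrite P1.
  - by rewrite pc_jumpz R1 Hsz addnA.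
  rewrite -Ei; apply: (HI _ _ _ Hi).
  - move=> x N1 N2; rewrite /s1; case: (s) => p rg M o /=.
    by rewrite /update (negbTE N2).
  - by rewrite /s1; case: (s).
  - by rewrite /s1; case: (s).
have iN' : i < N by lia.
set s1 := exec w (Ibinop OpLt r.+2 r.+1 r) s.
have R1 : regs s1 r.+2 = 1.
  by rewrite /s1; case: s Hr Hr1 {Hi Hp s1} => p rg M o /= -> ->; rewrite /update eqxx iN'.
have P1 : pc s1 = h.+1 by rewrite /s1; case: s Hp {Hi Hr Hr1 s1 R1} => p rg M o /= ->.
set s2 := exec w (Ijumpz r.+2 (h + size body + 5)) s1.
have P2 : pc s2 = h + 2.
  by rewrite /s2 pc_jumpz R1 P1 /=; lia.
have S2 x : x != r.+1 -> x != r.+2 -> regs s2 x = regs s x.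
  by move=> N1 N2; rewrite /s2 /s1; case: (s) => p rg M o /=; rewrite /update (negbTE N2).
have I2 : Inv i s2.
  by apply: (HI _ _ _ Hi S2); rewrite /s2 /s1; case: (s).
have R2 : regs s2 r = N by rewrite S2 ?Hr //; lia.
have R21 : regs s2 r.+1 = i.
  rewrite -Hr1 /s2 /s1; case: (s) => p rg M o /=; rewrite /update.
  by have -> : r.+1 == r.+2 = false by lia.
have [t [s3 [T3 P3 I3 [R3 R31] L3]]] := HB i s2 iN' I2 P2 R2 R21.
set s4 := exec w (Iconst r.+2 1) s3.
set s5 := exec w (Ibinop OpAdd r.+1 r.+1 r.+2) s4.
set s6 := exec w (Ijump h) s5.
have P4 : pc s4 = (h + 2 + size body).+1 by rewrite /s4 -P3; case: (s3).
have P5 : pc s5 = (h + 2 + size body).+2 by rewrite /s5; case: (s4) P4 => ???? /= ->.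
have P6 : pc s6 = h by rewrite /s6; case: (s5).
have S6 x : x != r.+1 -> x != r.+2 -> regs s6 x = regs s3 x.
  move=> N1 N2; rewrite /s6 /s5 /s4; case: (s3) => p rg M o /=.
  by rewrite /update (negbTE N1) (negbTE N2).
have I6 : Inv i.+1 s6 by apply: (HI _ _ _ I3 S6); rewrite /s6 /s5 /s4; case: (s3).
have R6 : regs s6 r = N by rewrite S6 ?R3 //; lia.
have R61 : regs s6 r.+1 = i.+1.
  rewrite /s6 /s5 /s4; case: s3 R31 {T3 P3 I3 R3 s4 s5 s6 P4 P5 P6 S6 I6 R6} => p rg M o /= R31.
  rewrite /update !eqxx; have -> : r.+1 == r.+2 = false by lia.
  by rewrite R31 !wrap_small ?addn1 //; lia.
have [t' [s' [T' P' I' L']]] := IH i.+1 s6 ltac:(lia) ltac:(lia) I6 P6 R6 R61.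
exists (1 + (1 + (t + (1 + (1 + (1 + t')))))), s'; split=> //.
  have T1 : run w P 1 s = s1 by apply: run_step; rewrite Hp.
  have T2 : run w P 1 s1 = s2 by apply: run_step; rewrite P1.
  have T4 : run w P 1 s3 = s4 by apply: run_step; rewrite P3.
  have T5 : run w P 1 s4 = s5 by apply: run_step; rewrite P4.
  have T6 : run w P 1 s5 = s6 by apply: run_step; rewrite P5.
  by rewrite run_add T1 run_add T2 run_add T3 run_add T4 run_add T5 run_add T6.
by rewrite /= big_cons; lia.
Qed.

End Exec.
End Run.

(* Plain [lia] is too slow next to hypotheses with powers such as [n ^ 241]. *)
Ltac slia :=
  repeat match goal with
  | H : ?T |- _ =>
    lazymatch type of T with
    | Prop => lazymatch T with
       | is_true (leq _ _) => fail
       | is_true (negb (_ == _)) => fail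
       | is_true (andb _ _) => fail
       | @eq nat _ _ => fail
       | _ => clear H
       end
    | _ => fail
    end
  end; lia.

Lemma all_set_nth q (env : seq nat) x v : 0 < q -> v < q ->
  all (fun y => y < q) env -> all (fun y => y < q) (set_nth 0 env x v).
Proof.
move=> q0 vq He; apply/(all_nthP 0) => i _; rewrite nth_set_nth /=.
case: eqP => // _; have [/(mem_nth 0)/(allP He)|/(nth_default 0)->] //= := ltnP i (size env).
Qed.

(** * Evaluating all rules against the final table *)

Definition wtag (a : act) : seq nat := if a.1 is AC t :: _ then [:: t] else [::].
Definition wtags (rs : seq rule) : seq nat := flatten [seq flatten (map wtag r.2) | r <- rs].
Fixpoint chk_rules (rs : seq rule) : bool :=
  if rs is r :: rs' then chk_c [::] (wtags rs) r.1 r.2 && chk_rules rs' else true.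

Definition rules_events inp L (rs : seq rule) := flatten [seq rule_events inp L r | r <- rs].

Section Agree.
Variable inp : seq nat.

Lemma envs_agree W L1 L2 a c sc env : agree W L1 L2 -> chk_c sc W c a ->
  envs inp L1 c env = envs inp L2 c env.
Proof.
move=> HA; elim: c sc env => [|b c IH] sc env //=.
case: b => [e|x e|x k|x e].
- by move=> /andP[/(ve_agree inp env HA)-> /IH->].
- move=> /and5P[/(ve_agree inp env HA)-> _ _ _ H].
  by congr flatten; apply: eq_map => v; exact: IH H.
- move=> /and4P[/(chk_k_agree env HA)-> _ _ H].
  by congr flatten; apply: eq_map => v; exact: IH H.
- by move=> /and5P[/(ve_agree inp env HA)-> _ _ _ /IH->].
Qed.

Lemma chk_c_acts sc W c a : chk_c sc W c a -> exists sc', all (chk_act sc' W) a.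
Proof.
elim: c sc => [|b c IH] sc /=; first by exists sc.
by case: b => [e|x e|x k|x e]; [case/andP | case/and5P | case/and4P | case/and5P] => *;
  eapply IH; eassumption.
Qed.

Lemma at_key_fresh W L c a sc env k : chk_c sc W c a -> fresh_tag W k ->
  at_key k (ctx_events inp L c a env) = [::].
Proof.
move=> /chk_c_acts[sc' Ha] Hk.
have Hact e : all (fun x => x.1 != k) (acts_events a e).
  elim: a Ha => //= -[k' v] a IH /andP[/andP[_ /and3P[_ _ /= Ht]] /IH ->]; rewrite andbT.
  by case: k' k Hk Ht {IH} => [|[t|t] k'] [|t' k] //= Hk Ht; apply: contraNneq Hk => -[<- _].
suff H : all (fun e => e.1 != k) (ctx_events inp L c a env).
  rewrite /at_key; elim: (ctx_events _ _ _ _ _) H => //= e E IH /andP[He HE].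
  by rewrite (negbTE He) IH.
by rewrite /ctx_events; elim: (envs _ _ _ _) => //= e E IH; rewrite all_cat IH andbT.
Qed.

Lemma wtags_cons r rs W : chk_c [::] (wtags (r :: rs)) r.1 r.2 -> W = wtags (r :: rs) ->
  forall k, fresh_tag W k -> fresh_tag (wtags rs) k.
Proof.
move=> _ -> [|t k] //=; rewrite /wtags /= mem_cat negb_or => /andP[] //.
Qed.

Lemma at_key_rules_fresh L rs k : chk_rules rs -> fresh_tag (wtags rs) k ->
  at_key k (rules_events inp L rs) = [::].
Proof.
elim: rs => [|r rs IH] //= /andP[H1 H2] Hk.
rewrite /rules_events /= at_key_cat -/(rules_events inp L rs) IH //.
  by rewrite (at_key_fresh _ _ H1 Hk).
exact: wtags_cons H1 erefl _ Hk.
Qed.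

(* All rules can be evaluated against the final table because a rule only reads
   tables which neither it nor any later rule writes. *)
Lemma final_table rs L0 : chk_rules rs ->
  exists L, forall k, L k = L0 k ++ at_key k (rules_events inp L rs).
Proof.
elim: rs L0 => [|r rs IH] L0; first by exists L0 => k; rewrite cats0.
move=> /= /andP[H1 H2].
have [L HL] := IH (addev L0 (rule_events inp L0 r)) H2.
exists L => k; rewrite HL /rules_events /= at_key_cat catA /addev; congr ((_ ++ _) ++ _).
rewrite /rule_events /ctx_events; congr (at_key k (flatten (map _ _))).
apply: (envs_agree _ _ H1) => k' Hk'; rewrite HL /addev.
rewrite (at_key_rules_fresh _ H2) ?cats0; last exact: wtags_cons H1 erefl _ Hk'.
by rewrite (at_key_fresh _ _ H1 Hk') cats0.
Qed.
End Agree.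

(** * The compiled code simulates the rules *)

Section Simulation.
Variables (w : nat) (P : program) (q : nat) (inp : seq nat).
Hypothesis q_gt : 728 < q.
Hypothesis w_large : word_large w q.
Hypothesis inp_lt : forall a, nth 0 inp a < q.
Variables (W : seq nat) (L : table).
Hypothesis L_ok : Lok q L.

Lemma rep_ext L1 L2 s : (forall k, L1 k = L2 k) -> rep q inp L1 s -> rep q inp L2 s.
Proof.
by move=> E [[H1 H2] H3]; split; [split=> // k wk j jB; rewrite -E; exact: H1 | rewrite -E].
Qed.

Lemma safe_agree sc L1 L2 env e : agree W L1 L2 -> chk_e sc W e ->
  safe_e w q inp L1 env e = safe_e w q inp L2 env e.
Proof.
move=> HA; elim: e => [a|k|k|o a IHa b IHb|a IHa] //=.
- by move=> /and3P[Ha Hb _]; rewrite IHa // IHb // !(ve_agree inp env HA Ha) !(ve_agree inp env HA Hb).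
- by move=> /andP[Ha _]; rewrite IHa // (ve_agree inp env HA Ha).
Qed.

Lemma run_ce sc env r e p s Lc : all (fun x => x < 7) sc -> 8 <= r ->
  okreg q sc env s -> all (fun x => x < q) env -> rep q inp Lc s ->
  agree W Lc L -> chk_e sc W e -> code_at P (ce r e) p -> pc s = p ->
  exists s', [/\ run w P (size (ce r e)) s = s', pc s' = p + size (ce r e),
    regs s' r = ve inp L env e & same r s s'].
Proof.
move=> Hsc r8 Hr He [HM _] HA Hc HC Hp; exists (execs w (ce r e) s).
have [|R1 R2] := @run_straight w P (ce r e) s (straight_ce _ _); first by rewrite Hp.
have Hs : safe_e w q inp Lc env e.
  by rewrite (safe_agree env HA Hc); have [] := chk_safe q_gt w_large inp_lt He L_ok Hc.
have [R3 S3] := ce_ok q_gt w_large Hsc r8 Hr He HM Hc Hs.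
by rewrite R1 R2 Hp R3 (ve_agree inp env HA Hc).
Qed.

Definition small_after (Lc : table) E := forall k, k != [::] ->
  (size (Lc k) + size (at_key k E)).+1 < q.

(** The machine holds the current table [Lc] while the semantics reads the final table [L]; they
    agree on every tag that may be read. Only variables in scope and the registers of enclosing
    loops are preserved. [Z] bounds the code size and hence the straight pieces executed per unit of
    [gcost]. *)
Definition ctx_spec a c := forall sc r p env Lc s Z,
  chk_c sc W c a -> all (fun x => x < 7) sc -> 8 <= r ->
  code_at P (cctx a c r p) p -> pc s = p -> okreg q sc env s ->
  all (fun x => x < q) env -> rep q inp Lc s -> agree W Lc L ->
  small_after Lc (ctx_events inp L c a env) -> size (cctx a c r p) <= Z ->
  exists t s', [/\ run w P t s = s', pc s' = p + size (cctx a c r p),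
    rep q inp (addev Lc (ctx_events inp L c a env)) s',
    (forall x, (x \in sc) || (7 <= x < r) -> regs s' x = regs s x) &
    t <= Z * gcost inp L c env (fun=> 1)].

Lemma small_after_cat Lc E1 E2 : small_after Lc (E1 ++ E2) ->
  small_after Lc E1 /\ small_after (addev Lc E1) E2.
Proof.
by move=> H; split=> k Hk; have := H k Hk; rewrite at_key_cat /addev !size_cat; slia.
Qed.

Lemma agree_addev sc c a env Lc : chk_c sc W c a -> agree W Lc L ->
  agree W (addev Lc (ctx_events inp L c a env)) L.
Proof. by move=> Hc HA k Hk; rewrite /addev (at_key_fresh _ _ _ Hc Hk) cats0 HA. Qed.

Lemma okreg_sc sc env r s s' : 8 <= r -> okreg q sc env s ->
  (forall y, (y \in sc) || (7 <= y < r) -> regs s' y = regs s y) -> okreg q sc env s'.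
Proof.
move=> r8 [H1 H2] H; split=> [y Hy|]; last by rewrite H //; apply/orP; right.
by rewrite H ?H1 // Hy.
Qed.

(** Common to both loops: [fet] is the code that brings the value of the current round into register
    [x], and [vs] lists these values. The register [r.+3] must persist because it holds the list
    address. *)
Lemma loop_spec a c x sc r h env Lc s vs fet Z :
  ctx_spec a c -> chk_c (x :: sc) W c a -> x < 7 -> x \notin sc ->
  all (fun y => y < 7) sc -> 8 <= r -> size vs < 2 ^ w -> all (fun y => y < q) vs ->
  (forall i s1 Lc1, i < size vs -> agree W Lc1 L -> rep q inp Lc1 s1 ->
     regs s1 r.+1 = i -> regs s1 r.+3 = regs s r.+3 -> pc s1 = h + 2 ->
     exists s2, [/\ run w P (size fet) s1 = s2, pc s2 = h + 2 + size fet,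
       regs s2 x = nth 0 vs i,
       (forall y, y != x -> y != r.+2 -> regs s2 y = regs s1 y) &
       memory s2 = memory s1 /\ out s2 = out s1]) ->
  let body := fet ++ cctx a c r.+4 (h + 2 + size fet) in
  code_at P (loop_code r h body) h ->
  pc s = h -> regs s r = size vs -> regs s r.+1 = 0 -> okreg q sc env s ->
  all (fun y => y < q) env -> rep q inp Lc s -> agree W Lc L ->
  let E := flatten [seq ctx_events inp L c a (set_nth 0 env x v) | v <- vs] in
  small_after Lc E -> size (loop_code r h body) <= Z ->
  exists t s', [/\ run w P t s = s', pc s' = h + size (loop_code r h body),
    rep q inp (addev Lc E) s',
    (forall y, (y \in sc) || (7 <= y < r) -> regs s' y = regs s y) &
    t <= 2 + \sum_(v <- vs) (Z * (1 + gcost inp L c (set_nth 0 env x v) (fun=> 1)))].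
Proof.
move=> IH Hc x7 xsc Hsc r8 Nw Hvs Hfet body HC Hp Hr Hr1 Hok He HL HA E Hsm HZ.
pose ev v := ctx_events inp L c a (set_nth 0 env x v).
pose Ei i := flatten [seq ev v | v <- take i vs].
have q0 : 0 < q by slia.
have EiS i : i < size vs -> Ei i.+1 = Ei i ++ ev (nth 0 vs i).
  by move=> Hi; rewrite /Ei (take_nth 0) // map_rcons flatten_rcons.
have EE i : E = Ei i ++ flatten [seq ev v | v <- drop i vs].
  by rewrite /Ei /E -flatten_cat -map_cat cat_take_drop.
have AA i : agree W (addev Lc (Ei i)) L.
  elim: i => [|i IHi].
    by move=> k Hk; rewrite /addev /Ei take0 cats0 HA.
  have [Hi|Hi] := ltnP i (size vs); last first.
    by move: IHi; rewrite /Ei !take_oversize // ltnW.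
  move=> k Hk; rewrite EiS // addev_cat; exact: (agree_addev _ Hc IHi).
pose Inv i s1 := [/\ rep q inp (addev Lc (Ei i)) s1, regs s1 r.+3 = regs s r.+3 &
  forall y, (y \in sc) || (7 <= y < r) -> regs s1 y = regs s y].
have sc_lt y : (y \in sc) || (7 <= y < r) -> y < r.
  by case/orP=> [/(allP Hsc)|] /=; slia.
have I0 : Inv 0 s.
  by split=> //; apply: rep_ext HL => k; rewrite /addev /Ei take0 cats0.
have HI i s1 s2 : Inv i s1 -> (forall y, y != r.+1 -> y != r.+2 -> regs s2 y = regs s1 y) ->
   memory s2 = memory s1 -> out s2 = out s1 -> Inv i s2.
  move=> [[M1 O1] B1 S1] H Hm Ho; split.
  - by split; rewrite ?Hm ?Ho.
  - by rewrite H //; slia.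
  - by move=> y Hy; rewrite H ?S1 //; have := sc_lt y Hy; slia.
pose f i := size fet + Z * gcost inp L c (set_nth 0 env x (nth 0 vs i)) (fun=> 1).
have HB i s1 : i < size vs -> Inv i s1 -> pc s1 = h + 2 -> regs s1 r = size vs ->
   regs s1 r.+1 = i ->
   exists t s', [/\ run w P t s1 = s', pc s' = h + 2 + size body, Inv i.+1 s',
       regs s' r = size vs /\ regs s' r.+1 = i & t <= f i].
  move=> Hi [R1 B1 S1] P1 RN Ri.
  have [s2 [T2 P2 X2 S2 [M2 O2]]] := Hfet i s1 _ Hi (AA i) R1 Ri B1 P1.
  have [_ /code_at_cons[_ /code_at_cat[/code_at_cat[_ C2] _]]] := code_at_cons HC.
  have ok2 : okreg q (x :: sc) (set_nth 0 env x (nth 0 vs i)) s2.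
    have [H1 H2] : okreg q sc env s1 by apply: okreg_sc Hok S1.
    split=> [y|]; last by rewrite S2 ?H2 // /RB; slia.
    rewrite inE nth_set_nth /=; case: eqP => [-> _|/eqP Hyx /= Hy] //.
    by rewrite S2 ?H1 //; have := allP Hsc _ Hy; slia.
  have He2 : all (fun y => y < q) (set_nth 0 env x (nth 0 vs i)).
    by apply: all_set_nth => //; apply: (allP Hvs); rewrite mem_nth.
  have R2 : rep q inp (addev Lc (Ei i)) s2 by case: R1 => ? ?; split; rewrite ?M2 ?O2.
  have Hsm2 : small_after (addev Lc (Ei i)) (ev (nth 0 vs i)).
    move: Hsm; rewrite (EE i.+1) EiS // => /small_after_cat[/small_after_cat[]] //.
  have HZ2 : size (cctx a c r.+4 (h + 2 + size fet)) <= Z.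
    by apply: leq_trans HZ; rewrite /loop_code /= !size_cat /=; slia.
  have C2' : code_at P (cctx a c r.+4 (h + 2 + size fet)) (h + 2 + size fet).
    by move: C2; rewrite -[h.+2]addn2.
  have Hsc2 : all (fun y => y < 7) (x :: sc) by rewrite /= x7.
  have [t [s3 [T3 P3 R3 S3 L3]]] := IH (x :: sc) r.+4 _ _ _ s2 Z Hc Hsc2 ltac:(slia)
    C2' P2 ok2 He2 R2 (AA i) Hsm2 HZ2.
  have SS y : 7 <= y -> y != r.+2 -> y < r.+4 -> regs s3 y = regs s1 y.
    move=> a1 a2 a3; rewrite S3; last by rewrite a1 a3 orbT.
    by rewrite S2 //; slia.
  exists (size fet + t), s3; split.
  - by rewrite run_add T2.
  - by rewrite P3 /body size_cat; slia.
  - split; first by apply: rep_ext R3 => k; rewrite EiS // addev_cat.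
      by rewrite SS //; slia.
    move=> y Hy; rewrite S3 ?S2 ?S1 //.
    + by apply: contraTneq Hy => ->; rewrite negb_or xsc /=; slia.
    + by have := sc_lt y Hy; slia.
    + by rewrite inE; case/orP: Hy => [->|Hy]; rewrite ?orbT //; apply/orP; right; slia.
  - by split; rewrite SS //; slia.
  - by rewrite /f leq_add2l.
have [t [s' [T' P' [R' _ S'] L']]] := loop_run q_gt w_large HC Nw HI HB I0 Hp Hr Hr1.
exists t, s'; split=> //.
  by apply: rep_ext R' => k; rewrite /Ei take_size.
apply: leq_trans L' _; rewrite leq_add2l [leqRHS](big_nth 0) /index_iota subn0.
apply: leq_sum => i _; rewrite /f mulnDr muln1 addnA leq_add2r.
by apply: leq_trans HZ; rewrite /loop_code /= !size_cat /=; slia.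
Qed.

Opaque kcell.

Lemma cctx_ok a c : ctx_spec a c.
Proof.
elim: c => [|b c IH] sc r p env Lc s Z.
  move=> Ha Hsc r8 HC Hp Hok He HL HA Hsm HZ.
  have [|R1 R2] := @run_straight w P (cacts r a) s (straight_cacts _ _); first by rewrite Hp.
  have [|R3 S3] := cacts_ok q_gt w_large Hsc r8 Hok He HL Ha.
    by move: Hsm; rewrite /ctx_events /= cats0.
  exists (size (cacts r a)), (execs w (cacts r a) s); split=> //.
  - by rewrite R2 Hp.
  - by rewrite /ctx_events /= cats0.
  - by move=> x Hx; rewrite S3 //; case/orP: Hx => [/(allP Hsc)|] /=; slia.
  - by rewrite /= muln1.
case: b => [e|x e|x k|x e].
- move=> /= /andP[He1 Hc] Hsc r8 /code_at_cat[C1 /code_at_cons[C2 C3]] Hp Hok He HL HA.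
  rewrite ctx_events_cons_if; set b := cctx a c r _ in C2 C3 *.
  have [s1 [T1 P1 R1 S1]] := run_ce Hsc r8 Hok He HL HA He1 C1 Hp.
  set s2 := exec w (Ijumpz r (p + size (ce r e) + 1 + size b)) s1.
  have T2 : run w P 1 s1 = s2 by apply: run_step; rewrite P1.
  have [S11 S12 S13] := S1.
  have S2 : [/\ forall y, y < r -> regs s2 y = regs s y, memory s2 = memory s & out s2 = out s].
    by rewrite /s2; case: (s1) S11 S12 S13.
  have HL2 : rep q inp Lc s2 by case: S2 HL => _ Em Eo [??]; split; rewrite ?Em ?Eo.
  have P2 : pc s2 = if ve inp L env e == 0 then p + size (ce r e) + 1 + size b
     else (p + size (ce r e)).+1 by rewrite /s2 pc_jumpz R1 P1.
  case: eqP P2 => [_|_] P2 /= Hsm HZ.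
    exists (size (ce r e) + 1), s2; split.
    + by rewrite run_add T1.
    + by rewrite P2 size_cat /=; slia.
    + by apply: rep_ext HL2 => k; rewrite /addev /at_key cats0.
    + by case: S2 => H _ _ y Hy; rewrite H //; case/orP: Hy => [/(allP Hsc)|] /=; slia.
    + by rewrite addn0 muln1; apply: leq_trans HZ; rewrite size_cat /=; slia.
  have C3' : code_at P b (p + size (ce r e) + 1) by rewrite addn1.
  have P2' : pc s2 = p + size (ce r e) + 1 by rewrite P2 addn1.
  have ok2 : okreg q sc env s2 by apply: (okreg_same Hsc r8 _ Hok); exact: S2.
  have HZ2 : size b <= Z by apply: leq_trans HZ; rewrite size_cat /=; slia.
  have [t [s3 [T3 P3 R3 S3 L3]]] := IH _ _ _ _ _ _ _ Hc Hsc r8 C3' P2' ok2 He HL2 HA Hsm HZ2.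
  exists (size (ce r e) + (1 + t)), s3; split.
  + by rewrite run_add T1 run_add T2.
  + by rewrite P3 size_cat /= -/b; slia.
  + exact: R3.
  + move=> y Hy; rewrite S3 //; case: S2 => H _ _; rewrite H //.
    by case/orP: Hy => [/(allP Hsc)|] /=; slia.
  + rewrite mulnDr muln1 addnA leq_add //.
    by apply: leq_trans HZ; rewrite size_cat /=; slia.
- move=> /= /and5P[He1 dg x7 xsc Hc] Hsc r8 HC Hp Hok He HL HA Hsm HZ.
  have [C1 /code_at_cons[C2 C3]] := code_at_cat HC.
  have [s1 [T1 P1 R1 S1]] := run_ce Hsc r8 Hok He HL HA He1 C1 Hp.
  set h := p + size (ce r e) + 1 in C3 HC HZ *.
  set s2 := exec w (Iconst r.+1 0) s1.
  have T2 : run w P 1 s1 = s2 by apply: run_step; rewrite P1.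
  have P2 : pc s2 = h by rewrite /s2 /h -P1 addn1; case: (s1).
  have [S11 S12 S13] := S1.
  have S2 : [/\ forall y, y < r -> regs s2 y = regs s y, memory s2 = memory s & out s2 = out s].
    rewrite /s2; case: (s1) S11 S12 S13 => p1 rg M o /= H1 H2 H3; split=> // y Hy.
    by rewrite /update ltn_eqF ?H1 //; slia.
  have HL2 : rep q inp Lc s2 by case: S2 HL => _ Em Eo [??]; split; rewrite ?Em ?Eo.
  have ok2 : okreg q sc env s2 by apply: (okreg_same Hsc r8 _ Hok); exact: S2.
  have R2 : regs s2 r.+1 = 0.
    by rewrite /s2; case: (s1) => p1 rg M o /=; rewrite /update eqxx /Defs.wrap mod0n.
  have R2r : regs s2 r = size (iota 0 (ve inp L env e)).
    rewrite size_iota -R1 /s2; case: (s1) => p1 rg M o /=; rewrite /update.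
    by have -> : r == r.+1 = false by slia.
  have Hlt : ve inp L env e < q.
    have [_ H] := chk_safe q_gt w_large inp_lt He L_ok He1.
    apply: leq_trans H _; rewrite -[leqRHS]expn1 leq_pexp2l //; slia.
  have Nw : size (iota 0 (ve inp L env e)) < 2 ^ w.
    by rewrite size_iota; apply: (qpow_lt_w q_gt w_large (d:=1)); rewrite ?expn1.
  have Hvs : all (fun y => y < q) (iota 0 (ve inp L env e)).
    by apply/allP => y; rewrite mem_iota; slia.
  have C3' : code_at P (loop_code r h ([:: Ibinop OpAnd x r.+1 r.+1] ++ cctx a c r.+4 (h + 2 + 1))) h.
    by move: C3; rewrite /h addn1.
  have Hsm2 : small_after Lc (flatten [seq ctx_events inp L c a (set_nth 0 env x v)
      | v <- iota 0 (ve inp L env e)]).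
    by move: Hsm; rewrite /ctx_events /= ctx_events_flatten.
  have HZ2 : size (loop_code r h ([:: Ibinop OpAnd x r.+1 r.+1] ++ cctx a c r.+4 (h + 2 + 1))) <= Z.
    by apply: leq_trans HZ; rewrite size_cat /=; slia.
  have [i s3 Lc1 Hi _ _ Ri _ P3|t [s3 [T3 P3 R3 S3 L3]]] := @loop_spec a c x sc r h env Lc s2 (iota 0 (ve inp L env e))
    [:: Ibinop OpAnd x r.+1 r.+1] Z IH Hc x7 xsc Hsc r8 Nw Hvs _ C3' P2 R2r R2 ok2 He HL2 HA Hsm2 HZ2.
  + have [_ /code_at_cons[_ /code_at_cons[C4 _]]] := code_at_cons C3'.
    exists (exec w (Ibinop OpAnd x r.+1 r.+1) s3); split.
    * by apply: run_step; rewrite P3 addn2.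
    * by rewrite addn1 -P3; case: (s3).
    * rewrite nth_iota ?add0n -?Ri; last by rewrite size_iota in Hi; rewrite Ri.
      by case: (s3) => ???? /=; rewrite /update eqxx PeanoNat.Nat.land_diag.
    * by move=> y Hy _; case: (s3) => ???? /=; rewrite /update (negbTE Hy).
    * by case: (s3).
  exists (size (ce r e) + (1 + t)), s3; split.
  + by rewrite run_add T1 run_add T2.
  + by rewrite P3 size_cat /= /h; slia.
  + by move: R3; rewrite /ctx_events /= ctx_events_flatten.
  + move=> y Hy; rewrite S3 //; case: S2 => H _ _; rewrite H //.
    by case/orP: Hy => [/(allP Hsc)|] /=; slia.
  + apply: leq_trans (leq_add (leqnn _) (leq_add (leqnn _) L3)) _.
    rewrite -big_distrr /= mulnDr !addnA leq_add2r.
    have : size (ce r e) + 3 <= Z by apply: leq_trans HZ; rewrite size_cat /=; slia.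
    by slia.
- move=> /= /and4P[Hk x7 xsc Hc] Hsc r8 HC Hp Hok He HL HA Hsm HZ.
  have [C1 /code_at_cons[C2 /code_at_cons[C2' C3]]] := code_at_cat HC.
  have [|T1 P1] := @run_straight w P (kcell r.+3 k) s (straight_kcell _ _); first by rewrite Hp.
  have [Hka k8 _] := and3P Hk.
  have [R1 S1] := kcell_ok q_gt w_large Hsc (ltac:(slia) : 8 <= r.+3) Hok He Hka k8.
  set s1 := execs w _ s in T1 P1 R1 S1.
  set h := p + size (kcell r.+3 k) + 2 in C3 HC HZ *.
  set s2' := exec w (Iload r r.+3) s1; set s2 := exec w (Iconst r.+1 0) s2'.
  have T2 : run w P 2 s1 = s2.
    have T21 : run w P 1 s1 = s2' by apply: run_step; rewrite P1 Hp.
    rewrite (run_add w P 1 1) T21; apply: run_step.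
    by rewrite -C2' /s2' -Hp -P1; case: (s1).
  have P2 : pc s2 = h by rewrite /s2 /s2' /h -Hp -P1 addn2; case: (s1).
  have [S11 S12 S13] := S1.
  have S2 : [/\ forall y, y < r -> regs s2 y = regs s y, memory s2 = memory s & out s2 = out s].
    rewrite /s2 /s2'; case: (s1) S11 S12 S13 => p1 rg M o /= H1 H2 H3; split=> // y Hy.
    by rewrite /update !ltn_eqF ?H1 //; slia.
  have HL2 : rep q inp Lc s2 by case: S2 HL => _ Em Eo [??]; split; rewrite ?Em ?Eo.
  have ok2 : okreg q sc env s2 by apply: (okreg_same Hsc r8 _ Hok); exact: S2.
  have wk := chk_wfk q_gt w_large He Hk.
  have EL : Lc (vk env k) = L (vk env k) := chk_k_agree env HA Hk.
  have B1 := B_gt1 q_gt w_large.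
  have [Hlen Hvs] : (size (L (vk env k))).+1 < q /\ all (fun y => y < q) (L (vk env k)).
    by apply: L_ok; case/and3P: wk.
  have E1 : memory s1 (cell (q ^ 4) (vk env k) 0) = size (L (vk env k)).
    by rewrite S12 -EL; case: HL => -[H _] _; rewrite (H _ wk) //; slia.
  have R2 : regs s2 r.+1 = 0.
    by rewrite /s2; case: (s2') => p1 rg M o /=; rewrite /update eqxx /Defs.wrap mod0n.
  have R2r : regs s2 r = size (L (vk env k)).
    rewrite -E1 -R1 /s2 /s2'; case: (s1) => p1 rg M o /=; rewrite /update eqxx.
    by have -> : r == r.+1 = false by slia.
  have R23 : regs s2 r.+3 = cell (q ^ 4) (vk env k) 0.
    rewrite -R1 /s2 /s2'; case: (s1) => p1 rg M o /=; rewrite /update.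
    have -> : r.+3 == r.+1 = false by slia.
    by have -> : r.+3 == r = false by slia.
  have Nw : size (L (vk env k)) < 2 ^ w.
    by apply: (qpow_lt_w q_gt w_large (d:=1)); rewrite ?expn1 // ltnW.
  have C3' : code_at P (loop_code r h (fetch r x ++ cctx a c r.+4 (h + 2 + 4))) h.
    by move: C3; rewrite /h addn2.
  have Hsm2 : small_after Lc (flatten [seq ctx_events inp L c a (set_nth 0 env x v)
      | v <- L (vk env k)]).
    by move: Hsm; rewrite /ctx_events /= ctx_events_flatten.
  have HZ2 : size (loop_code r h (fetch r x ++ cctx a c r.+4 (h + 2 + 4))) <= Z.
    by apply: leq_trans HZ; rewrite size_cat /=; slia.
  have [i s3 Lc1 Hi HA1 HL1 Ri R3 P3|t [s3 [T3 P3 R3 S3 L3]]] := @loop_spec a c x sc r h env Lc s2 (L (vk env k))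
    (fetch r x) Z IH Hc x7 xsc Hsc r8 Nw Hvs _ C3' P2 R2r R2 ok2 He HL2 HA Hsm2 HZ2.
  + have [_ /code_at_cons[_ /code_at_cat[/code_at_cat[C4 _] _]]] := code_at_cons C3'.
    have [||T4 P4] := @run_straight w P (fetch r x) s3 => //; first by rewrite P3 addn2.
    exists (execs w (fetch r x) s3); split=> //; first by rewrite P4 P3.
    * have lt1 : 1 < 2 ^ w by apply: (qpow_lt_w q_gt w_large (d:=1)); rewrite ?expn1 //; slia.
      have Hi1 : i.+1 < q ^ 4 by have := qB q_gt w_large; slia.
      have c1 := cell_lt q_gt w_large wk Hi1.
      have c2 : i.+1 < 2 ^ w.
        by apply: leq_trans c1; rewrite /cell; slia.
      have cc : i.+1 + cell (q ^ 4) (vk env k) 0 = cell (q ^ 4) (vk env k) i.+1.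
        by rewrite /cell addn0 addnC.
      have M3 : memory s3 (cell (q ^ 4) (vk env k) i.+1) = nth 0 (L (vk env k)) i.
        by case: HL1 => -[H _] _; rewrite (H _ wk) //= (chk_k_agree env HA1 Hk).
      rewrite R23 in R3.
      case: (s3) Ri R3 M3 => p3 rg M o /= Ri R3 M3.
      have N1 : r.+1 == r.+2 = false by slia.
      have N3 : r.+3 == r.+2 = false by slia.
      rewrite /update !eqxx N1 N3 Ri R3 (wrap_small lt1) add1n (wrap_small c2).
      by rewrite cc (wrap_small c1) M3.
    * move=> y Hy Hy2; case: (s3) => ???? /=.
      by rewrite /update (negbTE Hy) (negbTE Hy2).
    * by case: (s3).
  exists (size (kcell r.+3 k) + (2 + t)), s3; split.
  + by rewrite run_add T1 run_add T2.
  + by rewrite P3 size_cat /= /h; slia.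
  + by move: R3; rewrite /ctx_events /= ctx_events_flatten.
  + move=> y Hy; rewrite S3 //; case: S2 => H _ _; rewrite H //.
    by case/orP: Hy => [/(allP Hsc)|] /=; slia.
  + apply: leq_trans (leq_add (leqnn _) (leq_add (leqnn _) L3)) _.
    rewrite -big_distrr /= mulnDr !addnA leq_add2r.
    have : size (kcell r.+3 k) + 4 <= Z by apply: leq_trans HZ; rewrite size_cat /=; slia.
    by slia.
- move=> /= /and5P[He1 dg x7 xsc Hc] Hsc r8 HC Hp Hok He HL HA Hsm HZ.
  have [C1 /code_at_cons[C2 C3]] := code_at_cat HC.
  have [s1 [T1 P1 R1 S1]] := run_ce Hsc r8 Hok He HL HA He1 C1 Hp.
  set p' := p + size (ce r e) + 1 in HC HZ *.
  set s2 := exec w (Ibinop OpAnd x r r) s1.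
  have T2 : run w P 1 s1 = s2 by apply: run_step; rewrite P1.
  have P2 : pc s2 = p' by rewrite /s2 /p' -P1 addn1; case: (s1).
  have [S11 S12 S13] := S1.
  have S2 : [/\ forall y, y < r -> y != x -> regs s2 y = regs s y, memory s2 = memory s & out s2 = out s].
    rewrite /s2; case: (s1) S11 S12 S13 => p1 rg M o /= H1 H2 H3; split=> // y Hy Hyx.
    by rewrite /update (negbTE Hyx) H1.
  have HL2 : rep q inp Lc s2 by case: S2 HL => _ Em Eo [??]; split; rewrite ?Em ?Eo.
  have R2 : regs s2 x = ve inp L env e.
    by rewrite -R1 /s2; case: (s1) => ???? /=; rewrite /update eqxx PeanoNat.Nat.land_diag.
  have [S21 _ _] := S2.
  have ok2 : okreg q (x :: sc) (set_nth 0 env x (ve inp L env e)) s2.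
    case: Hok => H1 H2; split=> [y|]; last by rewrite S21 // /RB; slia.
    rewrite inE nth_set_nth /=; case: eqP => [-> _|/eqP Hyx /= Hy] //.
    by rewrite S21 ?H1 //; have := allP Hsc _ Hy; slia.
  have Hlt : ve inp L env e < q.
    have [_ H] := chk_safe q_gt w_large inp_lt He L_ok He1.
    apply: leq_trans H _; rewrite -[leqRHS]expn1 leq_pexp2l //; slia.
  have He2 : all (fun y => y < q) (set_nth 0 env x (ve inp L env e)).
    by apply: all_set_nth => //; slia.
  have C3' : code_at P (cctx a c r p') p' by move: C3; rewrite /p' addn1.
  have HZ2 : size (cctx a c r p') <= Z by apply: leq_trans HZ; rewrite size_cat /=; slia.
  have Hsc2 : all (fun y => y < 7) (x :: sc) by rewrite /= x7.
  have [t [s3 [T3 P3 R3 S3 L3]]] := IH _ _ _ _ _ _ _ Hc Hsc2 r8 C3' P2 ok2 He2 HL2 HA Hsm HZ2.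
  exists (size (ce r e) + (1 + t)), s3; split.
  + by rewrite run_add T1 run_add T2.
  + by rewrite P3 size_cat /= /p'; slia.
  + exact: R3.
  + move=> y Hy; rewrite S3 ?S21 //.
    * by case/orP: Hy => [/(allP Hsc)|] /=; slia.
    * by apply: contraTneq Hy => ->; rewrite negb_or xsc /=; slia.
    * by rewrite inE; case/orP: Hy => ->; rewrite ?orbT.
  + rewrite mulnDr muln1 addnA leq_add //.
    by apply: leq_trans HZ; rewrite size_cat /=; slia.
Qed.

Transparent kcell.

End Simulation.

(** * Correctness of whole compiled programs *)

Section Compile.
Variables (w q : nat) (inp : seq nat).
Hypothesis q_gt : 728 < q.
Hypothesis w_large : word_large w q.
Hypothesis inp_lt : forall a, nth 0 inp a < q.

Lemma envs_lt W L a c sc env : Lok q L -> chk_c sc W c a ->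
  all (fun x => x < q) env -> all (all (fun x => x < q)) (envs inp L c env).
Proof.
move=> HL; have q0 : 0 < q by lia.
have Hfl (f : nat -> seq (seq nat)) vs : (forall v, v \in vs -> all (all (fun x => x < q)) (f v)) ->
    all (all (fun x => x < q)) (flatten [seq f v | v <- vs]).
  elim: vs => //= v vs IH H; rewrite all_cat H ?mem_head //=.
  by apply: IH => u Hu; apply: H; rewrite inE Hu orbT.
have Hlt sc' env' e : chk_e sc' W e -> deg e <= 1 -> all (fun x => x < q) env' -> ve inp L env' e < q.
  move=> Hc dg He; have [_ H] := chk_safe q_gt w_large inp_lt He HL Hc.
  by apply: leq_trans H _; rewrite -[leqRHS]expn1 leq_pexp2l.
elim: c sc env => [|b c IH] sc env /=; first by move=> _ ->.
case: b => [e|x e|x k|x e].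
- by move=> /andP[_ Hc] He; case: ifP => // _; exact: IH Hc He.
- move=> /and5P[He1 dg _ _ Hc] He; apply: Hfl => v; rewrite mem_iota add0n => Hv.
  by apply: IH Hc _; apply: all_set_nth => //; have := Hlt _ _ _ He1 dg He; lia.
- move=> /and4P[Hk _ _ Hc] He; apply: Hfl => v Hv.
  apply: IH Hc _; apply: all_set_nth => //.
  have [_ /allP] := HL (vk env k) ltac:(by case/and3P: (chk_wfk q_gt w_large He Hk)).
  by apply.
- by move=> /and5P[He1 dg _ _ Hc] He; apply: IH Hc _; apply: all_set_nth => //; exact: Hlt He1 dg He.
Qed.

Lemma events_lt W L a c sc env : Lok q L -> chk_c sc W c a ->
  all (fun x => x < q) env -> all (fun e => e.2 < q) (ctx_events inp L c a env).
Proof.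
move=> HL Hc He; have := envs_lt HL Hc He; have [sc' Ha] := chk_c_acts Hc.
rewrite /ctx_events; elim: (envs _ _ _ _) => //= e E IH /andP[H1 /IH H2].
rewrite all_cat H2 andbT.
elim: a Ha {IH H2 Hc} => //= -[k v] a IH /andP[/andP[/= Hv _] /IH->]; rewrite andbT.
exact: (va_lt q_gt w_large H1 Hv).
Qed.

Lemma all_at_key k E : all (fun e => e.2 < q) E -> all (fun x => x < q) (at_key k E).
Proof.
rewrite /at_key all_map => /allP H; apply/allP => e; rewrite mem_filter => /andP[_].
exact: H.
Qed.

Lemma agree_start L0 L r rs : chk_rules (r :: rs) ->
  (forall k, L k = L0 k ++ at_key k (rules_events inp L (r :: rs))) ->
  agree (wtags (r :: rs)) L0 L.
Proof. by move=> H HL k Hk; rewrite HL (at_key_rules_fresh _ _ H Hk) cats0. Qed.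

(** The bound on entries is carried from rule to rule: the events of a rule can be computed from the
    table before it, whose lists are prefixes of those of [L] and hence short, and whose entries are
    bounded already. *)
Lemma table_elems rs L0 L : chk_rules rs ->
  (forall k, L k = L0 k ++ at_key k (rules_events inp L rs)) ->
  (forall k, k != [::] -> (size (L k)).+1 < q) ->
  (forall k, all (fun x => x < q) (L0 k)) ->
  forall k, all (fun x => x < q) (L k).
Proof.
elim: rs L0 => [|r rs IH] L0 Hc HL Hsz H0 k.
  by rewrite HL cats0.
have HA := agree_start Hc HL; move: Hc => /= /andP[H1 H2].
apply: (IH (addev L0 (rule_events inp L r))) => // k'.
  by rewrite HL /rules_events /= at_key_cat catA.
rewrite /addev all_cat H0 /=; apply: all_at_key.
rewrite /rule_events /ctx_events -(envs_agree _ _ HA H1).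
have HL0 : Lok q L0.
  move=> k1 Hk1; split=> //; have := Hsz k1 Hk1; rewrite HL size_cat; lia.
by apply: (events_lt HL0 H1); rewrite /env0 /=; lia.
Qed.

Lemma crules_ok P L rs : Lok q L -> forall L0 s p Z, chk_rules rs ->
  code_at P (crules rs p) p -> pc s = p -> regs s RB = q ^ 4 ->
  rep q inp L0 s ->
  (forall k, L k = L0 k ++ at_key k (rules_events inp L rs)) ->
  size (crules rs p) <= Z ->
  exists t s', [/\ run w P t s = s', pc s' = p + size (crules rs p),
    rep q inp L s' & t <= Z * \sum_(r <- rs) rule_cost inp L r].
Proof.
move=> HLok; elim: rs => [|r rs IH] L0 s p Z Hc HC Hp Hr HR HL HZ.
  exists 0, s; split=> //; first by rewrite Hp addn0.
  by apply: rep_ext HR => k; rewrite HL cats0.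
have HA := agree_start Hc HL; move: Hc HC HZ => /= /andP[H1 H2] /code_at_cat[C1 C2] HZ.
have HL' k : L k = addev L0 (rule_events inp L r) k ++ at_key k (rules_events inp L rs).
  by rewrite HL /rules_events /= at_key_cat catA.
have Hsm : small_after q L0 (ctx_events inp L r.1 r.2 env0).
  by move=> k Hk; have [] := HLok k Hk; rewrite HL' /addev /rule_events !size_cat; lia.
have ok0 : okreg q [::] env0 s by split.
have He0 : all (fun x => x < q) env0 by rewrite /env0 /=; lia.
have HZ1 : size (cctx r.2 r.1 8 p) <= Z by apply: leq_trans HZ; rewrite size_cat; lia.
have [t [s1 [T1 P1 R1 S1 L1]]] := @cctx_ok w P q inp q_gt w_large inp_lt _ L HLok r.2 r.1
  [::] 8 p env0 L0 s Z H1 isT isT C1 Hp ok0 He0 HR HA Hsm HZ1.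
have HZ2 : size (crules rs (p + size (cctx r.2 r.1 8 p))) <= Z.
  by apply: leq_trans HZ; rewrite size_cat; lia.
have Hr1 : regs s1 RB = q ^ 4 by rewrite S1.
have [t' [s2 [T2 P2 R2 L2]]] := IH _ s1 _ Z H2 C2 P1 Hr1 R1 HL' HZ2.
exists (t + t'), s2; split=> //.
- by rewrite run_add T1.
- by rewrite P2 size_cat addnA.
- by rewrite big_cons mulnDr leq_add.
Qed.

Lemma mul_loop j s B n : regs s RB = B -> regs s 8 = n -> B * n ^ j < 2 ^ w -> 0 < n ->
  let s' := execs w (nseq j (Ibinop OpMul RB RB 8)) s in
  [/\ regs s' RB = B * n ^ j, Defs.mem s' = Defs.mem s & out s' = out s].
Proof.
elim: j s B => [|j IH] s B HB Hn Hlt n0 /=; first by rewrite expn0 muln1.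
set s1 := exec w _ s.
have lt1 : B * n < 2 ^ w.
  by apply: leq_ltn_trans Hlt; rewrite expnS mulnA leq_pmulr // expn_gt0 n0.
have [||||H1 H2 H3] := IH s1 (B * n).
- by rewrite /s1; case: (s) HB Hn => ???? /= -> ->; rewrite /update eqxx wrap_small.
- by rewrite /s1 -Hn; case: (s).
- by rewrite -mulnA -expnS.
- exact: n0.
split; first by rewrite H1 -mulnA -expnS.
- by rewrite H2 /s1; case: (s).
- by rewrite H3 /s1; case: (s).
Qed.
End Compile.

Lemma execs_preamble w s : execs w preamble s = execs w (nseq 24 (Ibinop OpMul RB RB 8))
  (execs w [:: Iconst 8 0; Iload 8 8; Iconst RB 1] s).
Proof. exact: (execs_cat w [:: Iconst 8 0; Iload 8 8; Iconst RB 1]). Qed.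

Theorem compile_ok w n inp rs L : 2 < n -> nth 0 inp 0 = n -> size inp <= n ^ 24 ->
  (forall a, nth 0 inp a < n ^ 6) -> n ^ 241 <= 2 ^ w -> chk_rules rs ->
  (forall k, L k = at_key k (rules_events inp L rs)) ->
  (forall k, k != [::] -> (size (L k)).+1 < n ^ 6) ->
  exists t, let final := run w (compile rs) t (init w inp) in
    [/\ halted (compile rs) final, out final = L [::] &
        t <= size (compile rs) * (1 + \sum_(r <- rs) rule_cost inp L r)].
Proof.
move=> n3 In Isz Ilt Hw Hrs HL Hsz.
have n0 : 0 < n by lia.
set q := n ^ 6 in Ilt Hsz.
have q_gt : 728 < q.
  have -> : 728 = (3 ^ 6).-1 by [].
  by have : 3 ^ 6 <= q by rewrite leq_exp2r.
have qB : q ^ 4 = n ^ 24 by rewrite /q -expnM.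
have w_large : word_large w q.
  rewrite /word_large.
  (* Here [n ^ 241] is [n * (n ^ 24) ^ 10], and its first factor pays for the 2 in [word_large]. *)
  apply: leq_trans Hw; rewrite qB -expnM expnS leq_mul2r; apply/orP; right; lia.
clear Hw; have nq : n < q ^ 1.
  by rewrite expn1 /q -[ltnLHS]expn1 ltn_exp2l //; lia.
clearbody q; have HLok : Lok q L.
  move=> k Hk; split; first exact: Hsz.
  by apply: (table_elems q_gt w_large Ilt Hrs (L0 := fun=> [::])).
have B0 : 0 < q ^ 4 by rewrite expn_gt0 (leq_trans _ q_gt).
set P := compile rs.
have C0 : code_at P P 0 by move=> i _; rewrite add0n.
have [C1 C2] := code_at_cat C0.
set s0 := init w inp.
have [|T1 P1] := @run_straight w P preamble s0 _ C1; first by [].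
set s1 := execs w preamble s0 in T1 P1.
have nw : n < 2 ^ w by exact: (@qpow_lt_w w q q_gt w_large 1 n isT nq).
have lt1 : 1 < 2 ^ w by apply: leq_ltn_trans nw; apply: ltnW; apply: ltnW.
have wlt a : nth 0 inp a < 2 ^ w.
  by apply: (@qpow_lt_w w q q_gt w_large 1 _ isT); rewrite expn1.
have [||||R1 M1 O1] := @mul_loop w 24 (execs w [:: Iconst 8 0; Iload 8 8; Iconst RB 1] s0) 1 n.
- by rewrite /= /update /=; exact: wrap_small lt1.
- by rewrite /= /update /= {2}/Defs.wrap mod0n In; exact: wrap_small nw.
- rewrite mul1n -qB; apply: (pow_lt_w q_gt w_large (isT : 1 <= 10)).
  by rewrite expn1 mul2n -addnn -[ltnLHS]addn0 ltn_add2l.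
- exact: n0.
rewrite mul1n -qB in R1.
have Hs1 : s1 = execs w (nseq 24 (Ibinop OpMul RB RB 8))
    (execs w [:: Iconst 8 0; Iload 8 8; Iconst RB 1] s0).
  exact: execs_preamble.
rewrite -Hs1 in R1 M1 O1; clearbody s1.
have rep1 : rep q inp (fun=> [::]) s1.
  split; last by rewrite O1.
  rewrite M1 /=; split=> [k wk j jB|a aB]; last by rewrite wrap_small.
  (* The cells of tables start at [n ^ 24], where the input has ended, so all lists are empty at the
     start. *)
  rewrite nth_default; first by rewrite /Defs.wrap mod0n; case: j {jB} => [|[]].
  by apply: leq_trans Isz _; rewrite -qB; exact: cell_ge.
have HL' k : L k = [::] ++ at_key k (rules_events inp L rs) by rewrite HL.
have HZ : size (crules rs (size preamble)) <= size P by rewrite /P /compile size_cat; lia.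
have [t [s2 [T2 P2 [_ R2] L2]]] := @crules_ok w q inp q_gt w_large Ilt P L rs HLok _ s1 _ (size P)
  Hrs C2 P1 R1 rep1 HL' HZ.
exists (size preamble + t); rewrite run_add T1 T2; split.
- by rewrite /halted P2 /P /compile size_cat.
- by rewrite R2.
- rewrite mulnDr muln1 leq_add // /P /compile size_cat; lia.
Qed.

Module Walks.
(** * Counting lemmas *)

Section Counting.
Variable T : finType.
Implicit Types (P Q : pred T) (F : T -> nat).

Lemma sum_rem P z : \sum_(x | P x) 1 <= 1 + \sum_(x | P x && (x != z)) 1.
Proof.
rewrite (bigID (pred1 z)) /= leq_add2r.
apply: leq_trans (_ : \sum_(x | x == z) 1 <= _); last by rewrite big_pred1_eq.
by rewrite [leqLHS]big_mkcond [leqRHS]big_mkcond; apply: leq_sum => x _; case: (P x); case: eqP.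
Qed.

Lemma sum_rem2 P y z :
  \sum_(x | P x) 1 <= 2 + \sum_(x | [&& P x, x != y & x != z]) 1.
Proof.
apply: leq_trans (sum_rem P y) _; rewrite -[2]/(1 + 1) -addnA leq_add2l.
apply: leq_trans (sum_rem _ z) _; rewrite leq_add2l.
by rewrite (eq_bigl (fun x => [&& P x, x != y & x != z])) // => x; rewrite andbA.
Qed.

Lemma sum_rem3 P y z t :
  \sum_(x | P x) 1 <= 3 + \sum_(x | [&& P x, x != y, x != z & x != t]) 1.
Proof.
apply: leq_trans (sum_rem2 P y z) _; rewrite -[3]/(2 + 1) -addnA leq_add2l.
apply: leq_trans (sum_rem _ t) _; rewrite leq_add2l.
by rewrite (eq_bigl (fun x => [&& P x, x != y, x != z & x != t])) // => x; rewrite !andbA.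
Qed.

Lemma sum_subpred P Q F : (forall x, P x -> Q x) -> \sum_(x | P x) F x <= \sum_(x | Q x) F x.
Proof.
move=> H; rewrite [leqLHS]big_mkcond [leqRHS]big_mkcond; apply: leq_sum => x _.
by case: ifP => // /H->.
Qed.

(** Count ordered triples of distinct elements whose first two are related. Such a triple is a
    triangle of [R], or its third element is unrelated to one of the other two. Among [d] elements
    every pair has [d - 2] third elements, and cancelling this factor gives the bound; the final 2
    covers [d <= 2]. *)
Lemma fat_pairs P (R : rel T) : symmetric R ->
  \sum_(a | P a) \sum_(b | P b && (b != a)) R a b <=
  \sum_(a | P a) \sum_(b | P b && (b != a))
     \sum_(c | [&& P c, c != a & c != b]) [&& R a b, R a c & R b c] +
  2 * (\sum_(a | P a) \sum_(b | P b && (b != a)) ~~ R a b) + 2.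
Proof.
move=> Rs; set f := leqLHS; set tau := \sum_(a | P a) \sum_(b | _) \sum_(c | _) _.
set h := \sum_(a | P a) \sum_(b | _) _; set d := \sum_(x | P x) 1.
have dc a b : P a -> P b -> b != a -> \sum_(c | [&& P c, c != a & c != b]) 1 = d - 2.
  move=> Pa Pb ba; have -> : d = (\sum_(c | [&& P c, c != a & c != b]) 1).+2; last by rewrite subn2.
  rewrite /d (bigD1 a) //= (bigD1 b) ?Pb //= add1n; congr _.+2.
  by apply: eq_bigl => c; rewrite andbA.
have [d2|d2] := leqP d 2.
  apply: leq_trans (leq_addl _ _).
  apply: leq_trans (_ : \sum_(a | P a) 1 <= _); last exact: d2.
  apply: leq_sum => a Pa.
  apply: leq_trans (_ : \sum_(b | P b && (b != a)) 1 <= _).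
    by apply: leq_sum => b _; case: (R a b).
  by move: d2; rewrite /d (bigD1 a) //= add1n ltnS.
suff H : f * (d - 2) <= (tau + 2 * h) * (d - 2).
  by move: H; rewrite leq_mul2r subn_eq0 leqNgt d2 /= => H; apply: leq_trans H (leq_addr _ _).
have Hf : f * (d - 2) = \sum_(a | P a) \sum_(b | P b && (b != a))
     \sum_(c | [&& P c, c != a & c != b]) R a b.
  rewrite big_distrl; apply: eq_bigr => a Pa; rewrite big_distrl; apply: eq_bigr => b /andP[Pb ba].
  by rewrite /= -(dc a b) // big_distrr /=; apply: eq_bigr => c _; rewrite muln1.
have Hh : h * (d - 2) = \sum_(a | P a) \sum_(b | P b && (b != a))
     \sum_(c | [&& P c, c != a & c != b]) ~~ R a b.
  rewrite big_distrl; apply: eq_bigr => a Pa; rewrite big_distrl; apply: eq_bigr => b /andP[Pb ba].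
  by rewrite /= -(dc a b) // big_distrr /=; apply: eq_bigr => c _; rewrite muln1.
have Hh2 : h * (d - 2) = \sum_(a | P a) \sum_(b | P b && (b != a))
     \sum_(c | [&& P c, c != a & c != b]) ~~ R a c.
  rewrite Hh; apply: eq_bigr => a Pa.
  rewrite (exchange_big_dep (fun c => P c && (c != a))) /=; last first.
    by move=> b c _ /and3P[-> ->].
  apply: eq_bigr => b /andP[Pb ba]; apply: eq_bigl => c.
  by rewrite Pb ba /= -andbA [c == b]eq_sym.
have Hh3 : h * (d - 2) = \sum_(a | P a) \sum_(b | P b && (b != a))
     \sum_(c | [&& P c, c != a & c != b]) ~~ R b c.
  rewrite Hh2 (exchange_big_dep P) /=; last by move=> a b _ /andP[].
  apply: eq_bigr => b Pb; apply: eq_big => [a|a _]; first by rewrite Pb eq_sym.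
  by apply: eq_bigl => c; rewrite [in RHS]andbCA andbA andbC andbA [RHS]andbC andbA; case: (P c); rewrite ?andbF ?andbT //= andbC.
apply: leq_trans (_ : tau + (h * (d - 2) + h * (d - 2)) <= _); last first.
  by rewrite mulnDl mul2n -addnn mulnDl leq_add2r leq_pmulr // subn_gt0.
rewrite Hf {1}Hh2 Hh3 /tau -!big_split /=; apply: leq_sum => a Pa.
rewrite -!big_split /=; apply: leq_sum => b _.
rewrite -!big_split /=; apply: leq_sum => c _.
by case: (R a b); case: (R a c); case: (R b c).
Qed.

(* A family of [e] items, each in conflict with at most [r] others, has few
   items or many non-conflicting pairs. *)
Lemma few_or_many e r v : e * e <= r * e + v -> e <= r + v.
Proof.
move=> H; have [er|re] := leqP e r; first by apply: leq_trans er (leq_addr _ _).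
have : e * (e - r) <= v by rewrite mulnBr [e * r]mulnC; lia.
have : e <= e * (e - r) by rewrite leq_pmulr // subn_gt0.
by lia.
Qed.
End Counting.

(** * Classification of walks *)

Definition thr := 6.

Section Graph.
Variables (T : finType) (e : rel T) (D : nat).
Hypothesis e_sym : symmetric e.
Hypothesis e_irr : irreflexive e.

Definition dg x := \sum_(y | e x y) 1.
Definition heavy x := D * D < dg x.
Definition inS x := D < dg x.
Definition poor x y := ~~ (D * D * D < dg x * dg y).

Definition twalk x0 x1 x2 := [&& e x0 x1, e x1 x2 & x0 != x2].
Definition U k x0 x1 x2 : bool := twalk x0 x1 x2 &&
  (if k == 0 then poor x1 x2 else if k == 1 then heavy x0
   else [&& inS x0, inS x1 & inS x2]).
Definition cd k x0 x2 := \sum_(x1 | U k x0 x1 x2) 1.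
Definition fatp k x0 x2 := ~~ (cd k x0 x2 < thr).
Definition Ad k x2 x3 := e x2 x3 && ((k == 2) ==> inS x2 && inS x3).
Definition Yt k x0 x2 x3 := [&& fatp k x0 x2, Ad k x2 x3 & x3 != x0].
(** In kind 2 the second 2-walk has to be thin as well. Then x1 has few choices for given x0, x2,
    x3, and x2 has few choices for given x0, x1, x3, so that a thin item of kind 2 collides with
    boundedly many others. *)
Definition Xt k x1 x2 x3 :=
  if k == 2 then U 2 x1 x2 x3 && ~~ fatp 2 x1 x3 else e x2 x3.
Definition Et k x0 x1 x2 x3 :=
  [&& U k x0 x1 x2, ~~ fatp k x0 x2, Xt k x1 x2 x3, x3 != x0 & x3 != x1].
(** Thin items of a bucket are grouped by x1. In kinds 0 and 1 the x2 belonging to one x1 are not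
    bounded in number, so collisions at x1 have to be rejected once per group; collisions at x2 are
    few by [Et_deg] and can be rejected one by one. *)
Definition Gt k x0 x3 x1 := [exists x2, Et k x0 x1 x2 x3].
(** Consecutive vertices differ since [e] is irreflexive, so only the nine other pairs are
    compared. *)
Definition Vc x0 x1 x2 x3 x4 x5 : bool :=
  [&& [&& e x0 x1, e x1 x2, e x2 x3, e x3 x4, e x4 x5 & e x5 x0],
      [&& x0 != x2, x0 != x3, x0 != x4, x1 != x3 & x1 != x4] &
      [&& x1 != x5, x2 != x4, x2 != x5 & x3 != x5]].
Definition TT := \sum_x0 \sum_x1 \sum_x2 \sum_x3 \sum_x4 \sum_x5 Vc x0 x1 x2 x3 x4 x5.

Lemma U_twalk k x0 x1 x2 : U k x0 x1 x2 -> [/\ e x0 x1, e x1 x2 & x0 != x2].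
Proof. by case/andP=> /and3P[]. Qed.

Lemma U2_sym x0 x1 x2 : U 2 x0 x1 x2 = U 2 x2 x1 x0.
Proof.
rewrite /U /twalk /= e_sym [e x1 x2]e_sym [x0 == x2]eq_sym.
by case: (e x1 x0); case: (e x2 x1); case: (x2 != x0); case: (inS x0); case: (inS x1); case: (inS x2).
Qed.

Lemma cd2_sym x0 x2 : cd 2 x0 x2 = cd 2 x2 x0.
Proof. by apply: eq_bigl => x1; rewrite U2_sym. Qed.

Lemma fatp2_sym x0 x2 : fatp 2 x0 x2 = fatp 2 x2 x0.
Proof. by rewrite /fatp cd2_sym. Qed.

Lemma fatp_ge k x0 x2 : fatp k x0 x2 -> 6 <= cd k x0 x2.
Proof. by rewrite /fatp -leqNgt. Qed.

Lemma Ad_e k x y : Ad k x y -> e x y. Proof. by case/andP. Qed.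

Lemma e_neq x y : e x y -> x != y.
Proof. by apply: contraTneq => ->; rewrite e_irr. Qed.

Lemma Et_path k x0 x1 x2 x3 : Et k x0 x1 x2 x3 ->
  [/\ e x0 x1, e x1 x2, e x2 x3 & [/\ x0 != x2, x3 != x0 & x3 != x1]].
Proof.
case/and5P=> /U_twalk[a b c] _ Hx d f; split=> //.
by move: Hx; rewrite /Xt; case: ifP => // _ /andP[/U_twalk[]].
Qed.

(** * Pairs of items in a bucket *)

(** A middle x1 has to avoid x3 and x4, then x5 has to avoid x2, x3 and x1. As both numbers of
    middles are at least 6, at least two thirds and one half of the choices remain, which explains
    the factor 3. *)
Lemma YY_valid k k' x0 x2 x3 x4 : Yt k x0 x2 x3 -> Yt k' x0 x4 x3 -> x4 != x2 ->
  cd k x0 x2 * cd k' x0 x4 <= 3 * \sum_x1 \sum_x5 Vc x0 x1 x2 x3 x4 x5.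
Proof.
case/and3P=> F1 /Ad_e A1 N1 /and3P[F2 /Ad_e A2 _] N2.
set c1 := cd k x0 x2; set c2 := cd k' x0 x4.
have H1 := fatp_ge F1; have H2 := fatp_ge F2.
pose Q1 x1 := [&& U k x0 x1 x2, x1 != x3 & x1 != x4].
pose Q2 x1 x5 := [&& U k' x0 x5 x4, x5 != x2, x5 != x3 & x5 != x1].
have L1 : c1 <= 2 + \sum_(x1 | Q1 x1) 1 by exact: sum_rem2.
have L2 x1 : c2 <= 3 + \sum_(x5 | Q2 x1 x5) 1 by exact: sum_rem3.
have L3 : (\sum_(x1 | Q1 x1) 1) * (c2 - 3) <= \sum_x1 \sum_x5 Vc x0 x1 x2 x3 x4 x5.
  rewrite big_distrl /= [leqLHS]big_mkcond; apply: leq_sum => x1 _; case: ifP => // /and3P[].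
  move=> /U_twalk[a1 a2 a3] a4 a5; rewrite mul1n.
  apply: leq_trans (_ : \sum_(x5 | Q2 x1 x5) 1 <= _); first by have := L2 x1; lia.
  rewrite big_mkcond; apply: leq_sum => x5 _; case: ifP => // /and4P[/U_twalk[b1 b2 b3] b4 b5 b6].
  rewrite /Vc a1 a2 A1 a3 a4 a5 b3 /= [e x3 x4]e_sym A2 [e x4 x5]e_sym b2 [e x5 x0]e_sym b1 /=.
  by rewrite ![x0 == x3]eq_sym N1 [x1 == x5]eq_sym b6 [x2 == x4]eq_sym N2 [x2 == x5]eq_sym b4 [x3 == x5]eq_sym b5.
move: H1 H2 L1 L3; rewrite -/c1 -/c2; move: (\sum_(x1 | Q1 x1) 1) (\sum_x1 _) => s1 s2.
by clear; nia.
Qed.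

Lemma YE_valid k k' x0 x2 x3 x4 x5 : Yt k x0 x2 x3 -> Et k' x0 x5 x4 x3 ->
  x5 != x2 -> x4 != x2 -> cd k x0 x2 <= 2 * \sum_x1 Vc x0 x1 x2 x3 x4 x5.
Proof.
case/and3P=> F1 /Ad_e A1 N1 /Et_path[b1 b2 b3 [b4 b5 b6]] N2 N3.
set c1 := cd k x0 x2; have H1 := fatp_ge F1.
pose Q1 x1 := [&& U k x0 x1 x2, x1 != x3, x1 != x4 & x1 != x5].
have L1 : c1 <= 3 + \sum_(x1 | Q1 x1) 1 by exact: sum_rem3.
apply: leq_trans (_ : 2 * \sum_(x1 | Q1 x1) 1 <= _); first by move: H1 L1; rewrite -/c1; clear; lia.
rewrite leq_mul2l /= big_mkcond; apply: leq_sum => x1 _; case: ifP => // /and4P[/U_twalk[a1 a2 a3] a4 a5 a6].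
rewrite /Vc a1 a2 A1 [e x3 x4]e_sym b3 [e x4 x5]e_sym b2 [e x5 x0]e_sym b1 a3 a4 a5 a6 /=.
by rewrite [x0 == x3]eq_sym N1 b4 [x2 == x4]eq_sym N3 [x2 == x5]eq_sym N2 b6.
Qed.

Lemma EE_valid k k' x0 x1 x2 x3 x4 x5 : Et k x0 x1 x2 x3 -> Et k' x0 x5 x4 x3 ->
  x5 != x1 -> x5 != x2 -> x4 != x1 -> x4 != x2 -> Vc x0 x1 x2 x3 x4 x5.
Proof.
move=> /Et_path[a1 a2 a3 [a4 a5 a6]] /Et_path[b1 b2 b3 [b4 b5 b6]] N1 N2 N3 N4.
rewrite /Vc a1 a2 a3 [e x3 x4]e_sym b3 [e x4 x5]e_sym b2 [e x5 x0]e_sym b1 a4 b4 /=.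
rewrite [x0 == x3]eq_sym a5 [x1 == x3]eq_sym a6 [x1 == x4]eq_sym N3 [x1 == x5]eq_sym N1.
by rewrite [x2 == x4]eq_sym N4 [x2 == x5]eq_sym N2 b6.
Qed.

Lemma Et_deg k x0 x2 x3 : \sum_x1 Et k x0 x1 x2 x3 <= thr.
Proof.
have [F|F] := boolP (fatp k x0 x2).
  by rewrite big1 // => x1 _; rewrite /Et F andbF.
apply: leq_trans (_ : cd k x0 x2 <= _); last by move: F; rewrite /fatp negbK => /ltnW.
rewrite /cd [leqRHS]big_mkcond; apply: leq_sum => x1 _.
by rewrite /Et; case: (U k x0 x1 x2); rewrite /= ?leq_b1.
Qed.

Lemma Et2_deg x0 x1 x3 : \sum_x2 Et 2 x0 x1 x2 x3 <= thr.
Proof.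
have [F|F] := boolP (fatp 2 x1 x3).
  by rewrite big1 // => x2 _; rewrite /Et /Xt /= F !andbF.
apply: leq_trans (_ : cd 2 x1 x3 <= _); last by move: F; rewrite /fatp negbK => /ltnW.
rewrite /cd [leqRHS]big_mkcond; apply: leq_sum => x2 _.
by rewrite /Et /Xt /=; case: (U 2 x1 x2 x3); rewrite ?leq_b1 //= !andbF.
Qed.

Definition Vb x0 x3 := \sum_x1 \sum_x2 \sum_x4 \sum_x5 Vc x0 x1 x2 x3 x4 x5.

Lemma sum_Vb : \sum_x0 \sum_x3 Vb x0 x3 = TT.
Proof.
apply: eq_bigr => x0 _; rewrite exchange_big; apply: eq_bigr => x1 _.
by rewrite exchange_big.
Qed.

Definition sS := \sum_x inS x.

(** Two distinct fat items of a bucket always yield a 6-cycle, so an item is in conflict with itself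
    only and [few_or_many] applies with 1. *)
Lemma Y2_bucket x0 x3 : \sum_x2 Yt 2 x0 x2 x3 <= inS x0 * inS x3 + Vb x0 x3.
Proof.
set f := \sum_x2 _.
have [S0|S0] := boolP (inS x0 && inS x3); last first.
  rewrite /f big1 // => x2 _; apply/eqP; rewrite eqb0; apply: contra S0.
  case/and3P=> /fatp_ge F /andP[_ /= /andP[_ ->]] _; rewrite andbT.
  apply: contraLR F => N; rewrite /cd big1 // => x1.
  by rewrite /U /= (negbTE N) andbF.
have -> : inS x0 * inS x3 = 1 by case/andP: S0 => -> ->.
apply: few_or_many; rewrite mul1n.
have -> : f * f = \sum_x2 \sum_x4 (Yt 2 x0 x2 x3 * Yt 2 x0 x4 x3).
  by rewrite big_distrl; apply: eq_bigr => x2 _; rewrite big_distrr.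
have -> : Vb x0 x3 = \sum_x2 \sum_x4 \sum_x1 \sum_x5 Vc x0 x1 x2 x3 x4 x5.
  by rewrite /Vb exchange_big; apply: eq_bigr => x2 _; rewrite exchange_big.
rewrite -big_split; apply: leq_sum => x2 _ /=.
rewrite (bigD1 x2) //= leq_add //; first by case: (Yt 2 x0 x2 x3).
apply: leq_trans (_ : \sum_(x4 | x4 != x2) \sum_x1 \sum_x5 Vc x0 x1 x2 x3 x4 x5 <= _); last first.
  by apply: sum_subpred.
apply: leq_sum => x4 N; case Y1: (Yt 2 x0 x2 x3); case Y2: (Yt 2 x0 x4 x3) => //.
have := YY_valid Y1 Y2 N; case/and3P: Y1 => /fatp_ge F1 _ _; case/and3P: Y2 => /fatp_ge F2 _ _.
move: F1 F2; move: (cd _ _ _) (cd _ _ _) (\sum_x1 _) => a b c; clear; nia.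
Qed.

Lemma Y2_total : \sum_x0 \sum_x3 \sum_x2 Yt 2 x0 x2 x3 <= sS * sS + TT.
Proof.
rewrite -sum_Vb.
have -> : sS * sS = \sum_x0 \sum_x3 inS x0 * inS x3.
  by rewrite big_distrl; apply: eq_bigr => x2 _; rewrite big_distrr.
rewrite -big_split; apply: leq_sum => x0 _; rewrite -big_split; apply: leq_sum => x3 _.
exact: Y2_bucket.
Qed.

Lemma pair_split k k' x0 x1 x2 x3 (v : nat) x4 x5 :
  Et k x0 x1 x2 x3 * Et k' x0 x5 x4 x3 <=
  Et k x0 x1 x2 x3 * (Et k' x0 x5 x4 x3 * (x5 == x1) + Et k' x0 x5 x4 x3 * (x5 == x2)
   + Et k' x0 x5 x4 x3 * (x4 == x1) + Et k' x0 x5 x4 x3 * (x4 == x2)) + Vc x0 x1 x2 x3 x4 x5.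
Proof.
case E1: (Et k x0 x1 x2 x3) => //; case E2: (Et k' x0 x5 x4 x3) => //.
rewrite !mul1n.
case: eqP => [|/eqP N1]; first by lia.
case: eqP => [|/eqP N2]; first by lia.
case: eqP => [|/eqP N3]; first by lia.
case: eqP => [|/eqP N4]; first by lia.
by rewrite (EE_valid E1 E2).
Qed.

Lemma sum_diag (f : T -> nat) z : \sum_x f x * (x == z) = f z.
Proof.
by rewrite (bigD1 z) //= eqxx muln1 big1 ?addn0 // => x /negbTE->; rewrite muln0.
Qed.

(** A second thin item conflicts if x5 or x4 equals x1 or x2. Each of the four coincidences leaves
    one vertex free, with at most [thr] choices by [Et2_deg] when x5 is fixed and by [Et_deg] when
    x4 is fixed. Then [few_or_many] applies. *)
Lemma E2_bucket x0 x3 :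
  \sum_x1 \sum_x2 Et 2 x0 x1 x2 x3 <= 4 * thr * (inS x0 * inS x3) + Vb x0 x3.
Proof.
set f := \sum_x1 _.
have [S0|S0] := boolP (inS x0 && inS x3); last first.
  rewrite /f big1 // => x1 _; rewrite big1 // => x2 _; apply/eqP; rewrite eqb0; apply: contra S0.
  case/and5P=> /andP[_ /and3P[-> _ _]] _; rewrite /Xt /= => /andP[/andP[_ /and3P[_ _ ->]]].
  by [].
have -> : inS x0 * inS x3 = 1 by case/andP: S0 => -> ->.
apply: few_or_many; rewrite muln1.
have -> : f * f = \sum_x1 \sum_x2 \sum_x4 \sum_x5 (Et 2 x0 x1 x2 x3 * Et 2 x0 x5 x4 x3).
  rewrite big_distrl; apply: eq_bigr => x1 _; rewrite big_distrl; apply: eq_bigr => x2 _ /=.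
  rewrite {1}/f exchange_big big_distrr; apply: eq_bigr => x4 _; rewrite big_distrr.
  by [].
rewrite /f big_distrr -big_split; apply: leq_sum => x1 _ /=.
rewrite big_distrr -big_split; apply: leq_sum => x2 _ /=.
apply: leq_trans (_ : \sum_x4 \sum_x5 (Et 2 x0 x1 x2 x3 * (Et 2 x0 x5 x4 x3 * (x5 == x1) + Et 2 x0 x5 x4 x3 * (x5 == x2)
   + Et 2 x0 x5 x4 x3 * (x4 == x1) + Et 2 x0 x5 x4 x3 * (x4 == x2)) + Vc x0 x1 x2 x3 x4 x5) <= _).
  by apply: leq_sum => x4 _; apply: leq_sum => x5 _; exact: pair_split 0 _ _.
under eq_bigr do rewrite big_split /= -big_distrr /=.
rewrite big_split /= leq_add2r -big_distrr /= mulnC leq_mul2r; apply/orP; right.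
under eq_bigr do rewrite !big_split /= !sum_diag -!big_distrl /=.
rewrite !big_split /= !sum_diag.
have := Et2_deg x0 x1 x3; have := Et2_deg x0 x2 x3.
by have := Et_deg 2 x0 x1 x3; have := Et_deg 2 x0 x2 x3; lia.
Qed.

Lemma E2_total : \sum_x0 \sum_x3 \sum_x1 \sum_x2 Et 2 x0 x1 x2 x3 <= 4 * thr * (sS * sS) + TT.
Proof.
rewrite -sum_Vb.
have -> : sS * sS = \sum_x0 \sum_x3 inS x0 * inS x3.
  by rewrite big_distrl; apply: eq_bigr => x2 _; rewrite big_distrr.
rewrite big_distrr -big_split; apply: leq_sum => x0 _ /=.
rewrite big_distrr -big_split; apply: leq_sum => x3 _.
exact: E2_bucket.
Qed.

(** Connect a, b, c cyclically by middles of the three fat pairs. Nearly every middle of a and b can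
    be completed, in at least two ways, so that the cycles outnumber the common middles of a and
    b. *)
Lemma triple_cycles a b c : b != a -> c != a -> c != b ->
  fatp 2 a b -> fatp 2 a c -> fatp 2 b c ->
  cd 2 a b <= \sum_y1 \sum_y2 \sum_y3 Vc a y1 b y2 c y3.
Proof.
move=> ba ca cb /fatp_ge F1 F2 /fatp_ge F3.
have {}F2 : 6 <= cd 2 c a by rewrite cd2_sym; exact: fatp_ge.
pose Q1 y := U 2 a y b && (y != c).
pose Q2 y1 y := [&& U 2 b y c, y != a & y != y1].
pose Q3 y1 y2 y := [&& U 2 c y a, y != b, y != y1 & y != y2].
have L1 : cd 2 a b <= 1 + \sum_(y | Q1 y) 1 := sum_rem (U 2 a ^~ b) c.
have L2 y1 : 4 <= \sum_(y | Q2 y1 y) 1.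
  by have : cd 2 b c <= 2 + \sum_(y | Q2 y1 y) 1; [exact: sum_rem2 | lia].
have L3 y1 y2 : 3 <= \sum_(y | Q3 y1 y2 y) 1.
  by have : cd 2 c a <= 3 + \sum_(y | Q3 y1 y2 y) 1; [exact: sum_rem3 | lia].
apply: leq_trans (_ : 2 * \sum_(y | Q1 y) 1 <= _); first by lia.
rewrite mulnC big_distrl /= [leqLHS]big_mkcond; apply: leq_sum => y1 _; case: ifP => // /andP[/U_twalk[a1 a2 a3] a4].
apply: leq_trans (_ : \sum_(y | Q2 y1 y) 1 <= _); first by have := L2 y1; lia.
rewrite big_mkcond; apply: leq_sum => y2 _; case: ifP => // /and3P[/U_twalk[b1 b2 b3] b4 b5].
apply: leq_trans (_ : \sum_(y | Q3 y1 y2 y) 1 <= _); first by have := L3 y1 y2; lia.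
rewrite big_mkcond; apply: leq_sum => y3 _; case: ifP => // /and4P[/U_twalk[c1 c2 c3] c4 c5 c6].
rewrite /Vc a1 a2 b1 b2 c1 c2 a3 b3 a4 /= [a == y2]eq_sym b4 [a == c]eq_sym c3.
by rewrite [y1 == y2]eq_sym b5 [y1 == y3]eq_sym c5 [b == y3]eq_sym c4 [y2 == y3]eq_sym c6.
Qed.

(** This replaces a degree count for kind 2. For each middle x the pairs of its neighbours in S are
    thin or fat. A thin pair occurs for fewer than [thr] middles, so thin pairs total
    [thr * (sS * sS)]. By [fat_pairs] the fat ones are bounded by thin ones and by fat triangles
    among the neighbours of x, and the latter are paid for by 6-cycles. *)
Lemma U2_total : \sum_x0 \sum_x1 \sum_x2 U 2 x0 x1 x2 <= TT + 3 * (thr * (sS * sS)) + 2 * sS.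
Proof.
pose P x a := [&& inS x, inS a & e x a].
have UE a x b : U 2 a x b = [&& P x a, P x b & b != a].
  rewrite /U /twalk /P /= e_sym [a == b]eq_sym.
  by case: (e x a); case: (e x b); case: (b != a); case: (inS a); case: (inS x); case: (inS b).
pose f x := \sum_(a | P x a) \sum_(b | P x b && (b != a)) fatp 2 a b.
pose h x := \sum_(a | P x a) \sum_(b | P x b && (b != a)) ~~ fatp 2 a b.
pose tau x := \sum_(a | P x a) \sum_(b | P x b && (b != a))
  \sum_(c | [&& P x c, c != a & c != b]) [&& fatp 2 a b, fatp 2 a c & fatp 2 b c].
have Hfh : \sum_x0 \sum_x1 \sum_x2 U 2 x0 x1 x2 = \sum_x (f x + h x).
  rewrite exchange_big; apply: eq_bigr => x _; rewrite /f /h -big_split /= [RHS]big_mkcond.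
  apply: eq_bigr => a _; case Pa: (P x a); last by rewrite big1 // => b _; rewrite UE Pa.
  rewrite -big_split [RHS]big_mkcond /=; apply: eq_bigr => b _; rewrite UE Pa /=.
  by case: ifP => _ //; case: (fatp 2 a b).
have Hh : \sum_x h x <= thr * (sS * sS).
  apply: leq_trans (_ : \sum_a \sum_b (inS a * inS b * thr) <= _); last first.
    rewrite mulnC big_distrl big_distrl /=; apply: leq_sum => a _.
    by rewrite big_distrr big_distrl.
  have -> : \sum_x h x = \sum_a \sum_b \sum_x (U 2 a x b && ~~ fatp 2 a b).
    rewrite [RHS](eq_bigr (fun a => \sum_x \sum_b (U 2 a x b && ~~ fatp 2 a b))); last first.
      by move=> a _; rewrite exchange_big.
    rewrite [RHS]exchange_big; apply: eq_bigr => x _; rewrite /h big_mkcond.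
    apply: eq_bigr => a _; case Pa: (P x a); last by rewrite big1 // => b _; rewrite UE Pa.
    by rewrite big_mkcond; apply: eq_bigr => b _; rewrite UE Pa /=; case: ifP.
  apply: leq_sum => a _; apply: leq_sum => b _.
  have [F|F] := boolP (fatp 2 a b); first by rewrite big1 // => x _; rewrite andbF.
  case Sab: (inS a && inS b); last first.
    rewrite big1 // => x _; apply/eqP; rewrite eqb0; apply/negP => /andP[/andP[_ /and3P[Ha _ Hb]] _].
    by rewrite Ha Hb in Sab.
  have -> : inS a * inS b * thr = thr by case/andP: Sab => -> ->; rewrite !mul1n.
  apply: leq_trans (_ : cd 2 a b <= _); last by move: F; rewrite /fatp negbK => /ltnW.
  by rewrite /cd [leqRHS]big_mkcond; apply: leq_sum => x _; case: (U 2 a x b); rewrite ?leq_b1.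
(* For a fixed fat triangle a, b, c every such x is a middle of a and b, so their number is bounded
   through [triple_cycles]. *)
have Ht : \sum_x tau x <= TT.
  have -> : \sum_x tau x = \sum_a \sum_b \sum_c \sum_x ([&& P x a, P x b, b != a, P x c, c != a & c != b]
     && [&& fatp 2 a b, fatp 2 a c & fatp 2 b c]).
    transitivity (\sum_x \sum_a \sum_b \sum_c ([&& P x a, P x b, b != a, P x c, c != a & c != b]
     && [&& fatp 2 a b, fatp 2 a c & fatp 2 b c])).
      apply: eq_bigr => x _; rewrite /tau big_mkcond; apply: eq_bigr => a _.
      case: (P x a); last by rewrite big1 // => b _; rewrite big1.
      rewrite big_mkcond; apply: eq_bigr => b _; case: ifP => [/andP[-> ->]|C] /=.
        by rewrite big_mkcond; apply: eq_bigr => c _; case: ifP.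
      by rewrite big1 // => c _; move: C; case: (P x b) => //=; case: (b != a).
    rewrite exchange_big; apply: eq_bigr => a _; rewrite exchange_big; apply: eq_bigr => b _.
    by rewrite exchange_big.
  have -> : TT = \sum_a \sum_b \sum_c \sum_y1 \sum_y2 \sum_y3 Vc a y1 b y2 c y3.
    apply: eq_bigr => a _; rewrite exchange_big; apply: eq_bigr => b _.
    rewrite [RHS]exchange_big; apply: eq_bigr => y1 _; rewrite exchange_big.
    by apply: eq_bigr => c _; rewrite exchange_big.
  apply: leq_sum => a _; apply: leq_sum => b _; apply: leq_sum => c _.
  case C: [&& b != a, c != a, c != b, fatp 2 a b, fatp 2 a c & fatp 2 b c]; last first.
    rewrite big1 // => x _; apply/eqP; rewrite eqb0; apply/negP => /andP[/and5P[_ _ ba _ /andP[ca cb]] /and3P[fa fb fc]].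
    by rewrite ba ca cb fa fb fc in C.
  case/and5P: C => ba ca cb fa /andP[fb fc].
  apply: leq_trans (triple_cycles ba ca cb fa fb fc).
  rewrite /cd [leqRHS]big_mkcond; apply: leq_sum => x _; rewrite UE.
  by case: (P x a); case: (P x b); rewrite ?ba ?leq_b1.
have Hf : \sum_x f x <= \sum_x (tau x + 2 * h x + 2 * inS x).
  apply: leq_sum => x _; have [Sx|Sx] := boolP (inS x); last first.
    by rewrite /f big_pred0 // => a; rewrite /P (negbTE Sx).
  exact: fat_pairs fatp2_sym.
have E1 : \sum_x 2 * h x = 2 * \sum_x h x by rewrite big_distrr.
have E2 : \sum_x 2 * inS x = 2 * sS by rewrite big_distrr.
have E3 : \sum_x (tau x + 2 * h x + 2 * inS x) = \sum_x tau x + 2 * \sum_x h x + 2 * sS.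
  by rewrite -E1 -E2 -!big_split.
move: Hf; rewrite E3 Hfh big_split /=.
by move: Hh Ht; move: (thr * (sS * sS)) => z; slia.
Qed.

(** * Coverage of the 6-cycles *)

Definition item k x0 x1 x2 x3 :=
  (Yt k x0 x2 x3 && U k x0 x1 x2) || Et k x0 x1 x2 x3.
Definition Cov x0 x1 x2 x3 x4 x5 := exists k k',
  [/\ k < 3, k' < 3, item k x0 x1 x2 x3 & item k' x0 x5 x4 x3].
Definition AnyCov x0 x1 x2 x3 x4 x5 :=
  Cov x0 x1 x2 x3 x4 x5 \/ Cov x1 x2 x3 x4 x5 x0 \/ Cov x2 x3 x4 x5 x0 x1 \/
  Cov x3 x4 x5 x0 x1 x2 \/ Cov x4 x5 x0 x1 x2 x3 \/ Cov x5 x0 x1 x2 x3 x4.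

Lemma AnyCov_rot x0 x1 x2 x3 x4 x5 :
  AnyCov x1 x2 x3 x4 x5 x0 -> AnyCov x0 x1 x2 x3 x4 x5.
Proof. rewrite /AnyCov; tauto. Qed.

Lemma Vc_rot x0 x1 x2 x3 x4 x5 : Vc x0 x1 x2 x3 x4 x5 -> Vc x1 x2 x3 x4 x5 x0.
Proof.
case/and3P=> /and5P[a b c d /andP[f g]] /and5P[h i j k l] /and4P[p q r s].
rewrite /Vc a b c d f g k l p q r s /= [x2 == x0]eq_sym h [x3 == x0]eq_sym i.
by rewrite [x4 == x0]eq_sym j.
Qed.

Definition path3 x0 x1 x2 x3 :=
  [&& e x0 x1, e x1 x2, e x2 x3, x0 != x2, x3 != x0 & x3 != x1].

Lemma path3_rev x0 x1 x2 x3 : path3 x0 x1 x2 x3 -> path3 x3 x2 x1 x0.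
Proof.
case/and5P=> a b c d /andP[f g]; rewrite /path3 [e x3 x2]e_sym c [e x2 x1]e_sym b.
by rewrite [e x1 x0]e_sym a g [x0 == x3]eq_sym f d.
Qed.

Lemma Vc_path x0 x1 x2 x3 x4 x5 : Vc x0 x1 x2 x3 x4 x5 ->
  path3 x0 x1 x2 x3 && path3 x0 x5 x4 x3.
Proof.
case/and3P=> /and5P[a b c d /andP[f g]] /and5P[h i j k l] /and4P[p q r s].
rewrite /path3 a b c h [x3 == x0]eq_sym i [x3 == x1]eq_sym k.
by rewrite [e x0 x5]e_sym g [e x5 x4]e_sym f [e x4 x3]e_sym d j s.
Qed.

(** In kinds 0 and 1 every continuation is stored, below a fat pair or as a thin item. *)
Lemma low_item k x0 x1 x2 x3 : k < 2 -> path3 x0 x1 x2 x3 -> U k x0 x1 x2 ->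
  item k x0 x1 x2 x3.
Proof.
move=> k2 /and5P[a b c d /andP[f g]] u; rewrite /item /Yt /Et /Ad /Xt u c f g.
by case: k k2 u => [|[|]] //= _ _; rewrite !andbT orbN.
Qed.

Lemma S_item x0 x1 x2 x3 : path3 x0 x1 x2 x3 ->
  [&& inS x0, inS x1, inS x2 & inS x3] -> fatp 2 x0 x2 || ~~ fatp 2 x1 x3 ->
  item 2 x0 x1 x2 x3.
Proof.
move=> /and5P[a b c d /andP[f g]] /and4P[s0 s1 s2 s3] H.
rewrite /item /Yt /Et /Ad /Xt /U /twalk a b c d f g s0 s1 s2 s3 /= [x1 == x3]eq_sym g /=.
by move: H; case: (fatp 2 x0 x2) => //= ->.
Qed.

Lemma poor_item x0 x1 x2 x3 : path3 x0 x1 x2 x3 -> poor x1 x2 -> item 0 x0 x1 x2 x3.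
Proof.
move=> p H; apply: low_item => //; case/and5P: p => a b c d _.
by rewrite /U /twalk a b d H.
Qed.

Lemma poor_sym x y : poor x y = poor y x.
Proof. by rewrite /poor [dg x * _]mulnC. Qed.

Lemma low_poor x y : ~~ inS x -> ~~ heavy y -> poor x y.
Proof. by rewrite /inS /heavy /poor -!leqNgt => H1 H2; rewrite mulnC leq_mul. Qed.

Lemma rich_S x y : ~~ poor x y -> ~~ heavy x -> ~~ heavy y -> inS x && inS y.
Proof.
rewrite /inS /heavy /poor negbK -!leqNgt => H1 H2 H3; apply/andP; split; rewrite ltnNge; apply/negP => H4.
  by have := leq_mul H4 H3; rewrite mulnA leqNgt H1.
by have := leq_mul H2 H4; rewrite leqNgt H1.
Qed.

(** If the condition of [S_item] fails forwards, then x1 and x3 form a fat pair, which is the first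
    alternative of that condition for the reversed path. *)
Lemma S_path_item x0 x1 x2 x3 : path3 x0 x1 x2 x3 ->
  [&& inS x0, inS x1, inS x2 & inS x3] -> item 2 x0 x1 x2 x3 \/ item 2 x3 x2 x1 x0.
Proof.
move=> p s; have [H|] := boolP (fatp 2 x0 x2 || ~~ fatp 2 x1 x3).
  by left; exact: S_item.
rewrite negb_or negbK => /andP[_ H]; right; apply: S_item; first exact: path3_rev.
  by case/and4P: s => -> -> -> ->.
by rewrite fatp2_sym H.
Qed.

(** Both edges at x4 are poor, so a half with one of them in the middle is an item of kind 0. The
    edges opposite to them are x1 x2 and x0 x1; if one of these is poor, the other half of the split
    is of kind 0 too. If both are rich, x0, x1, x2 lie in S. A further rich edge x2 x3 or x5 x0 then
    gives a path inside S, an item of kind 2 in one direction; otherwise these two edges are the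
    poor middles of the split at x1 and x4. *)
Lemma cov_low x0 x1 x2 x3 x4 x5 : Vc x0 x1 x2 x3 x4 x5 ->
  [&& ~~ heavy x0, ~~ heavy x1, ~~ heavy x2, ~~ heavy x3 & ~~ heavy x5] ->
  ~~ inS x4 -> AnyCov x0 x1 x2 x3 x4 x5.
Proof.
move=> V /and5P[h0 h1 h2 h3 h5] l4.
have V1 := Vc_rot V; have V2 := Vc_rot V1; have V3 := Vc_rot V2.
have V4 := Vc_rot V3; have V5 := Vc_rot V4.
have /andP[p012 p054] := Vc_path V.
have /andP[p123 p105] := Vc_path V1.
have /andP[p345 p321] := Vc_path V3.
have /andP[p501 p543] := Vc_path V5.
have /andP[p234 p210] := Vc_path V2.
have q45 : poor x4 x5 by exact: low_poor.
have q43 : poor x4 x3 by exact: low_poor.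
have [q12|r12] := boolP (poor x1 x2).
  left; exists 0, 0; split=> //; first exact: poor_item.
  by apply: poor_item => //; rewrite poor_sym.
have [q01|r01] := boolP (poor x0 x1).
  do 5 right; exists 0, 0; split=> //; exact: poor_item.
have /andP[s1 s2] := rich_S r12 h1 h2; have /andP[s0 _] := rich_S r01 h0 h1.
have [q23|r23] := boolP (poor x2 x3); last first.
  have /andP[_ s3] := rich_S r23 h2 h3.
  have [H|H] := S_path_item p012 (introT and4P (And4 s0 s1 s2 s3)).
    by left; exists 2, 0; split=> //; apply: poor_item => //; rewrite poor_sym.
  by do 3 right; left; exists 0, 2; split=> //; exact: poor_item.
have [q50|r50] := boolP (poor x5 x0); last first.
  have /andP[s5 _] := rich_S r50 h5 h0.
  have [H|H] := S_path_item p501 (introT and4P (And4 s5 s0 s1 s2)).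
    by do 5 right; exists 2, 0; split=> //; exact: poor_item.
  by do 2 right; left; exists 0, 2; split=> //; apply: poor_item => //; rewrite poor_sym.
right; left; exists 0, 0; split=> //; first exact: poor_item.
by apply: poor_item => //; rewrite poor_sym.
Qed.

Lemma cov_heavy x0 x1 x2 x3 x4 x5 : Vc x0 x1 x2 x3 x4 x5 -> heavy x0 ->
  AnyCov x0 x1 x2 x3 x4 x5.
Proof.
move=> /Vc_path/andP[p q] h; left; exists 1, 1; split=> //; apply: low_item => //.
  by case/and5P: p => a b c d _; rewrite /U /twalk a b d h.
by case/and5P: q => a b c d _; rewrite /U /twalk a b d h.
Qed.

(** Consider the fatness of the six pairs at distance two, ordered such that each half of a split
    compares two consecutive ones. A split fails from both ends only if the pairs differ in each
    half, and in opposite senses. If all three splits failed, fatness would alternate around the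
    hexagon, but then the pairs would differ in the same sense in both halves. The proof checks the
    64 cases. *)
Lemma cov_S x0 x1 x2 x3 x4 x5 : Vc x0 x1 x2 x3 x4 x5 ->
  [&& inS x0, inS x1, inS x2, inS x3, inS x4 & inS x5] -> AnyCov x0 x1 x2 x3 x4 x5.
Proof.
move=> V S.
have R y0 y1 y2 y3 y4 y5 : Vc y0 y1 y2 y3 y4 y5 ->
  [&& inS y0, inS y1, inS y2, inS y3, inS y4 & inS y5] ->
  (fatp 2 y0 y2 || ~~ fatp 2 y1 y3) && (fatp 2 y0 y4 || ~~ fatp 2 y5 y3) ->
  Cov y0 y1 y2 y3 y4 y5.
  move=> /Vc_path/andP[p q] /and5P[s0 s1 s2 s3 /andP[s4 s5]] /andP[H1 H2].
  by exists 2, 2; split=> //; apply: S_item => //; rewrite ?s0 ?s1 ?s2 ?s3 ?s4 ?s5.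
have V1 := Vc_rot V; have V2 := Vc_rot V1; have V3 := Vc_rot V2.
have V4 := Vc_rot V3; have V5 := Vc_rot V4.
case/and5P: (S) => s0 s1 s2 s3 /andP[s4 s5].
have C0 := R _ _ _ _ _ _ V S.
have C1 := R _ _ _ _ _ _ V1; have C2 := R _ _ _ _ _ _ V2; have C3 := R _ _ _ _ _ _ V3.
have C4 := R _ _ _ _ _ _ V4; have C5 := R _ _ _ _ _ _ V5.
rewrite s0 s1 s2 s3 s4 s5 /= in C1 C2 C3 C4 C5.
have {}C1 := C1 isT; have {}C2 := C2 isT; have {}C3 := C3 isT.
have {}C4 := C4 isT; have {}C5 := C5 isT.
rewrite (fatp2_sym x5 x3) in C0; rewrite (fatp2_sym x0 x4) in C0 C1.
rewrite (fatp2_sym x1 x5) in C1 C2; rewrite (fatp2_sym x2 x0) in C2 C3.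
rewrite (fatp2_sym x3 x1) in C3 C4; rewrite (fatp2_sym x4 x2) in C4 C5.
rewrite (fatp2_sym x5 x3) in C5.
rewrite /AnyCov; move: C0 C1 C2 C3 C4 C5.
case: (fatp 2 x0 x2); case: (fatp 2 x2 x4); case: (fatp 2 x4 x0);
case: (fatp 2 x1 x3); case: (fatp 2 x3 x5); case: (fatp 2 x5 x1) => /= C0 C1 C2 C3 C4 C5;
by first [ left; exact: C0 | right; left; exact: C1 | do 2 right; left; exact: C2
  | do 3 right; left; exact: C3 | do 4 right; left; exact: C4 | do 5 right; exact: C5 ].
Qed.

Lemma coverage x0 x1 x2 x3 x4 x5 : Vc x0 x1 x2 x3 x4 x5 -> AnyCov x0 x1 x2 x3 x4 x5.
Proof.
move=> V; have V1 := Vc_rot V; have V2 := Vc_rot V1; have V3 := Vc_rot V2.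
have V4 := Vc_rot V3; have V5 := Vc_rot V4.
have [h0|h0] := boolP (heavy x0); first exact: cov_heavy.
have [h1|h1] := boolP (heavy x1); first by do 1 apply: AnyCov_rot; exact: cov_heavy.
have [h2|h2] := boolP (heavy x2); first by do 2 apply: AnyCov_rot; exact: cov_heavy.
have [h3|h3] := boolP (heavy x3); first by do 3 apply: AnyCov_rot; exact: cov_heavy.
have [h4|h4] := boolP (heavy x4); first by do 4 apply: AnyCov_rot; exact: cov_heavy.
have [h5|h5] := boolP (heavy x5); first by do 5 apply: AnyCov_rot; exact: cov_heavy.
have [l4|s4] := boolP (~~ inS x4); first by apply: cov_low => //; apply/and5P.
have [l5|s5] := boolP (~~ inS x5); first by do 1 apply: AnyCov_rot; apply: cov_low => //; apply/and5P.
have [l0|s0] := boolP (~~ inS x0); first by do 2 apply: AnyCov_rot; apply: cov_low => //; apply/and5P.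
have [l1|s1] := boolP (~~ inS x1); first by do 3 apply: AnyCov_rot; apply: cov_low => //; apply/and5P.
have [l2|s2] := boolP (~~ inS x2); first by do 4 apply: AnyCov_rot; apply: cov_low => //; apply/and5P.
have [l3|s3] := boolP (~~ inS x3); first by do 5 apply: AnyCov_rot; apply: cov_low => //; apply/and5P.
move: s0 s1 s2 s3 s4 s5; rewrite !negbK => s0 s1 s2 s3 s4 s5.
by apply: cov_S; rewrite ?s0 ?s1 ?s2 ?s3 ?s4 ?s5.
Qed.

(** * Work bounds *)

Lemma YY_point k k' x0 x2 x3 : Yt k x0 x2 x3 ->
  \sum_(x4 | Yt k' x0 x4 x3 && (x4 != x2)) cd k x0 x2 * cd k' x0 x4 <=
  3 * \sum_x1 \sum_x4 \sum_x5 Vc x0 x1 x2 x3 x4 x5.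
Proof.
move=> Y1; rewrite exchange_big big_distrr /= big_mkcond; apply: leq_sum => x4 _.
by case: ifP => // /andP[Y2 N]; exact: YY_valid.
Qed.

Lemma YE_point k k' x0 x2 x3 : Yt k x0 x2 x3 ->
  \sum_(x5 | x5 != x2) \sum_(x4 | Et k' x0 x5 x4 x3 && (x4 != x2)) cd k x0 x2 <=
  2 * \sum_x1 \sum_x4 \sum_x5 Vc x0 x1 x2 x3 x4 x5.
Proof.
move=> Y1.
have -> : \sum_x1 \sum_x4 \sum_x5 Vc x0 x1 x2 x3 x4 x5 =
  \sum_x5 \sum_x4 \sum_x1 Vc x0 x1 x2 x3 x4 x5.
  rewrite exchange_big [RHS]exchange_big; apply: eq_bigr => x4 _.
  by rewrite exchange_big.
rewrite big_distrr /= big_mkcond; apply: leq_sum => x5 _; case: ifP => // N5.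
rewrite big_distrr /= big_mkcond; apply: leq_sum => x4 _; case: ifP => // /andP[E1 N4].
exact: YE_valid Y1 E1 N5 N4.
Qed.

Lemma sum_diag1 P (z : T) : \sum_(x | P x && (x == z)) 1 = P z.
Proof.
case Pz: (P z); last by rewrite big_pred0 // => x; case: eqP => [->|]; rewrite ?Pz ?andbF.
by rewrite (big_pred1 z) // => x /=; case: eqP => [->|]; rewrite ?Pz ?andbF.
Qed.

Lemma Ycount k' x0 x2 x3 : \sum_(x4 | Yt k' x0 x4 x3) 1 <=
  1 + \sum_(x4 | Yt k' x0 x4 x3 && (x4 != x2)) 1.
Proof. exact: sum_rem. Qed.

(** Thin items that meet x2 in their vertex x4 are the only collisions left once the group of x2 is
    skipped, and [Et_deg] bounds them. *)
Lemma YE_count k' x0 x2 x3 :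
  \sum_(x5 | x5 != x2) \sum_(x4 | Et k' x0 x5 x4 x3) 1 <=
  thr + \sum_(x5 | x5 != x2) \sum_(x4 | Et k' x0 x5 x4 x3 && (x4 != x2)) 1.
Proof.
under eq_bigr do rewrite (bigID (pred1 x2)) /= sum_diag1.
rewrite big_split /= leq_add2r; apply: leq_trans (Et_deg k' x0 x2 x3).
exact: sum_subpred.
Qed.

(** With the groups of x1 and x2 skipped, a collision can only come from x4 being x1 or x2, and each
    case admits at most [thr] values of x5. *)
Lemma EE_point k k' x0 x1 x2 x3 : Et k x0 x1 x2 x3 ->
  \sum_(x5 | (x5 != x1) && (x5 != x2)) \sum_(x4 | Et k' x0 x5 x4 x3) 1 <=
  2 * thr + \sum_x4 \sum_x5 Vc x0 x1 x2 x3 x4 x5.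
Proof.
move=> E1; rewrite [X in _ + X]exchange_big /=.
apply: leq_trans (_ : \sum_x5 (Et k' x0 x5 x1 x3 + Et k' x0 x5 x2 x3 +
   \sum_x4 Vc x0 x1 x2 x3 x4 x5) <= _); last first.
  rewrite !big_split /= leq_add2r mul2n -addnn leq_add //; exact: Et_deg.
rewrite big_mkcond; apply: leq_sum => x5 _; case: ifP => // /andP[N1 N2].
rewrite -(sum_diag (fun x => Et k' x0 x5 x x3) x1) -(sum_diag (fun x => Et k' x0 x5 x x3) x2).
rewrite -!big_split /= big_mkcond; apply: leq_sum => x4 _; case: ifP => // E2.
rewrite !mul1n; case: eqP => // /eqP N3; case: eqP => // /eqP N4.
by rewrite (EE_valid E1 E2).
Qed.

(** Groups are nonempty, so running through them costs no more than running through their items. *)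
Lemma Gt_le k x0 x3 (P : pred T) (F : T -> nat) :
  \sum_(x5 | Gt k x0 x3 x5 && P x5) F x5 <= \sum_(x5 | P x5) \sum_(x4 | Et k x0 x5 x4 x3) F x5.
Proof.
rewrite [leqLHS]big_mkcond [leqRHS]big_mkcond; apply: leq_sum => x5 _.
case: (P x5); rewrite ?andbF // andbT; case: ifP => // /existsP[x4 H].
by rewrite (bigD1 x4) //= leq_addr.
Qed.

Variable m : nat.
Hypothesis sum_dg : \sum_x dg x = 2 * m.
Hypothesis m_le : m <= D ^ 5.
Hypothesis D_gt0 : 0 < D.

Definition sH := \sum_x heavy x.
Definition MM := D ^ 8 + TT.

Lemma m_MM : m <= MM.
Proof. by apply: leq_trans m_le (leq_trans _ (leq_addr _ _)); rewrite leq_pexp2l. Qed.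

Lemma sS_le : sS <= 2 * D ^ 4.
Proof.
rewrite -(leq_pmul2r D_gt0); apply: leq_trans (_ : 2 * m <= _); last first.
  by rewrite -mulnA -expnSr leq_mul2l.
rewrite -sum_dg /sS big_distrl /=; apply: leq_sum => x _; rewrite /inS.
by case: ltnP => // /ltnW; rewrite mul1n.
Qed.

Lemma sS2_le : sS * sS <= 4 * D ^ 8.
Proof.
apply: leq_trans (leq_mul sS_le sS_le) _.
by rewrite mulnACA -expnD.
Qed.

Lemma sH_le : sH * (2 * m) <= 4 * D ^ 8.
Proof.
have H : sH <= 2 * D ^ 3.
  have D2 : 0 < D * D by rewrite muln_gt0 D_gt0.
  rewrite -(leq_pmul2r D2); apply: leq_trans (_ : 2 * m <= _); last first.
    by rewrite mulnn -mulnA -expnD leq_mul2l.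
  rewrite -sum_dg /sH big_distrl /=; apply: leq_sum => x _; rewrite /heavy.
  by case: ltnP => // /ltnW; rewrite mul1n.
apply: leq_trans (leq_mul H (leq_mul (leqnn 2) m_le)) _.
by rewrite mulnACA -expnD.
Qed.

Lemma dg_sum x : dg x = \sum_y e x y.
Proof. by rewrite /dg big_mkcond. Qed.

Lemma dg_gt0 x y : e x y -> 0 < dg x.
Proof. by move=> H; rewrite dg_sum (bigD1 y) //= H. Qed.

Lemma poor_walks : \sum_x1 \sum_(x2 | e x1 x2 && poor x1 x2) dg x1 * dg x2 <= 2 * D ^ 8.
Proof.
apply: leq_trans (_ : \sum_x1 \sum_(x2 | e x1 x2) D ^ 3 <= _).
  apply: leq_sum => x1 _; rewrite [leqLHS]big_mkcond [leqRHS]big_mkcond; apply: leq_sum => x2 _.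
  case: (e x1 x2) => //=; case: ifP => //; rewrite /poor -leqNgt => H.
  by apply: leq_trans H _; rewrite mulnn -expnSr.
apply: leq_trans (_ : 2 * m * D ^ 3 <= _).
  rewrite -sum_dg big_distrl /=; apply: leq_sum => x _.
  by rewrite /dg big_distrl /=; apply: leq_sum => y _; rewrite mul1n.
by rewrite -mulnA leq_mul2l /= -[8]/(5 + 3) expnD leq_mul2r m_le orbT.
Qed.

Definition UT k := \sum_x0 \sum_x1 \sum_x2 U k x0 x1 x2.

Lemma heavy_walks : \sum_x0 \sum_(x1 | e x0 x1) heavy x0 * dg x1 <= 4 * D ^ 8.
Proof.
apply: leq_trans sH_le; rewrite -sum_dg /sH big_distrl /=; apply: leq_sum => x0 _.
rewrite big_distrr /=; exact: sum_subpred.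
Qed.

Lemma U0_walks : \sum_x0 \sum_x1 \sum_x2 U 0 x0 x1 x2 * dg x2 <= 2 * D ^ 8.
Proof.
apply: leq_trans poor_walks; rewrite exchange_big; apply: leq_sum => x1 _.
rewrite exchange_big [leqRHS]big_mkcond /=; apply: leq_sum => x2 _.
have [C|C] := boolP (e x1 x2 && poor x1 x2); last first.
  rewrite big1 // => x0 _; rewrite /U /= /twalk; case: (e x0 x1) => //=.
  by move: C; case: (e x1 x2) => //= /negbTE->; rewrite andbF.
rewrite (dg_sum x1) big_distrl /=; apply: leq_sum => x0 _.
rewrite leq_mul2r /U /twalk [e x0 x1]e_sym; apply/orP; right.
by case: (e x1 x0); rewrite ?leq_b1.
Qed.

Lemma UT_le k : k < 3 -> UT k <= 100 * MM.
Proof.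
move=> k3; rewrite /MM.
have H1 : UT 0 <= 2 * D ^ 8.
  apply: leq_trans U0_walks; do 3 (apply: leq_sum => ? _).
  case Hu: (U 0 _ _ _) => //; rewrite mul1n; case/U_twalk: Hu => _ + _.
  by rewrite e_sym => /dg_gt0.
have H2 : UT 1 <= 4 * D ^ 8.
  apply: leq_trans heavy_walks; apply: leq_sum => x0 _; rewrite [leqRHS]big_mkcond; apply: leq_sum => x1 _.
  case: ifP => E1; last by rewrite big1 // => x2 _; rewrite /U /twalk E1.
  rewrite dg_sum big_distrr; apply: leq_sum => x2 _; rewrite /U /twalk E1 /=.
  by case: (e x1 x2); case: (heavy x0); rewrite ?andbF ?leq_b1.
have H3 := U2_total; have H4 := sS2_le; have H5 := sS_le.
have H6 : D ^ 4 <= D ^ 8 by rewrite leq_pexp2l.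
case: k k3 => [|[|[|]]] // _; first by lia.
- by lia.
- by move: H3 H4 H5 H6; rewrite /UT /thr; move: (sS * sS) sS (D ^ 4) (D ^ 8) TT; clear; lia.
Qed.

(** Counts rounds of the loop over x3, hence also x3 equal to x0, which the next test rejects. In
    kind 2 this adds at most one round per fat pair, paid for by a 2-walk. *)
Definition YT k := \sum_x0 \sum_x2 \sum_(x3 | fatp k x0 x2 && Ad k x2 x3) 1.

Lemma fat_U k : \sum_x0 \sum_x2 fatp k x0 x2 <= UT k.
Proof.
rewrite /UT; apply: leq_sum => x0 _; rewrite exchange_big; apply: leq_sum => x2 _ /=.
have [F|//] := boolP (fatp k x0 x2); have := fatp_ge F; rewrite /cd big_mkcond => H.
by apply: leq_trans (_ : 6 <= _) => //; apply: leq_trans H _; apply: leq_sum => x1 _; case: ifP.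
Qed.

Lemma fat_has k x0 x2 : fatp k x0 x2 -> exists x1, U k x0 x1 x2.
Proof.
move=> /fatp_ge F; apply/existsP; apply: contraLR F => /existsPn H.
by rewrite /cd big_pred0 // => x1; apply/negbTE.
Qed.

Lemma YT_le k : k < 3 -> YT k <= 200 * MM.
Proof.
move=> k3; have HU := UT_le k3; rewrite /MM in HU *.
case: k k3 HU => [|[|[|]]] // _ HU.
- apply: leq_trans (_ : 2 * D ^ 8 <= _); last by lia.
  apply: leq_trans U0_walks; apply: leq_sum => x0 _; rewrite [leqRHS]exchange_big; apply: leq_sum => x2 _.
  have [F|F] := boolP (fatp 0 x0 x2); last by rewrite big_pred0.
  have [x1 H1] := fat_has F; rewrite [leqRHS](bigD1 x1) //= H1 mul1n.
  apply: leq_trans (leq_addr _ _); rewrite /dg; apply: sum_subpred => x3; exact: Ad_e.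
- apply: leq_trans (_ : 4 * D ^ 8 <= _); last by lia.
  apply: leq_trans sH_le; rewrite /sH big_distrl; apply: leq_sum => x0 _ /=.
  rewrite -sum_dg big_distrr /=; apply: leq_sum => x2 _.
  have [F|F] := boolP (fatp 1 x0 x2); last by rewrite big_pred0.
  have [x1 /andP[_ /= ->]] := fat_has F; rewrite mul1n.
  rewrite /dg; apply: sum_subpred => x3; exact: Ad_e.
- apply: leq_trans (_ : (sS * sS + TT) + UT 2 <= _); last first.
    by have := sS2_le; move: HU; lia.
  apply: leq_trans (leq_add Y2_total (fat_U 2)).
  rewrite -big_split; apply: leq_sum => x0 _ /=; rewrite exchange_big -big_split.
  apply: leq_sum => x2 _ /=; case F: (fatp 2 x0 x2); last by rewrite big_pred0.
  apply: leq_trans (sum_rem _ x0) _; rewrite addnC leq_add2r big_mkcond.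
  by apply: leq_sum => x3 _; rewrite /Yt F /=; case: ifP.
Qed.

Definition ET k := \sum_x0 \sum_x1 \sum_(x2 | U k x0 x1 x2 && ~~ fatp k x0 x2)
  \sum_(x3 | Xt k x1 x2 x3) 1.

Lemma ET_le k : k < 3 -> ET k <= 300 * MM.
Proof.
move=> k3; have HU := UT_le k3; rewrite /MM in HU *.
case: k k3 HU => [|[|[|]]] // _ HU.
- apply: leq_trans (_ : 2 * D ^ 8 <= _); last by lia.
  apply: leq_trans U0_walks; do 2 (apply: leq_sum => ? _).
  rewrite big_mkcond; apply: leq_sum => x2 _; case: ifP => // /andP[-> _]; rewrite mul1n.
  exact: leqnn.
- apply: leq_trans (_ : thr * (4 * D ^ 8) <= _); last by rewrite /thr; lia.
  apply: leq_trans (leq_mul (leqnn thr) sH_le).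
  rewrite mulnC /sH !big_distrl /=; apply: leq_sum => x0 _ /=.
  apply: leq_trans (_ : \sum_x2 \sum_(x1 | U 1 x0 x1 x2 && ~~ fatp 1 x0 x2) dg x2 <= _).
    rewrite [leqRHS](exchange_big_dep xpredT) //=.
  rewrite -sum_dg big_distrr big_distrl /=; apply: leq_sum => x2 _.
  have [F|F] := boolP (fatp 1 x0 x2); first by rewrite big_pred0 // => x1; rewrite andbF.
  have [h|h] := boolP (heavy x0); last first.
    by rewrite big_pred0 // => x1; rewrite /U /= (negbTE h) andbF.
  rewrite mul1n mulnC; apply: leq_trans (_ : cd 1 x0 x2 * dg x2 <= _); last first.
    by rewrite leq_mul2r ltnW ?orbT //; move: F; rewrite /fatp negbK.
  rewrite /cd big_distrl /= [leqLHS]big_mkcond [leqRHS]big_mkcond; apply: leq_sum => x1 _.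
  by case: (U 1 x0 x1 x2); rewrite //= mul1n.
- apply: leq_trans (_ : (4 * thr * (sS * sS) + TT) + UT 2 <= _); last first.
    by have := sS2_le; move: HU; rewrite /thr; lia.
  apply: leq_trans (leq_add E2_total (leqnn _)).
  rewrite /ET /UT -big_split; apply: leq_sum => x0 _ /=; rewrite exchange_big -big_split.
  apply: leq_sum => x1 _ /=; rewrite exchange_big -big_split big_mkcond; apply: leq_sum => x2 _ /=.
  case: ifP => // /andP[u F]; rewrite u; apply: leq_trans (sum_rem _ x0) _.
  rewrite addnC leq_add2r big_mkcond; apply: leq_sum => x3 _; case: ifP => // /andP[Hx N].
  rewrite /Et u F Hx N /=; move: Hx; rewrite /Xt /= => /andP[/U_twalk[_ _]].
  by rewrite eq_sym => ->.
Qed.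

End Graph.
End Walks.
Import Walks.

Module Rules.
(** * The program *)

Definition EV (x : nat) := EA (AV x).
Definition EC (c : nat) := EA (AC c).
Definition bne a b := BIf (EOp OEq (EOp OEq (EV a) (EV b)) (EC 0)).
Definition blt e1 e2 := BIf (EOp OLt e1 e2).
Definition bnlt e1 e2 := BIf (EOp OEq (EOp OLt e1 e2) (EC 0)).
Definition xN := EIn (EC 0).
Definition xM := EIn (EC 1).
Definition eD := ELen [:: AC 0].

(* Tables, by tag: 0 the threshold D (as a length), 1 adjacency, 2 adjacency
   inside [inS], 3 middles of 2-walks, 4 thin continuations, 5 fat items,
   6 thin items, 7 groups of thin items, 8 marks of 6-tuples. *)
Definition kA x := [:: AC 1; AV x].
Definition kS x := [:: AC 2; AV x].
Definition kM k x0 x2 := [:: AC 3; AC k; AV x0; AV x2].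
Definition kL x1 x2 := [:: AC 4; AV x1; AV x2].
Definition kY k x0 x3 := [:: AC 5; AC k; AV x0; AV x3].
Definition kE k x0 x3 x1 := [:: AC 6; AC k; AV x0; AV x3; AV x1].
Definition kG k x0 x3 := [:: AC 7; AC k; AV x0; AV x3].
Definition kK (vs : seq nat) := AC 8 :: [seq AV x | x <- vs].
Definition dgE x := ELen (kA x).
Definition mul5 e := EOp OMul e (EOp OMul e (EOp OMul e (EOp OMul e e))).

(** The order of the loops realises the counting bounds: each test stands before the loop whose
    length it controls, for instance poorness of x1 x2 before the loop over x0 in kind 0. *)
Definition ctx2 k : seq binder :=
  if k == 0 then
    [:: BR 1 xN; BL 2 (kA 1); bnlt (EOp OMul (EOp OMul eD eD) eD) (EOp OMul (dgE 1) (dgE 2));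
        BL 0 (kA 1); bne 0 2]
  else if k == 1 then
    [:: BR 0 xN; blt (EOp OMul eD eD) (dgE 0); BL 1 (kA 0); BL 2 (kA 1); bne 0 2]
  else [:: BR 1 xN; BL 0 (kS 1); BL 2 (kS 1); bne 0 2].
(** A fat pair is met once for each of its middles; comparing x1 with the head of the list of
    middles lets only one of these visits pass, so that the loop over x3 runs once per pair. *)
Definition ctxY k := ctx2 k ++
  [:: BIf (EOp OEq (EHd (kM k 0 2)) (EV 1)); bnlt (ELen (kM k 0 2)) (EC thr);
      BL 3 (if k == 2 then kS 2 else kA 2); bne 3 0].
Definition ctxE k := ctx2 k ++
  [:: blt (ELen (kM k 0 2)) (EC thr); BL 3 (if k == 2 then kL 1 2 else kA 2);
      bne 3 0; bne 3 1].

Definition guards (vs : seq nat) :=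
  [seq bne (nth 0 vs p.1) (nth 0 vs p.2) |
    p <- [:: (0, 2); (0, 3); (0, 4); (1, 3); (1, 4); (1, 5); (2, 4); (2, 5); (3, 5)]].
Definition pairYY k k' :=
  [:: BL 4 (kY k' 0 3); bne 4 2; BL 6 (kM k 0 2); BL 5 (kM k' 0 4)].
Definition pairYE k k' :=
  [:: BL 5 (kG k' 0 3); bne 5 2; BL 4 (kE k' 0 3 5); bne 4 2; BL 6 (kM k 0 2)].
Definition pairEE (k' : nat) :=
  [:: BL 5 (kG k' 0 3); bne 5 1; bne 5 2; BL 4 (kE k' 0 3 5)].

Definition block := (nat * nat * nat)%type.
(* The variable 1 of a fat item holds the head of its list of middles, so the
   middle that runs through the list is variable 6. *)
Definition bvars (b : block) : seq nat :=
  if b.1.1 == 2 then [:: 0; 1; 2; 3; 4; 5] else [:: 0; 6; 2; 3; 4; 5].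
Definition bctx (b : block) : seq binder :=
  let: (t, k, k') := b in
  (if t == 0 then ctxY k ++ pairYY k k' else if t == 1 then ctxY k ++ pairYE k k'
   else ctxE k ++ pairEE k') ++ guards (bvars b).
Definition blocks : seq block :=
  [seq (p, k') | p <- [seq (t, k) | t <- iota 0 3, k <- iota 0 3], k' <- iota 0 3].

(* The twelve symmetries of the hexagon; number 0 is the identity. *)
Definition sym r i := if r < 6 then (i + r) %% 6 else (r + 6 - i) %% 6.
Definition rot6 r (c : seq nat) : seq nat := [seq nth 0 c (sym r i) | i <- iota 0 6].

(** One entry for each i with [i ^ 5 < m] makes the length of this list the fifth root of m, rounded
    up. *)
Definition rD : rule := ([:: BR 0 xM; blt (mul5 (EV 0)) xM], [:: ([:: AC 0], AC 0)]).
Definition rA : rule :=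
  ([:: BR 0 xM; BLet 1 (EIn (EOp OAdd (EC 2) (EOp OMul (EC 2) (EV 0))));
       BLet 2 (EIn (EOp OAdd (EC 3) (EOp OMul (EC 2) (EV 0))))],
   [:: (kA 1, AV 2); (kA 2, AV 1)]).
Definition rS : rule :=
  ([:: BR 0 xN; BL 1 (kA 0); blt eD (dgE 0); blt eD (dgE 1)], [:: (kS 0, AV 1)]).
Definition rM k : rule := (ctx2 k, [:: (kM k 0 2, AV 1)]).
Definition rL : rule :=
  (ctx2 2 ++ [:: blt (ELen (kM 2 0 2)) (EC thr)], [:: (kL 0 1, AV 2)]).
Definition rY k : rule := (ctxY k, [:: (kY k 0 3, AV 2)]).
Definition rE k : rule := (ctxE k, [:: (kE k 0 3 1, AV 2)]).
Definition rG k : rule :=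
  (ctxE k ++ [:: BIf (EOp OEq (EHd (kE k 0 3 1)) (EV 2))], [:: (kG k 0 3, AV 1)]).
(** A mark encodes both the symmetry and the number of the block. With 27 blocks it stays below 324,
    within the bound on constants. *)
Definition rK (p : nat * block) : rule :=
  (bctx p.2, [seq (kK (rot6 r (bvars p.2)), AC (r + 12 * p.1)) | r <- iota 0 12]).
Definition rO (p : nat * block) : rule :=
  (bctx p.2 ++ [:: BIf (EOp OEq (EHd (kK (bvars p.2))) (EC (12 * p.1)))],
   [seq ([::], AV x) | x <- bvars p.2]).
Definition nblocks := zip (iota 0 27) blocks.

Definition rules : seq rule :=
  [:: rD; rA; rS] ++ [seq rM k | k <- iota 0 3] ++ [:: rL] ++
  [seq rY k | k <- iota 0 3] ++ [seq rE k | k <- iota 0 3] ++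
  [seq rG k | k <- iota 0 3] ++ [seq rK p | p <- nblocks] ++ [seq rO p | p <- nblocks].

Lemma chk_rules_rules : chk_rules rules.
Proof. by vm_compute. Qed.

(** * Sums over the runs of a rule *)

Section Sums.
Variables (inp : seq nat) (L : table).

Definition esum c env (f : seq nat -> nat) := \sum_(e <- envs inp L c env) f e.

Lemma esum_nil env f : esum [::] env f = f env.
Proof. by rewrite /esum /= big_seq1. Qed.

Lemma esum_if e c env f :
  esum (BIf e :: c) env f = if ve inp L env e != 0 then esum c env f else 0.
Proof. by rewrite /esum /=; case: ifP => //; rewrite big_nil. Qed.

Lemma esum_BL x k c env f :
  esum (BL x k :: c) env f = \sum_(v <- L (vk env k)) esum c (set_nth 0 env x v) f.
Proof. by rewrite /esum /= big_flatten big_map. Qed.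

Lemma esum_BR x e c env f :
  esum (BR x e :: c) env f = \sum_(v <- iota 0 (ve inp L env e)) esum c (set_nth 0 env x v) f.
Proof. by rewrite /esum /= big_flatten big_map. Qed.

Lemma esum_BLet x e c env f :
  esum (BLet x e :: c) env f = esum c (set_nth 0 env x (ve inp L env e)) f.
Proof. by []. Qed.

Lemma esum_cat c1 c2 env f : esum (c1 ++ c2) env f = esum c1 env (fun e => esum c2 e f).
Proof.
elim: c1 env => [|b c1 IH] env; first by rewrite esum_nil.
case: b => [e|x e|x k|x e]; rewrite cat_cons.
- by rewrite !esum_if IH.
- by rewrite !esum_BR; apply: eq_bigr => v _; rewrite IH.
- by rewrite !esum_BL; apply: eq_bigr => v _; rewrite IH.
- by rewrite !esum_BLet IH.
Qed.

Lemma esum_bne a b c env f :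
  esum (bne a b :: c) env f = if nth 0 env a != nth 0 env b then esum c env f else 0.
Proof. by rewrite /bne esum_if /=; case: (nth 0 env a == nth 0 env b). Qed.

Fixpoint vis (c : seq binder) (env : seq nat) (f : seq nat -> nat) : nat :=
  match c with
  | [::] => f env
  | BIf e :: c' => 1 + (if ve inp L env e != 0 then vis c' env f else 0)
  | BR x e :: c' => 1 + \sum_(i <- iota 0 (ve inp L env e)) vis c' (set_nth 0 env x i) f
  | BL x k :: c' => 1 + \sum_(v <- L (vk env k)) vis c' (set_nth 0 env x v) f
  | BLet x e :: c' => 1 + vis c' (set_nth 0 env x (ve inp L env e)) f
  end.

(** The additional 1 on the left makes the induction pass through loops, where [gcost] charges 1
    more for every round. *)
Lemma gcost_vis c env : gcost inp L c env (fun=> 1) + 1 <= 4 * vis c env (fun=> 1).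
Proof.
elim: c env => [|[e|x e|x k|x e] c IH] env //=.
- by case: ifP => // _; have := IH env; lia.
- suff : \sum_(i <- iota 0 (ve inp L env e)) (1 + gcost inp L c (set_nth 0 env x i) (fun=> 1))
     <= 4 * \sum_(i <- iota 0 (ve inp L env e)) vis c (set_nth 0 env x i) (fun=> 1) by lia.
  by rewrite big_distrr /=; apply: leq_sum => i _; rewrite addnC.
- suff : \sum_(i <- L (vk env k)) (1 + gcost inp L c (set_nth 0 env x i) (fun=> 1))
     <= 4 * \sum_(i <- L (vk env k)) vis c (set_nth 0 env x i) (fun=> 1) by lia.
  by rewrite big_distrr /=; apply: leq_sum => i _; rewrite addnC.
- by have := IH (set_nth 0 env x (ve inp L env e)); lia.
Qed.

Lemma vis_cat c1 c2 env f : vis (c1 ++ c2) env f = vis c1 env (fun e => vis c2 e f).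
Proof.
elim: c1 env => [|[e|x e|x k|x e] c1 IH] env //=; rewrite ?IH //.
- by congr (_ + _); apply: eq_bigr => v _.
- by congr (_ + _); apply: eq_bigr => v _.
Qed.

Definition is_if b := if b is BIf _ then true else false.

Lemma vis_ifs c env : all is_if c -> vis c env (fun=> 1) <= size c + 1.
Proof.
elim: c => // -[e|x e|x k|x e] c IH //= /IH H.
by case: ifP => // _; move: H; rewrite addSn add1n ltnS.
Qed.

(** Contribution of a rule to a sum over the list at [key]. The tables are specified through such
    sums, which makes the order of insertion irrelevant. *)
Definition rsum (r : rule) key (f : nat -> nat) :=
  esum r.1 env0 (fun e => \sum_(a <- r.2) (vk e a.1 == key) * f (va e a.2)).

Lemma at_key_sum key E (f : nat -> nat) :
  \sum_(v <- at_key key E) f v = \sum_(p <- E) (p.1 == key) * f p.2.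
Proof.
rewrite /at_key big_map big_filter big_mkcond; apply: eq_bigr => p _.
by case: (p.1 == key); rewrite ?mul1n.
Qed.

Hypothesis L_eq : forall k, L k = at_key k (rules_events inp L rules).

Lemma key_sum key f : \sum_(v <- L key) f v = \sum_(r <- rules) rsum r key f.
Proof.
rewrite L_eq at_key_sum /rules_events big_flatten big_map; apply: eq_bigr => r _.
rewrite /rule_events /ctx_events big_flatten big_map; apply: eq_bigr => e _.
by rewrite /acts_events big_map.
Qed.

Definition writes t (r : rule) := t \in flatten (map wtag r.2).

Lemma ac_headed (a : act) r : List.In a r.2 -> List.In r rules ->
  match a.1 with [::] => True | AC _ :: _ => True | _ => False end.
Proof.
have : chk_rules rules by exact: chk_rules_rules.
elim: rules => //= r0 rs IH /andP[H1 H2] Ha [E|]; last exact: IH.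
have [sc] := chk_c_acts H1; rewrite E.
elim: r.2 Ha => //= a' l IHl [->|/IHl H] /andP[/andP[_ /and3P[_ _ Ht]] Hl]; last exact: H.
by case: (a.1) Ht => [|[]].
Qed.

Lemma key_sum_tag t key f : \sum_(v <- L (t :: key)) f v =
  \sum_(r <- [seq r <- rules | writes t r]) rsum r (t :: key) f.
Proof.
rewrite key_sum big_filter [RHS]big_mkcond.
have: forall r, List.In r rules -> forall a, List.In a r.2 ->
    match a.1 with [::] => True | AC _ :: _ => True | _ => False end.
  by move=> r Hr a Ha; exact: ac_headed Ha Hr.
elim: rules => [|r rs IH] H; first by rewrite !big_nil.
rewrite !big_cons IH; last by move=> r' Hr'; apply: H; right.
congr (_ + _); case: ifP => // /negbT; rewrite /writes => Hw; rewrite /rsum /esum big1 // => e _.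
have {}H := H r (or_introl erefl).
elim: (r.2) H Hw => [|a l IHl] H; first by rewrite big_nil.
rewrite /= mem_cat negb_or => /andP[N1 N2]; rewrite big_cons IHl //; last first.
- by move=> a' Ha'; apply: H; right.
have := H a (or_introl erefl); rewrite addn0.
case: a N1 {H} => [[|[t'|x] k] v] //= N1 _; move: N1; rewrite /wtag /= inE => N1.
by rewrite eqseq_cons [t' == t]eq_sym (negbTE N1).
Qed.
End Sums.
End Rules.
Import Rules.

(** * Specification of the tables *)

(** Sums of all functions determine a list up to order, so this says that [l] enumerates [P] without
    repetition, in the form that turns loops over [l] into sums over vertices. *)
Definition listof n (l : seq nat) (P : pred 'I_n) :=
  forall f : nat -> nat, \sum_(v <- l) f v = \sum_(x : 'I_n | P x) f x.

Section ListOf.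
Variable n : nat.
Implicit Types (l : seq nat) (P : pred 'I_n).

Lemma listof_iota : listof (iota 0 n) (fun _ : 'I_n => true).
Proof. by move=> f; rewrite -(big_mkord xpredT) /index_iota subn0. Qed.

Lemma listof_size l P : listof l P -> size l = \sum_(x | P x) 1.
Proof. by move=> H; rewrite -(H (fun=> 1)) sum1_size. Qed.

Lemma listof_mem l P v : listof l P -> v \in l -> exists2 x, P x & v = val x.
Proof.
move=> H Hv; have := H (fun u => u == v).
rewrite (big_rem v Hv) /= eqxx => E.
have [x /andP[Px /eqP<-]|N] := pickP (fun x => P x && (val x == v)); first by exists x.
by move: E; rewrite [RHS]big1 // => x Px; have := N x; rewrite Px /= => ->.
Qed.

Lemma listof_head l P : listof l P -> (exists x, P x) ->
  exists2 x, P x & head 0 l = val x.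
Proof.
move=> H [x Px]; apply: (listof_mem H); have := listof_size H.
by case: l {H} => [|v l] //=; [rewrite (bigD1 x) | rewrite mem_head].
Qed.

Lemma sum_pick (a : 'I_n) (b : bool) (F : 'I_n -> nat) :
  \sum_(x : 'I_n) (if (val x == val a) && b then F x else 0) = if b then F a else 0.
Proof.
rewrite (bigD1 a) //= eqxx big1 ?addn0 // => x N.
by rewrite val_eqE (negbTE N).
Qed.

Lemma listof_eq l P P' : P =1 P' -> listof l P -> listof l P'.
Proof. by move=> E H f; rewrite H; apply: eq_bigl. Qed.

End ListOf.

Section Spec.
Variables (n : nat) (G : sgraph 'I_n) (s : seq ('I_n * 'I_n)) (L : table).
Hypothesis s_edges : is_edge_list G s.
Notation inp := (encode_input s).
Hypothesis L_eq : forall k, L k = at_key k (rules_events inp L rules).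
Notation e := (adj G : rel 'I_n).
Notation D := (size (L [:: 0])).
Notation esum := (esum inp L).
Notation vis := (vis inp L).

Let e_sym : symmetric e := adj_sym G.
Let e_irr : irreflexive e := adj_irrefl G.

Lemma D_count : D = count (fun i => i ^ 5 < size s) (iota 0 (size s)).
Proof.
rewrite -sum1_size (key_sum_tag L_eq).
rewrite [filter _ _](_ : _ = [:: rD]); last by [].
rewrite big_seq1 /rsum /rD /= esum_BR /= -sum1_count [RHS]big_mkcond.
apply: eq_bigr => i _; rewrite /blt esum_if /= esum_nil big_seq1 /=.
by rewrite !expnS expn0 !muln1; case: (_ < _).
Qed.

Lemma nth_enc (p0 : 'I_n * 'I_n) i : i < size s ->
  nth 0 inp (2 + 2 * i) = (nth p0 s i).1 /\ nth 0 inp (3 + 2 * i) = (nth p0 s i).2.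
Proof.
pose fl (s' : seq ('I_n * 'I_n)) := flatten [seq [:: val p.1; val p.2] | p <- s'].
rewrite -[nth 0 inp (2 + 2 * i)]/(nth 0 (fl s) (2 * i)).
rewrite -[nth 0 inp (3 + 2 * i)]/(nth 0 (fl s) (2 * i).+1).
elim: s i => [|p s' IH] [|i] // Hi.
rewrite (_ : 2 * i.+1 = (2 * i).+2); last by rewrite mulnS.
exact: IH.
Qed.

Lemma edge_neq p : p \in s -> p.1 != p.2.
Proof.
move=> Hp; have : [set p.1; p.2] \in [seq [set q.1; q.2] | q <- s] by apply/mapP; exists p.
rewrite (perm_mem s_edges) mem_enum => /imsetP[[a b] /=]; rewrite inE => Hab E.
have := congr1 (fun A : {set 'I_n} => #|A|) E; rewrite !cards2.
by rewrite (e_neq e_irr Hab); case: (p.1 != p.2).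
Qed.

(** An edge list is specified through unordered pairs only. Both orientations of a listed pair are
    therefore combined into a function [h] of the set of its ends, which is then summed over
    [edges G]. *)
Lemma sum_edges (F : 'I_n -> 'I_n -> nat) (a : 'I_n) :
  \sum_(p <- s) ((p.1 == a) * F a p.2 + (p.2 == a) * F a p.1) = \sum_(x | e a x) F a x.
Proof.
pose h (E : {set 'I_n}) := \sum_x (E == [set a; x]) * (x != a) * F a x.
have Hh p : p \in s -> (p.1 == a) * F a p.2 + (p.2 == a) * F a p.1 = h [set p.1; p.2].
  move=> /edge_neq; case: p => u v /= N; rewrite /h.
  have E x : x != a -> ([set u; v] == [set a; x]) = ((u == a) && (v == x)) || ((v == a) && (u == x)).
    move=> Nx; apply/eqP/orP => [E|[/andP[/eqP-> /eqP->]|/andP[/eqP-> /eqP->]]] //; last by rewrite setUC.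
    have : a \in [set u; v] by rewrite E set21.
    have : x \in [set u; v] by rewrite E set22.
    rewrite !inE => /orP[]/eqP Ex /orP[]/eqP Ea; subst.
    - by rewrite eqxx in Nx.
    - by right; rewrite !eqxx.
    - by left; rewrite !eqxx.
    - by rewrite eqxx in Nx.
  rewrite (eq_bigr (fun x => ((u == a) * (x == v) + (v == a) * (x == u)) * F a x)); last first.
    move=> x _; have [->|Nx] := eqVneq x a.
      rewrite muln0 mul0n [v == a]eq_sym [a == u]eq_sym.
      case: (eqVneq u a) => [E1|_]; case: (eqVneq a v) => [E2|_] //=.
      by move: N; rewrite E1 E2 eqxx.
    rewrite E // muln1; congr (_ * _); rewrite ![x == _]eq_sym.
    case: (eqVneq u a) => [E1|_]; case: (eqVneq v a) => [E2|_] //=.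
    - by move: N; rewrite E1 E2 eqxx.
    - by case: (v == x).
    - by case: (u == x).
  under eq_bigr do rewrite mulnDl -!mulnA.
  rewrite big_split /= -!big_distrr /=; congr (_ * _ + _ * _).
    by rewrite (bigD1 v) //= eqxx mul1n big1 ?addn0 // => x /negbTE->.
  by rewrite (bigD1 u) //= eqxx mul1n big1 ?addn0 // => x /negbTE->.
rewrite (eq_big_seq (fun p => h [set p.1; p.2])) //.
have -> : \sum_(p <- s) h [set p.1; p.2] = \sum_(E <- [seq [set p.1; p.2] | p <- s]) h E.
  by rewrite big_map.
rewrite (perm_big _ s_edges) /= big_enum /= /h exchange_big /= [RHS]big_mkcond; apply: eq_bigr => x _.
have [->|Nx] := eqVneq x a; first by rewrite e_irr big1 // => E _; rewrite muln0 mul0n.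
have He : ([set a; x] \in edges G) = e a x.
  apply/imsetP/idP => [[[u v] /=]|H]; last by exists (a, x) => //; rewrite inE.
  rewrite inE /= => Huv E.
  have : a \in [set u; v] by rewrite -E set21.
  have : x \in [set u; v] by rewrite -E set22.
  rewrite !inE => /orP[]/eqP Ex /orP[]/eqP Ea; subst; rewrite ?eqxx // in Nx *.
  by rewrite e_sym.
case: ifP => Hax; last first.
  rewrite big1 // => E HE; case: eqP => // EE; move: HE; rewrite EE He Hax //.
rewrite (bigD1 [set a; x]) /= ?He // eqxx !mul1n big1 ?addn0 // => E /andP[_ /negbTE->].
by [].
Qed.

Lemma HA x : listof (L [:: 1; val x]) (e x).
Proof.
move=> f; rewrite (key_sum_tag L_eq) [filter _ _](_ : _ = [:: rA]); last by [].
rewrite big_seq1 /rsum /rA /= esum_BR /= -(sum_edges (fun _ y => f y)).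
case Es : s => [|p0 s0]; first by rewrite !big_nil.
rewrite -Es [RHS](big_nth p0) /index_iota subn0 !big_seq; apply: eq_bigr => i; rewrite mem_iota add0n => /andP[_ Hi].
rewrite !esum_BLet esum_nil !big_cons big_nil /= addn0.
have /= [-> ->] := nth_enc p0 Hi.
rewrite !eqseq_cons /= !andbT; congr (_ * _ + _ * _).
Qed.

Lemma dgE_dg x : size (L [:: 1; val x]) = dg e x.
Proof. exact: listof_size (HA x). Qed.

Lemma sum_dg2 : \sum_x dg e x = 2 * size s.
Proof.
rewrite [LHS](eq_bigr (fun a => \sum_(p <- s) ((p.1 == a) * 1 + (p.2 == a) * 1))); last first.
  by move=> a _; rewrite (sum_edges (fun _ _ => 1)).
rewrite exchange_big /= mulnC -sum1_size big_distrl /=; apply: eq_bigr => p _.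
rewrite big_split /= mul1n.
have E (z : 'I_n) : \sum_i (z == i) * 1 = 1.
  by rewrite (bigD1 z) //= eqxx big1 // => i; rewrite eq_sym => /negbTE->.
by rewrite !E.
Qed.

Lemma esum_range x c env f :
  esum (BR x xN :: c) env f = \sum_(y : 'I_n) esum c (set_nth 0 env x (val y)) f.
Proof. by rewrite esum_BR /= listof_iota. Qed.

Lemma esum_blt e1 e2 c env f : esum (blt e1 e2 :: c) env f =
  if ve inp L env e1 < ve inp L env e2 then esum c env f else 0.
Proof. by rewrite /blt esum_if /=; case: (_ < _). Qed.

Lemma esum_bnlt e1 e2 c env f : esum (bnlt e1 e2 :: c) env f =
  if ~~ (ve inp L env e1 < ve inp L env e2) then esum c env f else 0.
Proof. by rewrite /bnlt esum_if /=; case: (_ < _). Qed.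

Definition Se (x y : 'I_n) := [&& e x y, inS e D x & inS e D y].

Lemma HS x : listof (L [:: 2; val x]) (Se x).
Proof.
move=> f; rewrite (key_sum_tag L_eq) [filter _ _](_ : _ = [:: rS]); last by [].
rewrite big_seq1 /rsum /rS esum_range.
rewrite [LHS](eq_bigr (fun y => if (val y == val x) && true then \sum_(z | Se y z) f (val z) else 0)).
  by rewrite sum_pick.
move=> y _; rewrite esum_BL /= (HA y) andbT.
rewrite [LHS](eq_bigr (fun z : 'I_n => (inS e D y && inS e D z) * ((val y == val x) * f z))); last first.
  move=> z _; rewrite !esum_blt esum_nil big_seq1 /= !dgE_dg /inS.
  by case: (D < dg e y); case: (D < dg e z); rewrite //= ?mul0n // !eqseq_cons /= !andbT mul1n.
case: (val y == val x); last by rewrite big1 // => z _; rewrite mul0n muln0.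
rewrite [LHS]big_mkcond [RHS]big_mkcond; apply: eq_bigr => z _; rewrite /Se.
by case: (e y z); case: (inS _ _ y); case: (inS _ _ z); rewrite /= ?mul1n ?mul0n.
Qed.

Notation U := (U e D).
Notation cd := (cd e D).
Notation fatp := (fatp e D).
Notation Yt := (Yt e D).
Notation Et := (Et e D).
Notation Gt := (Gt e D).
Notation Xt := (Xt e D).
Notation Ad := (Ad e D).

Lemma val_neq (x y : 'I_n) : (val x != val y) = (x != y). Proof. by []. Qed.

Lemma esum_ctx2 k f : k < 3 -> esum (ctx2 k) env0 f =
  \sum_x0 \sum_x1 \sum_(x2 | U k x0 x1 x2) f [:: val x0; val x1; val x2; 0; 0; 0; 0].
Proof.
case: k => [|[|[|]]] // _; rewrite /ctx2 /= esum_range.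
- rewrite [RHS]exchange_big; apply: eq_bigr => x1 _.
  rewrite esum_BL /= (HA x1) /= [LHS]big_mkcond.
  rewrite [RHS](eq_bigr (fun x0 => \sum_x2 if U 0 x0 x1 x2 then f [:: val x0; val x1; val x2; 0; 0; 0; 0] else 0)); last first.
    by move=> x0 _; rewrite big_mkcond.
  rewrite [RHS]exchange_big; apply: eq_bigr => x2 _.
  rewrite esum_bnlt /= !dgE_dg esum_BL /= (HA x1) /=.
  rewrite /Walks.U /= /twalk /poor.
  case: (e x1 x2); last by rewrite big1 // => x0 _; rewrite andbF.
  case: (~~ _); last by rewrite big1 // => x0 _; rewrite andbF.
  rewrite [LHS]big_mkcond; apply: eq_bigr => x0 _.
  rewrite esum_bne esum_nil /= [e x0 x1]e_sym andbT val_neq.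
  by case: (e x1 x0).
- apply: eq_bigr => x0 _; rewrite esum_blt /= dgE_dg esum_BL /= (HA x0) /= /Walks.U /= /twalk /heavy.
  case: (D * D < dg e x0); last first.
    by rewrite big1 // => x1 _; rewrite big_pred0 // => x2; rewrite andbF.
  rewrite big_mkcond; apply: eq_bigr => x1 _; case E1: (e x0 x1); last by rewrite big_pred0.
  rewrite esum_BL /= (HA x1) /= big_mkcond [RHS]big_mkcond; apply: eq_bigr => x2 _.
  by rewrite esum_bne esum_nil /= andbT val_neq; case: (e x1 x2).
- rewrite [RHS]exchange_big; apply: eq_bigr => x1 _.
  rewrite esum_BL /= (HS x1) /= big_mkcond; apply: eq_bigr => x0 _.
  rewrite esum_BL /= (HS x1) /= /Walks.U /= /twalk /Se [e x0 x1]e_sym.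
  case: (e x1 x0); last by rewrite /= [RHS]big_pred0.
  case: (inS e D x1); last by rewrite /= [RHS]big_pred0 // => x2; rewrite !andbF.
  case: (inS e D x0); last by rewrite /= [RHS]big_pred0 // => x2; rewrite !andbF.
  rewrite /= big_mkcond [RHS]big_mkcond; apply: eq_bigr => x2 _.
  rewrite esum_bne esum_nil /= val_neq.
  by case: (e x1 x2); case: (inS e D x2); rewrite ?andbF ?andbT.
Qed.

Lemma sum_pick2 (a c : 'I_n) (F : 'I_n -> 'I_n -> nat) :
  \sum_x \sum_y ((val x == val a) && (val y == val c)) * F x y = F a c.
Proof.
rewrite (bigD1 a) //= [X in _ + X]big1 ?addn0; last first.
  by move=> x N; rewrite big1 // => y _; rewrite val_eqE (negbTE N).
rewrite (bigD1 c) //= !eqxx mul1n big1 ?addn0 // => y N.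
by rewrite [val y == _]val_eqE (negbTE N) andbF.
Qed.

Lemma HM k x0 x2 : k < 3 -> listof (L [:: 3; k; val x0; val x2]) (fun x1 => U k x0 x1 x2).
Proof.
move=> k3 f; rewrite (key_sum_tag L_eq) [filter _ _](_ : _ = [seq rM k | k <- iota 0 3]); last by [].
have k_in : k \in iota 0 3 by rewrite mem_iota.
rewrite big_map (bigD1_seq k k_in (iota_uniq 0 3)) /=.
rewrite [X in _ + X]big1 ?addn0; last first.
  move=> j Nj; rewrite /rsum /esum big1 // => env _; rewrite big_seq1 /=.
  by rewrite !eqseq_cons (negbTE Nj) /= ?andbF.
rewrite /rsum esum_ctx2 //.
rewrite [LHS](eq_bigr (fun a => \sum_c ((val a == val x0) && (val c == val x2)) * \sum_(x1 | U k a x1 c) f (val x1))).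
  by rewrite sum_pick2.
move=> a _; rewrite (exchange_big_dep xpredT) //=; apply: eq_bigr => c _.
rewrite big_distrr /= ; apply: eq_bigr => x1 _.
by rewrite big_seq1 /= !eqseq_cons !eqxx /= andbT.
Qed.

Lemma cdE k x0 x2 : k < 3 -> size (L [:: 3; k; val x0; val x2]) = cd k x0 x2.
Proof. by move=> k3; rewrite (listof_size (HM x0 x2 k3)). Qed.

Lemma HL x1 x2 : listof (L [:: 4; val x1; val x2]) (fun x3 => U 2 x1 x2 x3 && ~~ fatp 2 x1 x3).
Proof.
move=> f; rewrite (key_sum_tag L_eq) [filter _ _](_ : _ = [:: rL]); last by [].
rewrite big_seq1 /rsum /rL esum_cat esum_ctx2 //.
rewrite [LHS](eq_bigr (fun a => \sum_c ((val a == val x1) && (val c == val x2)) * \sum_(x3 | U 2 a c x3 && ~~ fatp 2 a x3) f (val x3))).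
  by rewrite sum_pick2.
move=> a _; apply: eq_bigr => c _; rewrite big_distrr /= big_mkcond [RHS]big_mkcond.
apply: eq_bigr => x3 _; rewrite esum_blt esum_nil /= cdE // big_seq1 /= !eqseq_cons /= andbT.
by rewrite /Walks.fatp negbK; case: (U 2 a c x3); case: (_ < _).
Qed.

Lemma Ad_list k x2 : k < 3 -> listof (L (if k == 2 then [:: 2; val x2] else [:: 1; val x2])) (Ad k x2).
Proof.
move=> k3; case: eqP => [->|/eqP N].
  by apply: listof_eq (HS x2) => x3; rewrite /Se /Ad.
by apply: listof_eq (HA x2) => x3; rewrite /Walks.Ad (negbTE N) andbT.
Qed.

Lemma Xt_list k x1 x2 : k < 3 ->
  listof (L (if k == 2 then [:: 4; val x1; val x2] else [:: 1; val x2])) (Xt k x1 x2).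
Proof.
by move=> k3; rewrite /Walks.Xt; case: eqP => _; [exact: HL | exact: HA].
Qed.

Definition hd k (x0 x2 : 'I_n) := head 0 (L [:: 3; k; val x0; val x2]).

Lemma head_pick k x0 x2 (F : nat -> nat) : k < 3 -> fatp k x0 x2 ->
  \sum_(x1 | U k x0 x1 x2) (if hd k x0 x2 == val x1 then F (val x1) else 0) = F (hd k x0 x2).
Proof.
move=> k3 F1; have [x1 H1 E1] := listof_head (HM x0 x2 k3) (fat_has F1).
rewrite /hd E1 (bigD1 x1) //= eqxx big1 ?addn0 // => y /andP[_ N].
by rewrite eq_sym val_eqE (negbTE N).
Qed.

Lemma esum_ctxY k f : k < 3 -> esum (ctxY k) env0 f =
  \sum_x0 \sum_x2 \sum_(x3 | Yt k x0 x2 x3) f [:: val x0; hd k x0 x2; val x2; val x3; 0; 0; 0].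
Proof.
move=> k3; rewrite /ctxY esum_cat esum_ctx2 //; apply: eq_bigr => x0 _.
rewrite (exchange_big_dep xpredT) //=; apply: eq_bigr => x2 _.
pose F v := if fatp k x0 x2 then \sum_(x3 | Ad k x2 x3)
  (if x3 != x0 then f [:: val x0; v; val x2; val x3; 0; 0; 0] else 0) else 0.
rewrite [LHS](eq_bigr (fun x1 : 'I_n => if hd k x0 x2 == val x1 then F (val x1) else 0)); last first.
  move=> x1 _; rewrite esum_if /= -/(hd k x0 x2); case: (hd k x0 x2 == val x1) => //=.
  rewrite esum_bnlt /= cdE // /F /Walks.fatp; case: (~~ _) => //.
  rewrite esum_BL (_ : vk _ _ = if k == 2 then [:: 2; val x2] else [:: 1; val x2]); last by case: (k == 2).
  rewrite (Ad_list x2 k3).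
  by apply: eq_bigr => x3 _; rewrite esum_bne esum_nil /= val_neq.
have [F1|F1] := boolP (fatp k x0 x2); last first.
  rewrite big1; last by move=> x1 _; rewrite /F (negbTE F1); case: ifP.
  by rewrite big_pred0 // => x3; rewrite /Walks.Yt (negbTE F1).
rewrite (head_pick F) // /F F1 big_mkcond [RHS]big_mkcond; apply: eq_bigr => x3 _.
by rewrite /Walks.Yt F1 /=; case: (Ad k x2 x3).
Qed.

Lemma esum_ctxE k f : k < 3 -> esum (ctxE k) env0 f =
  \sum_x0 \sum_x1 \sum_x2 \sum_(x3 | Et k x0 x1 x2 x3)
    f [:: val x0; val x1; val x2; val x3; 0; 0; 0].
Proof.
move=> k3; rewrite /ctxE esum_cat esum_ctx2 //; apply: eq_bigr => x0 _.
apply: eq_bigr => x1 _; rewrite big_mkcond; apply: eq_bigr => x2 _.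
rewrite esum_blt /= cdE // /Walks.Et /Walks.fatp negbK.
case: (U k x0 x1 x2); last by rewrite big_pred0.
case: (_ < _); last by rewrite big_pred0.
rewrite esum_BL (_ : vk _ _ = if k == 2 then [:: 4; val x1; val x2] else [:: 1; val x2]); last by case: (k == 2).
rewrite (Xt_list x1 x2 k3).
rewrite big_mkcond [RHS]big_mkcond; apply: eq_bigr => x3 _.
by rewrite !esum_bne esum_nil /= !val_neq; case: (Xt k x1 x2 x3); case: (x3 != x0); case: (x3 != x1).
Qed.

Lemma HY k x0 x3 : k < 3 -> listof (L [:: 5; k; val x0; val x3]) (fun x2 => Yt k x0 x2 x3).
Proof.
move=> k3 f; rewrite (key_sum_tag L_eq) [filter _ _](_ : _ = [seq rY k | k <- iota 0 3]); last by [].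
have k_in : k \in iota 0 3 by rewrite mem_iota.
rewrite big_map (bigD1_seq k k_in (iota_uniq 0 3)) /=.
rewrite [X in _ + X]big1 ?addn0; last first.
  move=> j Nj; rewrite /rsum /esum big1 // => env _; rewrite big_seq1 /=.
  by rewrite !eqseq_cons (negbTE Nj) /= ?andbF.
rewrite /rsum esum_ctxY //.
rewrite [LHS](eq_bigr (fun a => \sum_c ((val a == val x0) && (val c == val x3)) * \sum_(x2 | Yt k a x2 c) f (val x2))).
  by rewrite sum_pick2.
move=> a _; rewrite (exchange_big_dep xpredT) //=; apply: eq_bigr => c _.
rewrite big_distrr /= ; apply: eq_bigr => x1 _.
by rewrite big_seq1 /= !eqseq_cons !eqxx /= andbT.
Qed.

Lemma sum_pick3 (a b c : 'I_n) (F : 'I_n -> 'I_n -> 'I_n -> nat) :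
  \sum_x \sum_y \sum_z [&& val x == val a, val z == val c & val y == val b] * F x y z = F a b c.
Proof.
rewrite (bigD1 a) //= [X in _ + X]big1 ?addn0; last first.
  by move=> x N; rewrite big1 // => y _; rewrite big1 // => z _; rewrite val_eqE (negbTE N).
rewrite eqxx (bigD1 b) //= [X in _ + X]big1 ?addn0; last first.
  by move=> y N; rewrite big1 // => z _; rewrite [val y == _]val_eqE (negbTE N) !andbF.
rewrite eqxx (bigD1 c) //= eqxx mul1n big1 ?addn0 // => z N.
by rewrite [val z == _]val_eqE (negbTE N).
Qed.

Lemma HE k x0 x3 x1 : k < 3 ->
  listof (L [:: 6; k; val x0; val x3; val x1]) (fun x2 => Et k x0 x1 x2 x3).
Proof.
move=> k3 f; rewrite (key_sum_tag L_eq) [filter _ _](_ : _ = [seq rE k | k <- iota 0 3]); last by [].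
have k_in : k \in iota 0 3 by rewrite mem_iota.
rewrite big_map (bigD1_seq k k_in (iota_uniq 0 3)) /=.
rewrite [X in _ + X]big1 ?addn0; last first.
  move=> j Nj; rewrite /rsum /esum big1 // => env _; rewrite big_seq1 /=.
  by rewrite !eqseq_cons (negbTE Nj) /= ?andbF.
rewrite /rsum esum_ctxE //.
rewrite [LHS](eq_bigr (fun a => \sum_b \sum_c [&& val a == val x0, val c == val x3 & val b == val x1] *
   \sum_(x2 | Et k a b x2 c) f (val x2))); first by rewrite sum_pick3.
move=> a _; apply: eq_bigr => b _; rewrite (exchange_big_dep xpredT) //=; apply: eq_bigr => c _.
rewrite big_distrr /= ; apply: eq_bigr => x2 _.
by rewrite big_seq1 /= !eqseq_cons !eqxx /= andbT.
Qed.

Lemma HG k x0 x3 : k < 3 -> listof (L [:: 7; k; val x0; val x3]) (Gt k x0 x3).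
Proof.
move=> k3 f; rewrite (key_sum_tag L_eq) [filter _ _](_ : _ = [seq rG k | k <- iota 0 3]); last by [].
have k_in : k \in iota 0 3 by rewrite mem_iota.
rewrite big_map (bigD1_seq k k_in (iota_uniq 0 3)) /=.
rewrite [X in _ + X]big1 ?addn0; last first.
  move=> j Nj; rewrite /rsum /esum big1 // => env _; rewrite big_seq1 /=.
  by rewrite !eqseq_cons (negbTE Nj) /= ?andbF.
rewrite /rsum esum_cat esum_ctxE //.
rewrite [LHS](eq_bigr (fun a => \sum_c ((val a == val x0) && (val c == val x3)) * \sum_(x1 | Gt k a c x1) f (val x1))).
  by rewrite sum_pick2.
move=> a _.
rewrite [LHS](eq_bigr (fun b => \sum_c \sum_(x2 | Et k a b x2 c)
   (if head 0 (L [:: 6; k; val a; val c; val b]) == val x2 then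
     ((val a == val x0) && (val c == val x3)) * f (val b) else 0))); last first.
  move=> b _; rewrite (exchange_big_dep xpredT) //=; apply: eq_bigr => c _; apply: eq_bigr => x2 _.
  rewrite esum_if /= esum_nil big_seq1 /= !eqseq_cons !eqxx /= andbT.
  by case: (head 0 _ == _).
rewrite exchange_big; apply: eq_bigr => c _; rewrite big_distrr /= [RHS]big_mkcond.
apply: eq_bigr => b _; rewrite /Walks.Gt; case: existsP => [Hex|N]; last first.
  by rewrite big_pred0 // => x2; apply/negP => H; apply: N; exists x2.
have [x2 H2 E2] := listof_head (HE a c b k3) Hex.
rewrite E2 (bigD1 x2) //= eqxx big1 ?addn0 // => y /andP[_ N].
by rewrite eq_sym val_eqE (negbTE N).
Qed.

End Spec.

(** * Running time *)

(** The count is the least d with [m <= d ^ 5]. For [d > 1] minimality gives [d.-1 ^ 5 < m], and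
    doubling [d.-1] reaches d, at the price of [2 ^ 5 = 32]. *)
Lemma fifth_root m : 0 < m ->
  let D := count (fun i => i ^ 5 < m) (iota 0 m) in [/\ 0 < D, m <= D ^ 5 & D ^ 5 <= 32 * m].
Proof.
move=> m0; have ex : exists d, m <= d ^ 5.
  by exists m; rewrite -[leqLHS]expn1 leq_pexp2l.
case: (ex_minnP ex) => d Hd Hmin.
have dm : d <= m by apply: Hmin; rewrite -[leqLHS]expn1 leq_pexp2l.
have d0 : 0 < d by case: d Hd {Hmin dm} => //; rewrite exp0n // leqNgt m0.
have -> : count (fun i => i ^ 5 < m) (iota 0 m) = d.
  rewrite (eq_count (a2 := fun i => i < d)); last first.
    move=> i /=; apply/idP/idP => H.
      by rewrite ltnNge; apply: contraL H => H; rewrite -leqNgt (leq_trans Hd) // leq_exp2r.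
    by rewrite ltnNge; apply: contraL H => /Hmin; rewrite -leqNgt.
  rewrite -(subnKC dm) iotaD count_cat add0n addnC.
  rewrite (eq_in_count (a2 := pred0)); last by move=> i; rewrite mem_iota /=; lia.
  rewrite count_pred0 add0n (eq_in_count (a2 := predT)); last by move=> i; rewrite mem_iota /=; lia.
  by rewrite count_predT size_iota.
split=> //; have [d1|d1] := leqP d 1.
  have -> : d = 1 by lia.
  by rewrite exp1n; lia.
have H1 : d.-1 ^ 5 < m by rewrite ltnNge; apply/negP => /Hmin; lia.
have H2 : d ^ 5 <= (2 * d.-1) ^ 5 by rewrite leq_exp2r //; lia.
by move: H2; rewrite expnMn -[2 ^ 5]/32; lia.
Qed.

Section Visits.
Variables (n : nat) (G : sgraph 'I_n) (s : seq ('I_n * 'I_n)) (L : table).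
Hypothesis s_edges : is_edge_list G s.
Notation inp := (encode_input s).
Hypothesis L_eq : forall k, L k = at_key k (rules_events inp L rules).
Hypothesis n_le : n <= size s.
Hypothesis s_gt0 : 0 < size s.
Notation e := (adj G : rel 'I_n).
Notation D := (size (L [:: 0])).
Notation esum := (esum inp L).
Notation vis := (vis inp L).
Notation U := (U e D).
Notation cd := (cd e D).
Notation fatp := (fatp e D).
Notation Yt := (Yt e D).
Notation Et := (Et e D).
Notation Gt := (Gt e D).
Notation Xt := (Xt e D).
Notation Ad := (Ad e D).
Notation Vc := (Vc e).
Notation MM := (MM e D).

Let e_sym : symmetric e := adj_sym G.
Let e_irr : irreflexive e := adj_irrefl G.

Lemma D_root : [/\ 0 < D, size s <= D ^ 5 & D ^ 5 <= 32 * size s].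
Proof. by rewrite (D_count L_eq); exact: fifth_root. Qed.

Let D0 : 0 < D. Proof. by case: D_root. Qed.
Let mD : size s <= D ^ 5. Proof. by case: D_root. Qed.
Let sdg := sum_dg2 s_edges.
Lemma HUT k : k < 3 -> UT e D k <= 100 * MM. Proof. exact: (UT_le e_sym sdg mD D0). Qed.
Let HYT k : k < 3 -> YT e D k <= 200 * MM. Proof. exact: (YT_le e_sym sdg mD D0). Qed.
Let HET k : k < 3 -> ET e D k <= 300 * MM. Proof. exact: (ET_le e_sym sdg mD D0). Qed.
Let mMM : size s <= MM. Proof. exact: m_MM mD D0. Qed.
Let MM0 : 0 < MM. Proof. exact: leq_trans s_gt0 mMM. Qed.

(** Separates the visits made by a context itself from the work done at its innermost point, so that
    contexts can be bounded once and extended later. *)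
Lemma vis_split c env f : vis c env f = vis c env (fun=> 0) + esum c env f.
Proof.
elim: c env => [|[x|x y|x k|x y] c IH] env /=.
- by rewrite esum_nil.
- by rewrite esum_if -addnA; case: ifP => // _; rewrite IH.
- by rewrite esum_BR -addnA -big_split; congr (_ + _); apply: eq_bigr => v _; rewrite IH.
- by rewrite esum_BL -addnA -big_split; congr (_ + _); apply: eq_bigr => v _; rewrite IH.
- by rewrite esum_BLet -addnA IH.
Qed.

Lemma vis_cat_split c1 c2 env f :
  vis (c1 ++ c2) env f = vis c1 env (fun=> 0) + esum c1 env (fun e => vis c2 e f).
Proof. by rewrite vis_cat vis_split. Qed.

Lemma sum_n : \sum_(x : 'I_n) 1 = n.
Proof. by rewrite sum1_card card_ord. Qed.

Lemma sum_arcs : \sum_x \sum_(y | e x y) 1 = 2 * size s.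
Proof. exact: sdg. Qed.

Lemma vis_range x c env f :
  vis (BR x xN :: c) env f = 1 + \sum_(y : 'I_n) vis c (set_nth 0 env x (val y)) f.
Proof. by rewrite /= listof_iota. Qed.

Lemma vis2 k : k < 3 -> vis (ctx2 k) env0 (fun=> 0) <= 300 * MM.
Proof.
have Hn : n <= MM by exact: leq_trans n_le mMM.
have D8 : D ^ 8 <= MM by exact: leq_addr.
case: k => [|[|[|]]] // _; rewrite /ctx2 vis_range.
- apply: leq_trans (_ : 1 + (n + (2 * size s + 2 * (2 * D ^ 8))) <= _); last by lia.
  rewrite leq_add2l; apply: leq_trans (_ : _ <= n + (2 * size s + 2 * \sum_x1 \sum_(x2 | e x1 x2 && poor e D x1 x2) dg e x1 * dg e x2)) _; last first.
    by rewrite !leq_add2l leq_mul2l /=; exact: (poor_walks sdg mD).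
  rewrite -[X in X + _]sum_n -sum_arcs big_distrr -!big_split; apply: leq_sum => x1 _ /=.
  rewrite (HA s_edges L_eq) leq_add2l big_distrr /= [X in _ <= _ + X]big_mkcond.
  rewrite [leqLHS]big_mkcond [X in _ <= X + _]big_mkcond -big_split /=; apply: leq_sum => x2 _.
  case E1: (e x1 x2) => //=; rewrite leq_add2l !(dgE_dg s_edges L_eq) /poor.
  case: (D * D * D < _) => //=; rewrite (HA s_edges L_eq).
  rewrite (eq_bigr (fun=> 1)) -/(dg e x1); last by move=> x _; rewrite if_same.
  have H1 := dg_gt0 E1; have H2 : 0 < dg e x2 by apply: (@dg_gt0 _ _ x2 x1); rewrite e_sym.
  by move: H1 H2; move: (dg e x1) (dg e x2) => a b; clear; nia.
- apply: leq_trans (_ : 1 + (n + (n + 2 * (4 * D ^ 8))) <= _); last by lia.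
  rewrite leq_add2l; apply: leq_trans (_ : _ <= n + (n + 2 * \sum_x0 \sum_(x1 | e x0 x1) heavy e D x0 * dg e x1)) _; last first.
    by rewrite !leq_add2l leq_mul2l /=; exact: (heavy_walks sdg mD D0).
  rewrite -[X in _ <= X + _]sum_n -[X in _ <= _ + (X + _)]sum_n big_distrr -!big_split; apply: leq_sum => x0 _ /=.
  rewrite leq_add2l (dgE_dg s_edges L_eq) -/(heavy e D x0); case: (heavy e D x0) => //=.
  rewrite leq_add2l (HA s_edges L_eq) big_distrr /=; apply: leq_sum => x1 E1.
  rewrite mul1n (HA s_edges L_eq).
  rewrite (eq_bigr (fun=> 1)) -/(dg e x1); last by move=> x _; rewrite if_same.
  have H2 : 0 < dg e x1 by apply: (@dg_gt0 _ _ x1 x0); rewrite e_sym.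
  by move: H2; move: (dg e x1) => a; clear; lia.
- apply: leq_trans (_ : 1 + (n + (2 * size s + (2 * size s + UT e D 2))) <= _); last first.
    by have := HUT (isT : 2 < 3); lia.
  rewrite leq_add2l; apply: leq_trans (_ : _ <= n + (2 * size s + (2 * size s + \sum_x1 \sum_x0 \sum_x2 U 2 x0 x1 x2))) _; last first.
    by rewrite !leq_add2l /UT exchange_big.
  rewrite -[X in X + _]sum_n -sum_arcs -!big_split; apply: leq_sum => x1 _ /=.
  rewrite (HS s_edges L_eq) leq_add2l [X in _ <= X + _]big_mkcond [X in _ <= _ + (X + _)]big_mkcond -!big_split /=.
  rewrite [leqLHS]big_mkcond; apply: leq_sum => x0 _; case: ifP => // Hs; case/and3P: (Hs) => E1 S1 S0.
  rewrite E1 leq_add2l (HS s_edges L_eq).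
  rewrite [leqLHS](eq_bigr (fun=> 1)); last by move=> x _; rewrite if_same.
  apply: leq_trans (sum_rem _ x0) _; rewrite leq_add2l big_mkcond; apply: leq_sum => x2 _.
  case: ifP => // /andP[/and3P[E2 _ S2] N].
  by rewrite /Walks.U /twalk /= e_sym E1 E2 eq_sym N S0 S1 S2.
Qed.

Lemma esum2_1 k : k < 3 -> esum (ctx2 k) env0 (fun=> 1) = UT e D k.
Proof.
move=> k3; rewrite (esum_ctx2 s_edges L_eq) //.
by do 2 (apply: eq_bigr => ? _); rewrite big_mkcond; apply: eq_bigr => ? _; case: (U _ _ _ _).
Qed.

Lemma visY k : k < 3 -> vis (ctxY k) env0 (fun=> 0) <= 900 * MM.
Proof.
move=> k3; rewrite /ctxY vis_cat_split.
apply: leq_trans (_ : 300 * MM + (2 * UT e D k + (UT e D k + YT e D k)) <= _); last first.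
  by have := HUT k3; have := HYT k3; lia.
rewrite leq_add ?vis2 // -esum2_1 // !(esum_ctx2 s_edges L_eq) //.
apply: leq_trans (_ : _ <= 2 * (\sum_x0 \sum_x1 \sum_(x2 | U k x0 x1 x2) 1) +
  (\sum_x0 \sum_x2 fatp k x0 x2 + YT e D k)) _; last first.
  rewrite leq_add2l leq_add2r; apply: leq_trans (fat_U _ _ _) _.
  by rewrite -esum2_1 // (esum_ctx2 s_edges L_eq).
rewrite /YT big_distrr -!big_split; apply: leq_sum => x0 _ /=.
rewrite (exchange_big_dep xpredT) //= big_distrr /=.
rewrite [X in _ <= X + _](_ : _ = \sum_x2 \sum_(x1 | U k x0 x1 x2) 2); last first.
  rewrite (exchange_big_dep xpredT) //=; apply: eq_bigr => x1 _; rewrite big_distrr /=.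
  by apply: eq_bigr => *; rewrite muln1.
rewrite -!big_split; apply: leq_sum => x2 _ /=.
rewrite (cdE s_edges L_eq) // -/(hd L k x0 x2).
pose Q := if fatp k x0 x2 then 1 + \sum_(x3 | Ad k x2 x3) 1 else 0.
apply: leq_trans (_ : \sum_(x1 | U k x0 x1 x2) (2 + (if hd L k x0 x2 == val x1 then Q else 0)) <= _).
  apply: leq_sum => x1 _; case: (hd L k x0 x2 == val x1) => //=.
  rewrite /Q /Walks.fatp /thr; case: (_ < _) => //=; rewrite -[leqLHS]/(3 + _) -[leqRHS]/(3 + _) leq_add2l.
  rewrite (_ : vk _ _ = if k == 2 then [:: 2; val x2] else [:: 1; val x2]); last by case: (k == 2).
  rewrite (Ad_list s_edges L_eq x2 k3).
  by apply: leq_sum => x3 _; case: ifP.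
rewrite big_split /= leq_add2l.
have [F|F] := boolP (fatp k x0 x2).
  by rewrite (head_pick s_edges L_eq (fun=> Q) k3 F) /Q F.
by rewrite big1 // => x1 _; rewrite /Q (negbTE F); case: ifP.
Qed.

Lemma visE k : k < 3 -> vis (ctxE k) env0 (fun=> 0) <= 1100 * MM.
Proof.
move=> k3; rewrite /ctxE vis_cat_split.
apply: leq_trans (_ : 300 * MM + (2 * UT e D k + 2 * ET e D k) <= _); last first.
  by have := HUT k3; have := HET k3; lia.
rewrite leq_add ?vis2 // -esum2_1 // !(esum_ctx2 s_edges L_eq) // /ET !big_distrr -big_split.
apply: leq_sum => x0 _ /=; rewrite !big_distrr -big_split; apply: leq_sum => x1 _ /=.
rewrite !big_distrr /= [leqLHS]big_mkcond [X in _ <= X + _]big_mkcond [X in _ <= _ + X]big_mkcond -big_split.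
apply: leq_sum => x2 _ /=; case: (U k x0 x1 x2) => //=.
rewrite (cdE s_edges L_eq) // /Walks.fatp negbK /thr; case: (_ < _) => //=.
rewrite muln1 -[leqLHS]/(2 + _) leq_add2l.
rewrite (_ : vk _ _ = if k == 2 then [:: 4; val x1; val x2] else [:: 1; val x2]); last by case: (k == 2).
rewrite (Xt_list s_edges L_eq x1 x2 k3) big_distrr /=.
by apply: leq_sum => x3 _; rewrite muln1; case: ifP => //; case: ifP.
Qed.

Lemma esumY_1 k : k < 3 -> esum (ctxY k) env0 (fun=> 1) <= 200 * MM.
Proof.
move=> k3; apply: leq_trans (HYT k3); rewrite (esum_ctxY s_edges L_eq) //.
apply: leq_sum => x0 _; apply: leq_sum => x2 _; apply: sum_subpred => x3.
by case/and3P=> -> ->.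
Qed.

Lemma esumE_1 k : k < 3 -> esum (ctxE k) env0 (fun=> 1) <= 300 * MM.
Proof.
move=> k3; apply: leq_trans (HET k3); rewrite (esum_ctxE s_edges L_eq) //.
apply: leq_sum => x0 _; apply: leq_sum => x1 _; rewrite [leqRHS]big_mkcond.
apply: leq_sum => x2 _; case: ifP => [_|N].
  by apply: sum_subpred => x3 /and5P[].
by rewrite big_pred0 // => x3; rewrite /Walks.Et andbA N.
Qed.

Lemma V_order (P : 'I_n -> 'I_n -> 'I_n -> bool) :
  \sum_x0 \sum_x2 \sum_(x3 | P x0 x2 x3) \sum_x1 \sum_x4 \sum_x5 Vc x0 x1 x2 x3 x4 x5 <= TT e.
Proof.
apply: leq_sum => x0 _; rewrite [leqRHS]exchange_big; apply: leq_sum => x2 _.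
rewrite [leqRHS]exchange_big /=; exact: sum_subpred.
Qed.

Variable gs : seq binder.
Hypothesis gs_if : all is_if gs.
Hypothesis gs_size : size gs <= 10.

Let gs_vis env : vis gs env (fun=> 1) <= 11.
Proof. by apply: leq_trans (vis_ifs _ _ _ gs_if) _; rewrite addn1. Qed.

Lemma vis_YY k k' : k < 3 -> k' < 3 ->
  vis (ctxY k ++ pairYY k k' ++ gs) env0 (fun=> 1) <= 2000 * MM.
Proof.
move=> k3 k3'; rewrite vis_cat_split.
apply: leq_trans (_ : 900 * MM + (2 * esum (ctxY k) env0 (fun=> 1) + 42 * TT e) <= _); last first.
  have : TT e <= MM by exact: leq_addl.
  by have := esumY_1 k3; lia.
rewrite leq_add ?visY //; apply: leq_trans (_ : _ <= 2 * esum (ctxY k) env0 (fun=> 1) +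
   42 * \sum_x0 \sum_x2 \sum_(x3 | Yt k x0 x2 x3) \sum_x1 \sum_x4 \sum_x5 Vc x0 x1 x2 x3 x4 x5) _; last first.
  by rewrite leq_add2l leq_mul2l V_order.
rewrite !(esum_ctxY s_edges L_eq) // !big_distrr -big_split; apply: leq_sum => x0 _ /=.
rewrite !big_distrr -big_split; apply: leq_sum => x2 _ /=.
rewrite !big_distrr -big_split; apply: leq_sum => x3 Y /=.
have YP := YY_point e_sym k' Y.
rewrite (HY s_edges L_eq) //.
apply: leq_trans (_ : 1 + \sum_(x4 | Yt k' x0 x4 x3) (1 + (if x4 != x2 then 13 * (cd k x0 x2 * cd k' x0 x4) else 0)) <= _).
  rewrite leq_add2l; apply: leq_sum => x4 Y4; rewrite val_eqE leq_add2l.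
  case: (x4 == x2) => //=.
  rewrite (HM s_edges L_eq) //.
  apply: leq_trans (_ : 1 + \sum_(x1 | U k x0 x1 x2) (1 + 11 * cd k' x0 x4) <= _).
    rewrite leq_add2l; apply: leq_sum => x1 _; rewrite leq_add2l (HM s_edges L_eq) //.
    by rewrite /Walks.cd big_distrr /=; apply: leq_sum => x5 _; rewrite muln1 gs_vis.
  have -> : \sum_(x1 | U k x0 x1 x2) (1 + 11 * cd k' x0 x4) = cd k x0 x2 * (1 + 11 * cd k' x0 x4).
    by rewrite /Walks.cd big_distrl /=; apply: eq_bigr => *; rewrite mul1n.
  case/and3P: Y => /fatp_ge F1 _ _; case/and3P: Y4 => /fatp_ge F2 _ _.
  move: F1 F2; move: (cd _ _ _) (cd _ _ _) => a b; clear; nia.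
rewrite big_split /= -big_mkcondr /= -big_distrr /=.
have H1 := Ycount e D k' x0 x2 x3.
have H2 : \sum_(x4 | Yt k' x0 x4 x3 && (x4 != x2)) 1 <=
  \sum_(x4 | Yt k' x0 x4 x3 && (x4 != x2)) cd k x0 x2 * cd k' x0 x4.
  apply: leq_sum => x4 /andP[Y4 _].
  case/and3P: Y => /fatp_ge F1 _ _; case/and3P: Y4 => /fatp_ge F2 _ _.
  move: F1 F2; move: (cd _ _ _) (cd _ _ _) => a b; clear; nia.
(* Here a counts all fat partners, b those with x4 different from x2, c the pairs of middles tried,
   and d the 6-cycles found; [14 * 3 = 42]. *)
have arith a b c d : c <= 3 * d -> a <= 1 + b -> b <= c -> 1 + (a + 13 * c) <= 2 * 1 + 42 * d by lia.
exact: (arith _ _ _ _ YP H1 H2).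
Qed.

Lemma vis_YE k k' : k < 3 -> k' < 3 ->
  vis (ctxY k ++ pairYE k k' ++ gs) env0 (fun=> 1) <= 4990 * MM.
Proof.
move=> k3 k3'; rewrite vis_cat_split.
apply: leq_trans (_ : 900 * MM + (20 * esum (ctxY k) env0 (fun=> 1) + 32 * TT e) <= _); last first.
  have : TT e <= MM by exact: leq_addl.
  by have := esumY_1 k3; lia.
rewrite leq_add ?visY //; apply: leq_trans (_ : _ <= 20 * esum (ctxY k) env0 (fun=> 1) +
   32 * \sum_x0 \sum_x2 \sum_(x3 | Yt k x0 x2 x3) \sum_x1 \sum_x4 \sum_x5 Vc x0 x1 x2 x3 x4 x5) _; last first.
  by rewrite leq_add2l leq_mul2l V_order.
rewrite !(esum_ctxY s_edges L_eq) // !big_distrr -big_split; apply: leq_sum => x0 _ /=.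
rewrite !big_distrr -big_split; apply: leq_sum => x2 _ /=.
rewrite !big_distrr -big_split; apply: leq_sum => x3 Y /=.
have YP := YE_point e_sym k' Y; have F1 := fatp_ge (proj1 (andP Y)).
have QC := YE_count e D k' x0 x2 x3.
rewrite (HG s_edges L_eq) //.
set q := \sum_(x5 | x5 != x2) \sum_(x4 | Et k' x0 x5 x4 x3) 1 in QC.
set q' := \sum_(x5 | x5 != x2) \sum_(x4 | _ && _) 1 in QC.
set Q := \sum_(x5 | x5 != x2) \sum_(x4 | _ && _) cd k x0 x2 in YP.
have q'Q : q' <= Q by apply: leq_sum => x5 _; apply: leq_sum => x4 _; apply: leq_trans F1.
have HGt : \sum_(x5 | Gt k' x0 x3 x5 && (x5 != x2)) 1 <= q.
  exact: (Gt_le e D k' x0 x3 (fun x5 => x5 != x2) (fun=> 1)).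
pose R x5 := \sum_(x4 | Et k' x0 x5 x4 x3) 1 + \sum_(x4 | Et k' x0 x5 x4 x3 && (x4 != x2)) (12 * cd k x0 x2).
apply: leq_trans (_ : 1 + \sum_(x5 | Gt k' x0 x3 x5) (1 + (if x5 != x2 then 1 + R x5 else 0)) <= _).
  rewrite leq_add2l; apply: leq_sum => x5 _; rewrite val_eqE leq_add2l.
  case: (x5 == x2) => //=; rewrite leq_add2l (HE s_edges L_eq) // /R.
  rewrite [X in _ <= _ + X]big_mkcondr -big_split /=; apply: leq_sum => x4 _.
  rewrite val_eqE leq_add2l; case: (x4 == x2) => //=.
  rewrite (HM s_edges L_eq) //.
  apply: leq_trans (_ : 1 + 11 * cd k x0 x2 <= _); last by move: F1; clear; lia.
  rewrite leq_add2l /Walks.cd big_distrr /=; apply: leq_sum => x1 _.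
  by rewrite muln1 gs_vis.
have R_le : \sum_(x5 | x5 != x2) R x5 = q + 12 * Q.
  rewrite /R big_split /=; congr (_ + _); rewrite /Q [RHS]big_distrr /=.
  by apply: eq_bigr => x5 _; rewrite [RHS]big_distrr.
have S1 : \sum_(x5 | Gt k' x0 x3 x5) (1 + (if x5 != x2 then 1 + R x5 else 0)) <=
   (1 + q) + (q + (q + 12 * Q)).
  rewrite big_split /= leq_add //.
    by apply: leq_trans (sum_rem _ x2) _; rewrite leq_add2l.
  rewrite -big_mkcondr /= big_split /= -R_le leq_add //.
  by apply: sum_subpred => x5 /andP[].
(* Here a counts thin partners outside the group of x2, b those that also avoid x2 at x4, c the
   tried triples of partner and middle, and d the 6-cycles. The 6 is [thr]. *)
have arith X a b c d : X <= 1 + a + (a + (a + 12 * c)) -> c <= 2 * d -> a <= 6 + b -> b <= c ->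
  1 + X <= 20 * 1 + 32 * d by lia.
exact: (arith _ _ _ _ _ S1 YP QC q'Q).
Qed.

Lemma vis_EE k k' : k < 3 -> k' < 3 ->
  vis (ctxE k ++ pairEE k' ++ gs) env0 (fun=> 1) <= 99 * (1000 * MM).
Proof.
move=> k3 k3'; rewrite vis_cat_split.
apply: leq_trans (_ : 1100 * MM + (180 * esum (ctxE k) env0 (fun=> 1) + 14 * TT e) <= _); last first.
  have : TT e <= MM by exact: leq_addl.
  by have := esumE_1 k3; lia.
rewrite leq_add ?visE //; apply: leq_trans (_ : _ <= 180 * esum (ctxE k) env0 (fun=> 1) +
   14 * \sum_x0 \sum_x1 \sum_x2 \sum_(x3 | Et k x0 x1 x2 x3) \sum_x4 \sum_x5 Vc x0 x1 x2 x3 x4 x5) _; last first.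
  rewrite leq_add2l leq_mul2l /=; do 3 (apply: leq_sum => ? _); exact: sum_subpred.
rewrite !(esum_ctxE s_edges L_eq) // !big_distrr -big_split; apply: leq_sum => x0 _ /=.
rewrite !big_distrr -big_split; apply: leq_sum => x1 _ /=.
rewrite !big_distrr -big_split; apply: leq_sum => x2 _ /=.
rewrite !big_distrr -big_split; apply: leq_sum => x3 Y /=.
have YP := EE_point e_sym k' Y.
rewrite (HG s_edges L_eq) //.
set q := \sum_(x5 | _ && _) \sum_(x4 | _) 1 in YP.
pose R x5 := \sum_(x4 | Et k' x0 x5 x4 x3) 11.
apply: leq_trans (_ : 1 + \sum_(x5 | Gt k' x0 x3 x5) (2 + (if (x5 != x1) && (x5 != x2) then 1 + R x5 else 0)) <= _).
  rewrite leq_add2l; apply: leq_sum => x5 _; rewrite !val_eqE.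
  case: (x5 == x1) => //=; case: (x5 == x2) => //=.
  rewrite !addnA !leq_add2l (HE s_edges L_eq) // /R; apply: leq_sum => x4 _.
  exact: gs_vis.
have HGt : \sum_(x5 | Gt k' x0 x3 x5 && ((x5 != x1) && (x5 != x2))) 1 <= q.
  exact: (Gt_le e D k' x0 x3 (fun x5 => (x5 != x1) && (x5 != x2)) (fun=> 1)).
have S1 : \sum_(x5 | Gt k' x0 x3 x5) (2 + (if (x5 != x1) && (x5 != x2) then 1 + R x5 else 0)) <=
   2 * (2 + q) + (q + 11 * q).
  rewrite big_split /= leq_add //.
    have -> : \sum_(x5 | Gt k' x0 x3 x5) 2 = 2 * \sum_(x5 | Gt k' x0 x3 x5) 1.
      by rewrite big_distrr.
    rewrite leq_mul2l /=; apply: leq_trans (sum_rem2 _ x1 x2) _; rewrite leq_add2l.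
    by apply: leq_trans HGt.
  rewrite -big_mkcondr /= big_split /= leq_add // /q big_distrr /=.
  apply: leq_trans (_ : \sum_(x5 | (x5 != x1) && (x5 != x2)) R x5 <= _).
    by apply: sum_subpred => x5 /andP[].
  by apply: leq_sum => x5 _; rewrite /R big_distrr.
(* Here a counts the thin partners tried after skipping two groups; [2 * 6] of them may collide and
   the others give 6-cycles. *)
have arith X a d : X <= 2 * (2 + a) + (a + 11 * a) -> a <= 2 * 6 + d -> 1 + X <= 180 * 1 + 14 * d by lia.
exact: (arith _ _ _ S1 YP).
Qed.

End Visits.

Lemma nblocks_lt p : p \in nblocks -> [/\ p.2.1.1 < 3, p.2.1.2 < 3 & p.2.2 < 3].
Proof.
have : all (fun p : nat * block => [&& p.2.1.1 < 3, p.2.1.2 < 3 & p.2.2 < 3]) nblocks by [].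
by move/allP => H /H /and3P[].
Qed.

(** * The generated 6-tuples *)

Lemma envs_cat inp L c1 c2 env :
  envs inp L (c1 ++ c2) env = flatten [seq envs inp L c2 e | e <- envs inp L c1 env].
Proof.
have F (f : nat -> seq nat) vs (g : seq nat -> seq (seq nat)) :
  flatten [seq flatten [seq envs inp L c2 e | e <- g (f v)] | v <- vs] =
  flatten [seq envs inp L c2 e | e <- flatten [seq g (f v) | v <- vs]].
  by elim: vs => //= v vs ->; rewrite map_cat flatten_cat.
elim: c1 env => [|[e|x e|x k|x e] c1 IH] env /=; first by rewrite cats0.
- by case: ifP.
- by rewrite -F; congr flatten; apply: eq_map => v; rewrite IH.
- by rewrite -F; congr flatten; apply: eq_map => v; rewrite IH.
- exact: IH.
Qed.

Lemma at_key_flatten (A : Type) k (f : A -> seq (seq nat * nat)) (l : seq A) :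
  at_key k (flatten [seq f x | x <- l]) = flatten [seq at_key k (f x) | x <- l].
Proof. by elim: l => //= x l IH; rewrite at_key_cat IH. Qed.

Lemma flatten_flatten (A B C : Type) (f : A -> seq B) (g : B -> seq C) l :
  flatten [seq g y | y <- flatten [seq f x | x <- l]] = flatten [seq flatten [seq g y | y <- f x] | x <- l].
Proof. by elim: l => //= x l IH; rewrite map_cat flatten_cat IH. Qed.

Lemma sum_gt0 (A : finType) (P : pred A) (F : A -> nat) :
  0 < \sum_(x | P x) F x -> exists2 x, P x & 0 < F x.
Proof.
move=> H; have [x /andP[Px Fx]|N] := pickP (fun x => P x && (0 < F x)); first by exists x.
by move: H; rewrite big1 // => x Px; apply/eqP; have := N x; rewrite Px /= lt0n => /negbFE.
Qed.

Lemma pick_sum (A : finType) (P : pred A) (F : A -> nat) a :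
  P a -> (forall x, P x -> x != a -> F x = 0) -> \sum_(x | P x) F x = F a.
Proof.
by move=> Pa H; rewrite (bigD1 a) //= big1 ?addn0 // => x /andP[Px N]; exact: H.
Qed.

Lemma sym_lt r i : i < 6 -> sym r i < 6.
Proof. by move=> Hi; rewrite /sym; case: ifP; rewrite ltn_mod. Qed.

Lemma size_rot6 r c : size (rot6 r c) = 6.
Proof. by rewrite size_map size_iota. Qed.

Lemma nth_rot6 r c i : i < 6 -> nth 0 (rot6 r c) i = nth 0 c (sym r i).
Proof. by move=> Hi; rewrite (nth_map 0) ?size_iota // nth_iota. Qed.

Lemma rot6_map (g : nat -> nat) r c : size c = 6 -> rot6 r (map g c) = map g (rot6 r c).
Proof.
move=> H; rewrite /rot6 -map_comp; apply/eq_in_map => i; rewrite mem_iota /= => Hi.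
by rewrite (nth_map 0) // H; exact: sym_lt.
Qed.

Lemma rot6_0 c : size c = 6 -> rot6 0 c = c.
Proof. by case: c => [|c0 [|c1 [|c2 [|c3 [|c4 [|c5 [|c6 c]]]]]]]. Qed.

Lemma rot6_comp r r' : r < 12 -> r' < 12 -> exists2 r'', r'' < 12 &
  forall c, rot6 r (rot6 r' c) = rot6 r'' c.
Proof.
have H : all (fun r => all (fun r' => has (fun r'' => all (fun i =>
  sym r' (sym r i) == sym r'' i) (iota 0 6)) (iota 0 12)) (iota 0 12)) (iota 0 12) by vm_compute.
move=> Hr Hr'; have /(allP H)/allP H1 : r \in iota 0 12 by rewrite mem_iota.
have /H1 /hasP[r'' Hr'' /allP E] : r' \in iota 0 12 by rewrite mem_iota.
exists r''; first by move: Hr''; rewrite mem_iota.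
move=> c; rewrite {1 3}/rot6; apply/eq_in_map => i Hi.
by rewrite nth_rot6 ?(eqP (E i Hi)) // sym_lt //; move: Hi; rewrite mem_iota.
Qed.

Lemma rot6_inv r : r < 12 -> exists2 r', r' < 12 &
  forall c, size c = 6 -> rot6 r' (rot6 r c) = c.
Proof.
have H : all (fun r => has (fun r' => all (fun i => sym r (sym r' i) == i) (iota 0 6))
  (iota 0 12)) (iota 0 12) by vm_compute.
move=> Hr; have /(allP H)/hasP[r' Hr' /allP E] : r \in iota 0 12 by rewrite mem_iota.
exists r'; first by move: Hr'; rewrite mem_iota.
move=> c Hc; rewrite -[RHS](rot6_0 Hc) {1 3}/rot6; apply/eq_in_map => i Hi.
have i6 : i < 6 by move: Hi; rewrite mem_iota.
by rewrite nth_rot6 ?(eqP (E i Hi)) ?sym_lt // /sym /= addn0 modn_small.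
Qed.

Definition related (c c' : seq nat) := exists2 r, r < 12 & rot6 r c = c'.

Lemma related_sym c c' : size c = 6 -> related c c' -> related c' c.
Proof. by move=> Hc [r Hr <-]; have [r' Hr' E] := rot6_inv Hr; exists r'; rewrite ?E. Qed.

Lemma related_trans c c' c'' : related c c' -> related c' c'' -> related c c''.
Proof. by move=> [r Hr <-] [r' Hr' <-]; have [r'' H E] := rot6_comp Hr' Hr; exists r''. Qed.

(** * Removal of duplicates by marks *)

Section Dedup.
Variable om : seq (nat * seq nat).
Hypothesis om_size : forall q, q \in om -> size q.2 = 6.

Definition mk c (q : nat * seq nat) := [seq r + 12 * q.1 | r <- iota 0 12 & rot6 r q.2 == c].
Definition marks c := flatten [seq mk c q | q <- om].
Definition kept := [seq q <- om | head 0 (marks q.2) == 12 * q.1].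

Lemma mk_nil c q : ~ related q.2 c -> mk c q = [::].
Proof.
rewrite /mk => N; case E: [seq _ <- _ | _] => [|r rs] //; case: N.
have : r \in [seq r <- iota 0 12 | rot6 r q.2 == c] by rewrite E mem_head.
by rewrite mem_filter mem_iota => /andP[/eqP E1 Hr]; exists r.
Qed.

Lemma mk_head c q l : related q.2 c ->
  exists r, [/\ r < 12, rot6 r q.2 = c & head 0 (mk c q ++ l) = r + 12 * q.1].
Proof.
move=> [r Hr E0]; rewrite /mk; case E: [seq _ <- _ | _] => [|r' rs].
  have : r \in [seq r <- iota 0 12 | rot6 r q.2 == c] by rewrite mem_filter E0 eqxx mem_iota.
  by rewrite E.
have : r' \in [seq r <- iota 0 12 | rot6 r q.2 == c] by rewrite E mem_head.
by rewrite mem_filter mem_iota => /andP[/eqP E1 Hr']; exists r'.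
Qed.

Lemma mk_head0 q l : size q.2 = 6 -> head 0 (mk q.2 q ++ l) = 12 * q.1.
Proof. by move=> H; rewrite /mk /= rot6_0 // eqxx. Qed.

(** Tuples of one symmetry class mark the same keys, and the first generated one, q, comes first at
    each of them. So the head of the marks at a tuple of the class stems from q, and it carries
    symmetry number 0 only if that tuple is the one of q. This leaves exactly one entry per class in
    [kept]. *)
Lemma first_related c : size c = 6 -> (exists2 q, q \in om & related q.2 c) ->
  exists q, [/\ q \in om, related q.2 c & forall c', size c' = 6 -> related q.2 c' ->
    exists l, marks c' = mk c' q ++ l].
Proof.
move=> c6; pose P (q : nat * seq nat) := has (fun r => rot6 r q.2 == c) (iota 0 12).
have PP q : reflect (related q.2 c) (P q).
  apply: (iffP hasP) => [[r Hr /eqP E]|[r Hr E]].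
    by exists r => //; move: Hr; rewrite mem_iota.
  by exists r; rewrite ?E // mem_iota.
move=> [q0 Hq0 /PP Pq0]; have hP : has P om by apply/hasP; exists q0.
move: om_size; rewrite /marks; case: (split_find hP) => q om1 om2 /PP Pq Hl Hs.
have q6 : size q.2 = 6 by apply: Hs; rewrite mem_cat mem_rcons mem_head.
exists q; split=> // [|c' c6' Hc']; first by rewrite mem_cat mem_rcons mem_head.
exists (flatten [seq mk c' q' | q' <- om2]).
rewrite map_cat flatten_cat map_rcons flatten_rcons.
suff -> : flatten [seq mk c' q' | q' <- om1] = [::] by [].
have : {subset om1 <= [predC P]} by move=> x Hx; move/hasPn: Hl; apply.
elim: om1 {Hl Hs} => //= x l IH Hsub; rewrite IH; last by move=> y Hy; apply: Hsub; rewrite inE Hy orbT.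
rewrite cats0 mk_nil // => Hx; have /negP := Hsub x (mem_head _ _); apply; apply/PP.
by apply: related_trans (related_trans Hx (related_sym q6 Hc')) Pq.
Qed.

Lemma kept_repr q : q \in om -> exists2 q', q' \in kept & related q'.2 q.2.
Proof.
move=> Hq; have q6 := om_size Hq; have rr : related q.2 q.2 by exists 0; rewrite ?rot6_0.
have [q' [Hq' R F]] := first_related q6 (ex_intro2 _ _ q Hq rr).
exists q' => //; rewrite mem_filter Hq' andbT.
have q6' := om_size Hq'.
have [l ->] := F _ q6' (ex_intro2 _ _ 0 isT (rot6_0 q6')).
by rewrite mk_head0.
Qed.

Lemma kept_inj q q' : q \in kept -> q' \in kept -> related q.2 q'.2 -> q = q'.
Proof.
rewrite !mem_filter => /andP[/eqP K Hq] /andP[/eqP K' Hq'] R.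
have q6 := om_size Hq; have q6' := om_size Hq'.
have rr : related q.2 q.2 by exists 0; rewrite ?rot6_0.
have [q0 [Hq0 R0 F]] := first_related q6 (ex_intro2 _ _ q Hq rr).
have A x : size x.2 = 6 -> head 0 (marks x.2) = 12 * x.1 -> related q0.2 x.2 -> q0 = x.
  move=> x6 Kx Rx; have [l E] := F _ x6 Rx; have [r [Hr E1 E2]] := mk_head l Rx.
  move: Kx; rewrite E E2 => Kx; have r0 : r = 0 by lia.
  move: E1; rewrite r0 rot6_0; last exact: om_size.
  by case: (q0) (x) Kx => [a b] [a' b'] /= Kx ->; congr pair; lia.
by rewrite -(A q) // -(A q') //; exact: related_trans R0 R.
Qed.
End Dedup.

(** * Tuples and 6-cycles *)

Definition adjn i j := (j == i.+1 %% 6) || (i == j.+1 %% 6).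

Lemma C6E (i j : 'I_6) : C6 i j = adjn i j.
Proof. by []. Qed.

Lemma sym_adj r i j : r < 12 -> i < 6 -> j < 6 -> adjn i j -> adjn (sym r i) (sym r j).
Proof.
have H : all (fun r => all (fun i => all (fun j => adjn i j ==> adjn (sym r i) (sym r j))
  (iota 0 6)) (iota 0 6)) (iota 0 12) by vm_compute.
move=> Hr Hi Hj; have /(allP H)/allP H1 : r \in iota 0 12 by rewrite mem_iota.
have /H1/allP H2 : i \in iota 0 6 by rewrite mem_iota.
by have /H2/implyP : j \in iota 0 6 by rewrite mem_iota.
Qed.

(** The automorphism group of the hexagon is dihedral of order twelve; this is checked by
    computation over all maps of six points. *)
Lemma hexagon_aut (t : nat -> nat) : (forall i, i < 6 -> t i < 6) ->
  (forall i j, i < 6 -> j < 6 -> t i = t j -> i = j) ->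
  (forall i, i < 6 -> adjn (t i) (t (i.+1 %% 6))) ->
  exists2 r, r < 12 & forall i, i < 6 -> t i = sym r i.
Proof.
have H : all (fun a => all (fun b => all (fun c => all (fun d => all (fun x => all (fun y =>
   [&& adjn a b, adjn b c, adjn c d, adjn d x, adjn x y & uniq [:: a; b; c; d; x; y]] ==>
   has (fun r => [:: a; b; c; d; x; y] == [seq sym r i | i <- iota 0 6]) (iota 0 12))
   (iota 0 6)) (iota 0 6)) (iota 0 6)) (iota 0 6)) (iota 0 6)) (iota 0 6) by vm_compute.
move=> Ht Hinj Hadj.
have M i : i < 6 -> t i \in iota 0 6 by move=> Hi; rewrite mem_iota /=; exact: Ht.
have U : uniq [seq t i | i <- iota 0 6].
  rewrite map_inj_in_uniq ?iota_uniq // => i j; rewrite !mem_iota => /= Hi Hj; exact: Hinj.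
have {H} /implyP H := allP (allP (allP (allP (allP (allP H _ (M 0 isT)) _ (M 1 isT)) _ (M 2 isT))
  _ (M 3 isT)) _ (M 4 isT)) _ (M 5 isT).
have /H/hasP[r Hr /eqP E] : [&& adjn (t 0) (t 1), adjn (t 1) (t 2), adjn (t 2) (t 3),
  adjn (t 3) (t 4), adjn (t 4) (t 5) & uniq [:: t 0; t 1; t 2; t 3; t 4; t 5]].
  by rewrite (Hadj 0) // (Hadj 1) // (Hadj 2) // (Hadj 3) // (Hadj 4).
exists r; first by move: Hr; rewrite mem_iota.
move=> i Hi; have := congr1 (fun l => nth 0 l i) (E : [seq t i | i <- iota 0 6] = _).
by rewrite !(nth_map 0) ?size_iota // nth_iota.
Qed.

Section GraphSide.
Variables (n : nat) (G : sgraph 'I_n).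
Notation e := (adj G : rel 'I_n).
Let e_sym : symmetric e := adj_sym G.
Let e_irr : irreflexive e := adj_irrefl G.

Lemma edgesP (T : finType) (F : sgraph T) (E : {set T}) :
  reflect (exists x y, F x y /\ E = [set x; y]) (E \in edges F).
Proof.
apply: (iffP imsetP) => [[[x y]]|[x [y [H ->]]]]; last by exists (x, y); rewrite ?inE.
by rewrite inE /= => H ->; exists x, y.
Qed.

Lemma set2_inj (T : finType) (a b x y : T) : [set a; b] = [set x; y] ->
  (a = x /\ b = y) \/ (a = y /\ b = x).
Proof.
move=> E; have : a \in [set x; y] by rewrite -E set21.
have : b \in [set x; y] by rewrite -E set22.
have : x \in [set a; b] by rewrite E set21.
have : y \in [set a; b] by rewrite E set22.
by move=> /set2P[H1|H1] /set2P[H2|H2] /set2P[H3|H3] /set2P[H4|H4]; first [left; split; congruence | right; split; congruence].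
Qed.

Lemma mem_edges (a b : 'I_n) : [set a; b] \in edges G -> e a b.
Proof.
by move/edgesP => [x [y [H /set2_inj[[-> ->]|[-> ->]]]]] //; rewrite e_sym.
Qed.

Lemma imset_pair (T U : finType) (f : T -> U) x y : f @: [set x; y] = [set f x; f y].
Proof. by rewrite imsetU1 imset_set1. Qed.

Lemma image_edge (f : 'I_6 -> 'I_n) (E : {set 'I_n}) : reflect
  (exists i j, C6 i j /\ E = [set f i; f j]) (E \in (graph_image C6 f).2).
Proof.
apply: (iffP imsetP) => [[E' /edgesP[i [j [H ->]]] ->]|[i [j [H ->]]]].
  by exists i, j; rewrite imset_pair.
by exists [set i; j]; rewrite ?imset_pair //; apply/edgesP; exists i, j.
Qed.

Definition vcyc (f : 'I_6 -> 'I_n) := injective f /\ forall i, e (f i) (f (ordS i)).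

Lemma vcyc_adj f i j : vcyc f -> C6 i j -> e (f i) (f j).
Proof. by move=> [_ H] /orP[]/eqP->; rewrite // e_sym. Qed.

Lemma C6_ordS (i : 'I_6) : C6 i (ordS i).
Proof. by rewrite C6E /adjn /= eqxx. Qed.

Lemma image_six_cycle f : vcyc f -> graph_image C6 f \in six_cycles G.
Proof.
move=> V; rewrite inE; apply/andP; split.
  apply/andP; split.
    apply/subsetP => E /image_edge[i [j [H ->]]]; apply/edgesP; exists (f i), (f j).
    by split=> //; exact: vcyc_adj.
  apply/forall_inP => E /imsetP[E' _ ->]; exact: imsetS (subsetT _).
apply/existsP; exists [ffun i => f i]; apply/andP; split.
  by apply/injectiveP => i j; rewrite !ffunE; exact: V.1.
apply/eqP; congr pair; first by apply: eq_imset => i; rewrite ffunE.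
by apply: eq_imset => E; apply: eq_imset => i; rewrite ffunE.
Qed.

Lemma six_cycle_image H : H \in six_cycles G ->
  exists f : 'I_6 -> 'I_n, vcyc f /\ H = graph_image C6 f.
Proof.
rewrite inE => /andP[/andP[/subsetP S _] /existsP[f /andP[/injectiveP I /eqP E]]].
exists f; split=> //; split=> // i; apply: mem_edges; apply: S; rewrite E.
by apply/image_edge; exists i, (ordS i); rewrite C6_ordS.
Qed.

Lemma ord_sym_subproof r (i : 'I_6) : sym r i < 6. Proof. exact: sym_lt. Qed.
Definition osym r (i : 'I_6) := Ordinal (ord_sym_subproof r i).

Lemma image_sub r (f f' : 'I_6 -> 'I_n) : r < 12 -> (forall i, f' i = f (osym r i)) ->
  (graph_image C6 f').1 \subset (graph_image C6 f).1 /\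
  (graph_image C6 f').2 \subset (graph_image C6 f).2.
Proof.
move=> Hr E; split; apply/subsetP.
  by move=> x /imsetP[i _ ->]; rewrite E imset_f.
move=> x /image_edge[i [j [A ->]]]; apply/image_edge; exists (osym r i), (osym r j).
by rewrite !E; split=> //; rewrite C6E; exact: sym_adj.
Qed.

Definition vals (f : 'I_6 -> 'I_n) : seq nat := [seq val (f i) | i <- enum 'I_6].

Lemma size_vals f : size (vals f) = 6.
Proof. by rewrite size_map size_enum_ord. Qed.

Lemma nth_vals f (i : 'I_6) : nth 0 (vals f) i = f i.
Proof. by rewrite (nth_map i) ?size_enum_ord // nth_ord_enum. Qed.

Lemma rot6_vals r f f' : rot6 r (vals f) = vals f' -> forall i, f' i = f (osym r i).
Proof.
move=> E i; apply: val_inj; rewrite /= -[LHS]nth_vals -E nth_rot6 //.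
by rewrite -[RHS]nth_vals.
Qed.

Lemma related_image f f' : related (vals f) (vals f') -> graph_image C6 f = graph_image C6 f'.
Proof.
move=> R; have R' := related_sym (size_vals f) R.
case: R => r Hr /rot6_vals/(image_sub Hr)[A B]; case: R' => r' Hr' /rot6_vals/(image_sub Hr')[A' B'].
apply/eqP; rewrite -pair_eqE /=; apply/andP.
by split; rewrite eqEsubset ?A ?A' ?B ?B'.
Qed.

(** Since the vertex sets agree, [f'] is [f] composed with a map [tau]; since [f] is injective and
    the edge sets agree, [tau] preserves adjacency and [hexagon_aut] identifies it. *)
Lemma image_related f f' : vcyc f -> vcyc f' -> graph_image C6 f = graph_image C6 f' ->
  related (vals f) (vals f').
Proof.
move=> V V' E.
have T i : {j | f' i = f j}.
  have : f' i \in (graph_image C6 f).1 by rewrite E imset_f.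
  by move=> H; apply: sig_eqW; case/imsetP: H => j _ ->; exists j.
pose tau i := sval (T i).
have tauE i : f' i = f (tau i) by rewrite /tau; case: (T i).
have tau_adj i : C6 (tau i) (tau (ordS i)).
  have : [set f' i; f' (ordS i)] \in (graph_image C6 f).2.
    by rewrite E; apply/image_edge; exists i, (ordS i); rewrite C6_ordS.
  move/image_edge => [a [b [A]]]; rewrite !tauE => /set2_inj[] [/V.1-> /V.1->] //.
  by rewrite (adj_sym C6).
pose t i := val (tau (inord i)).
have [i _|i j Hi Hj Eij|i Hi|r Hr Er] := @hexagon_aut t.
- exact: ltn_ord.
- have : tau (inord i) = tau (inord j) by exact: val_inj.
  move=> /(congr1 f); rewrite -!tauE => /V'.1 /(congr1 val) /=.
  by rewrite !inordK.
- have := tau_adj (inord i); rewrite C6E /t.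
  suff -> : ordS (inord i) = inord (i.+1 %% 6) :> 'I_6 by [].
  by apply: val_inj; rewrite /= !inordK ?ltn_mod.
exists r => //; apply: (@eq_from_nth _ 0); first by rewrite size_rot6 size_vals.
move=> i; rewrite size_rot6 => Hi; rewrite nth_rot6 // -(Er i Hi) /t.
rewrite nth_vals -tauE -[LHS]nth_vals inordK //.
Qed.

Lemma card_six_cycle H : H \in six_cycles G -> #|H.1| = 6.
Proof. by move/six_cycle_image => [f [[I _] ->]]; rewrite card_imset // cardsT card_ord. Qed.

Definition tup6 (x0 x1 x2 x3 x4 x5 : 'I_n) := tnth [tuple x0; x1; x2; x3; x4; x5].

Lemma vals_tup6 x0 x1 x2 x3 x4 x5 : vals (tup6 x0 x1 x2 x3 x4 x5) =
  [:: val x0; val x1; val x2; val x3; val x4; val x5].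
Proof.
apply: (@eq_from_nth _ 0); first by rewrite size_vals.
move=> i; rewrite size_vals => Hi; rewrite -[i]/(val (Ordinal Hi)) nth_vals /tup6 (tnth_nth x0).
by case: i Hi => [|[|[|[|[|[|]]]]]].
Qed.

Lemma Vc_vcyc x0 x1 x2 x3 x4 x5 : Vc e x0 x1 x2 x3 x4 x5 -> vcyc (tup6 x0 x1 x2 x3 x4 x5).
Proof.
move=> /and3P[/and3P[a01 a12 /and4P[a23 a34 a45 a50]] /and5P[n02 n03 n04 n13 n14] /and4P[n15 n24 n25 n35]].
split.
  apply/tuple_uniqP; rewrite /= !inE !negb_or n02 n03 n04 n13 n14 n15 n24 n25 n35.
  rewrite !(e_neq e_irr a01) !(e_neq e_irr a12) !(e_neq e_irr a23) !(e_neq e_irr a34).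
  by rewrite !(e_neq e_irr a45) /= andbT eq_sym (e_neq e_irr a50).
by case=> [[|[|[|[|[|[|i]]]]]] Hi] //; rewrite /tup6 !(tnth_nth x0).
Qed.

Lemma vcyc_Vc f : vcyc f ->
  let o i : 'I_n := f (inord i) in Vc e (o 0) (o 1) (o 2) (o 3) (o 4) (o 5) /\
    forall i, f i = tup6 (o 0) (o 1) (o 2) (o 3) (o 4) (o 5) i.
Proof.
move=> [I A] o.
have N i j : i < 6 -> j < 6 -> i != j -> o i != o j.
  move=> Hi Hj; apply: contraNneq => /I /(congr1 val) /=; by rewrite !inordK // => ->.
have S i : i < 6 -> e (o i) (o (i.+1 %% 6)).
  move=> Hi; suff -> : o (i.+1 %% 6) = f (ordS (inord i)) by exact: A.
  by congr f; apply: val_inj; rewrite /= !inordK ?ltn_mod.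
split.
  by rewrite /Vc (S 0) // (S 1) // (S 2) // (S 3) // (S 4) // (S 5) // !N.
move=> i; rewrite /tup6 (tnth_nth (o 0)).
have -> : f i = o i by congr f; apply: val_inj; rewrite /= inordK.
by case: i => [[|[|[|[|[|[|i]]]]]] Hi].
Qed.

Lemma sum_in_cycles c (A : subgraph_data 'I_n -> nat) (F : 'I_n -> nat) :
  (forall x, F x <= \sum_(H in six_cycles G) (A H * (x \in H.1)) * c) ->
  \sum_x F x <= \sum_(H in six_cycles G) A H * (c * 6).
Proof.
move=> HF; apply: leq_trans (leq_sum _ _) _ => [x _|]; first exact: HF.
rewrite exchange_big /= leq_eqVlt; apply/orP; left; apply/eqP; apply: eq_bigr => H HH.
under eq_bigr do rewrite -mulnA [_ * c]mulnC mulnA.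
by rewrite -big_distrr /= -mulnA; congr (_ * (_ * _)); rewrite -big_mkcond sum1_card card_six_cycle.
Qed.

(** A crude count suffices: all six entries of a tuple lie in the vertex set of its cycle, and
    [sum_in_cycles] replaces one membership at a time by a factor 6. The exact factor would be
    12. *)
Lemma TT_le : TT e <= 6 ^ 6 * #|six_cycles G|.
Proof.
have -> : 6 ^ 6 * #|six_cycles G| = \sum_(H in six_cycles G) 1 * (1 * 6 * 6 * 6 * 6 * 6 * 6).
  by rewrite sum_nat_const mulnC.
rewrite /TT; apply: (@sum_in_cycles (1 * 6 * 6 * 6 * 6 * 6)) => x0.
apply: (@sum_in_cycles (1 * 6 * 6 * 6 * 6)) => x1; apply: (@sum_in_cycles (1 * 6 * 6 * 6)) => x2.
apply: (@sum_in_cycles (1 * 6 * 6)) => x3; apply: (@sum_in_cycles (1 * 6)) => x4.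
apply: (@sum_in_cycles 1) => x5; case V: (Vc _ _ _ _ _ _ _) => //.
have {}V := Vc_vcyc V; rewrite (bigD1 _ (image_six_cycle V)).
have M i v : tup6 x0 x1 x2 x3 x4 x5 i = v -> v \in (graph_image C6 (tup6 x0 x1 x2 x3 x4 x5)).1.
  by move=> <-; exact: imset_f.
rewrite (M (@Ordinal 6 0 isT) x0) // (M (@Ordinal 6 1 isT) x1) // (M (@Ordinal 6 2 isT) x2) //.
by rewrite (M (@Ordinal 6 3 isT) x3) // (M (@Ordinal 6 4 isT) x4) // (M (@Ordinal 6 5 isT) x5).
Qed.

End GraphSide.

(** * The tuples generated by a block *)

Lemma if_sum (I : finType) (b : bool) (P : pred I) (F : I -> nat) :
  (if b then \sum_(i | P i) F i else 0) = \sum_i (if b && P i then F i else 0).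
Proof. by case: b; rewrite /= ?[LHS]big_mkcond // big1. Qed.

Lemma if_and (a b : bool) (x : nat) :
  (if a then if b then x else 0 else 0) = if a && b then x else 0.
Proof. by case: a. Qed.

Section Blocks.
Variables (n : nat) (G : sgraph 'I_n) (s : seq ('I_n * 'I_n)) (L : table).
Hypothesis s_edges : is_edge_list G s.
Notation inp := (encode_input s).
Hypothesis L_eq : forall k, L k = at_key k (rules_events inp L rules).
Notation e := (adj G : rel 'I_n).
Notation D := (size (L [:: 0])).
Notation esum := (esum inp L).
Notation vis := (vis inp L).
Notation U := (U e D).
Notation Yt := (Yt e D).
Notation Et := (Et e D).
Notation Gt := (Gt e D).
Notation Vc := (Vc e).
Notation MM := (MM e D).
Let e_sym : symmetric e := adj_sym G.
Let e_irr : irreflexive e := adj_irrefl G.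

Definition tup (b : block) (env : seq nat) := [seq nth 0 env x | x <- bvars b].
Definition W (b : block) := [seq tup b env | env <- envs inp L (bctx b) env0].

Definition six (x0 x1 x2 x3 x4 x5 : 'I_n) :=
  [:: val x0; val x1; val x2; val x3; val x4; val x5].
Definition BP (b : block) x0 x1 x2 x3 x4 x5 : bool :=
  let: (t, k, k') := b in
  [&& (if t == 2 then Et k x0 x1 x2 x3 else Yt k x0 x2 x3 && U k x0 x1 x2),
      (if t == 0 then Yt k' x0 x4 x3 && U k' x0 x5 x4 else Et k' x0 x5 x4 x3) &
      Vc x0 x1 x2 x3 x4 x5].
Definition valid (b : block) := [&& b.1.1 < 3, b.1.2 < 3 & b.2 < 3].

Lemma sum_W b g : \sum_(c <- W b) g c = esum (bctx b) env0 (fun env => g (tup b env)).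
Proof. by rewrite /W big_map. Qed.

Lemma esum_guards vs env f : esum (guards vs) env f =
  let x i := nth 0 env (nth 0 vs i) in
  if [&& [&& x 0 != x 2, x 0 != x 3, x 0 != x 4, x 1 != x 3 & x 1 != x 4],
         x 1 != x 5, x 2 != x 4, x 2 != x 5 & x 3 != x 5] then f env else 0.
Proof. by rewrite /guards /= !esum_bne esum_nil !if_and !andbA. Qed.

Lemma Yt_edge k x0 x2 x3 : Yt k x0 x2 x3 -> e x2 x3.
Proof. by case/and3P=> _ /andP[]. Qed.

Lemma Et_edges k x0 x1 x2 x3 : Et k x0 x1 x2 x3 -> [&& e x0 x1, e x1 x2 & e x2 x3].
Proof.
by case/and5P=> /andP[/and3P[-> -> _] _] _ X _ _; move: X; rewrite /Walks.Xt; case: ifP => // _ /andP[/U_twalk[]].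
Qed.

Lemma VcE x0 x1 x2 x3 x4 x5 :
  e x0 x1 -> e x1 x2 -> e x2 x3 -> e x0 x5 -> e x5 x4 -> e x4 x3 -> Vc x0 x1 x2 x3 x4 x5 =
  [&& [&& x0 != x2, x0 != x3, x0 != x4, x1 != x3 & x1 != x4],
      x1 != x5, x2 != x4, x2 != x5 & x3 != x5].
Proof.
by rewrite /Walks.Vc [e x3 x4]e_sym [e x4 x5]e_sym [e x5 x0]e_sym => -> -> -> -> -> ->.
Qed.

Arguments guards : simpl never.

(** The loops follow the layout of the tables, so the sums are exchanged into the order of the
    cycle. The edges come from the items and the inequalities from the guards; together they amount
    to [Vc], and a group test follows from the item in the group. *)
Lemma sum_block b g : valid b -> \sum_(c <- W b) g c =
  \sum_x0 \sum_x1 \sum_x2 \sum_x3 \sum_x4 \sum_x5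
    if BP b x0 x1 x2 x3 x4 x5 then g (six x0 x1 x2 x3 x4 x5) else 0.
Proof.
case: b => [[t k] k'] /and3P[/= t3 k3 k3']; rewrite sum_W /bctx.
case: t t3 => [|[|[|]]] // _; rewrite /= -catA esum_cat ?(esum_ctxY s_edges L_eq) ?(esum_ctxE s_edges L_eq) //;
  apply: eq_bigr => x0 _ /=.
- rewrite [RHS]exchange_big; apply: eq_bigr => x2 _.
  rewrite [RHS]exchange_big [LHS]big_mkcond; apply: eq_bigr => x3 _.
  rewrite [RHS]exchange_big /= esum_BL /= (HY s_edges L_eq x0 x3 k3') if_sum; apply: eq_bigr => x4 _.
  rewrite esum_bne if_and esum_BL /= (HM s_edges L_eq x0 x2 k3) if_sum; apply: eq_bigr => x1 _.
  rewrite esum_BL /= (HM s_edges L_eq x0 x4 k3') if_sum; apply: eq_bigr => x5 _.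
  rewrite esum_guards if_and /= !val_neq; congr (if _ then _ else _).
  case Y: (Yt k x0 x2 x3) => //=; case Y': (Yt k' x0 x4 x3) => //=; last by rewrite !andbF.
  case H: (U k x0 x1 x2); rewrite ?andbF //=; case H': (U k' x0 x5 x4); rewrite ?andbF //=.
  have [a01 a12 _] := U_twalk H; have [a05 a54 _] := U_twalk H'.
  rewrite VcE ?(Yt_edge Y) ?(Yt_edge Y') //.
  by rewrite [x4 == x2]eq_sym; case: (x2 == x4); rewrite ?andbF.
- rewrite [RHS]exchange_big; apply: eq_bigr => x2 _.
  rewrite [RHS]exchange_big [LHS]big_mkcond; apply: eq_bigr => x3 _.
  under [RHS]eq_bigr do rewrite exchange_big.
  rewrite [RHS]exchange_big /= esum_BL /= (HG s_edges L_eq x0 x3 k3') if_sum; apply: eq_bigr => x5 _.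
  rewrite [RHS]exchange_big /= esum_bne if_and esum_BL /= (HE s_edges L_eq x0 x3 x5 k3') if_sum.
  apply: eq_bigr => x4 _.
  rewrite esum_bne if_and esum_BL /= (HM s_edges L_eq x0 x2 k3) if_sum; apply: eq_bigr => x1 _.
  rewrite esum_guards if_and /= !val_neq; congr (if _ then _ else _).
  case Y: (Yt k x0 x2 x3) => //=; case Y': (Et k' x0 x5 x4 x3); rewrite ?andbF //=.
  case H: (U k x0 x1 x2); rewrite ?andbF //=.
  have -> : Gt k' x0 x3 x5 by apply/existsP; exists x4.
  have [a01 a12 _] := U_twalk H; have /and3P[a05 a54 a43] := Et_edges Y'.
  rewrite VcE ?(Yt_edge Y) //.
  by rewrite [x4 == x2]eq_sym [x5 == x2]eq_sym; case: (x2 == x4); case: (x2 == x5); rewrite ?andbF.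
- apply: eq_bigr => x1 _; apply: eq_bigr => x2 _; rewrite [LHS]big_mkcond; apply: eq_bigr => x3 _.
  rewrite [RHS]exchange_big /= esum_BL /= (HG s_edges L_eq x0 x3 k3') if_sum; apply: eq_bigr => x5 _.
  rewrite !esum_bne !if_and esum_BL /= (HE s_edges L_eq x0 x3 x5 k3') if_sum.
  apply: eq_bigr => x4 _.
  rewrite esum_guards if_and /= !val_neq; congr (if _ then _ else _).
  case Y: (Et k x0 x1 x2 x3) => //=; case Y': (Et k' x0 x5 x4 x3); rewrite ?andbF //=.
  have -> : Gt k' x0 x3 x5 by apply/existsP; exists x4.
  have /and3P[a01 a12 a23] := Et_edges Y; have /and3P[a05 a54 a43] := Et_edges Y'.
  rewrite VcE //.
  by rewrite [x5 == x1]eq_sym [x5 == x2]eq_sym; case: (x1 == x5); case: (x2 == x5); rewrite ?andbF.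
Qed.

Lemma W_BP b c : valid b -> c \in W b ->
  exists x0 x1 x2 x3 x4 x5, BP b x0 x1 x2 x3 x4 x5 /\ c = six x0 x1 x2 x3 x4 x5.
Proof.
move=> Hb Hc; have : 0 < \sum_(c' <- W b) (c' == c) by rewrite (big_rem c Hc) /= eqxx.
rewrite (sum_block (fun c' => c' == c : nat)) //.
move=> /sum_gt0[x0 _ /sum_gt0[x1 _ /sum_gt0[x2 _ /sum_gt0[x3 _ /sum_gt0[x4 _ /sum_gt0[x5 _]]]]]].
case: ifP => // H; rewrite lt0b => /eqP<-; by exists x0, x1, x2, x3, x4, x5.
Qed.

Lemma BP_count b x0 x1 x2 x3 x4 x5 : valid b -> BP b x0 x1 x2 x3 x4 x5 ->
  count_mem (six x0 x1 x2 x3 x4 x5) (W b) = 1.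
Proof.
move=> Hb H; rewrite -sum1_count big_mkcond.
rewrite (sum_block (fun c' => if c' == six x0 x1 x2 x3 x4 x5 then 1 else 0)) //.
have Z y0 y1 y2 y3 y4 y5 : ~~ [&& y0 == x0, y1 == x1, y2 == x2, y3 == x3, y4 == x4 & y5 == x5] ->
  (if BP b y0 y1 y2 y3 y4 y5 then
    if six y0 y1 y2 y3 y4 y5 == six x0 x1 x2 x3 x4 x5 then 1 else 0 else 0) = 0.
  by rewrite /six !eqseq_cons !val_eqE andbT => /negbTE->; case: ifP.
rewrite (pick_sum (a := x0)) //; last first.
  by move=> y _ N; do ![rewrite big1 // => ? _]; rewrite Z // (negbTE N).
rewrite (pick_sum (a := x1)) //; last first.
  by move=> y _ N; do ![rewrite big1 // => ? _]; rewrite Z // (negbTE N) ?andbF.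
rewrite (pick_sum (a := x2)) //; last first.
  by move=> y _ N; do ![rewrite big1 // => ? _]; rewrite Z // (negbTE N) ?andbF.
rewrite (pick_sum (a := x3)) //; last first.
  by move=> y _ N; do ![rewrite big1 // => ? _]; rewrite Z // (negbTE N) ?andbF.
rewrite (pick_sum (a := x4)) //; last first.
  by move=> y _ N; do ![rewrite big1 // => ? _]; rewrite Z // (negbTE N) ?andbF.
rewrite (pick_sum (a := x5)) //; last first.
  by move=> y _ N; rewrite Z // (negbTE N) !andbF.
by rewrite H eqxx.
Qed.

Lemma W_uniq b : valid b -> uniq (W b).
Proof.
move=> Hb; apply: count_mem_uniq => c; have [Hc|Hc] := boolP (c \in W b); last exact: count_memPn.
by have [x0 [x1 [x2 [x3 [x4 [x5 [H ->]]]]]]] := W_BP Hb Hc; rewrite BP_count.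
Qed.

Lemma BP_W b x0 x1 x2 x3 x4 x5 : valid b -> BP b x0 x1 x2 x3 x4 x5 -> six x0 x1 x2 x3 x4 x5 \in W b.
Proof. by move=> Hb H; rewrite -has_pred1 has_count BP_count. Qed.

Lemma size_tup b env : size (tup b env) = 6.
Proof. by rewrite size_map /bvars; case: ifP. Qed.

Lemma nblocks_valid p : p \in nblocks -> valid p.2.
Proof. by have /allP H : all (fun p => valid p.2) nblocks by []; exact: H. Qed.

Definition om := flatten [seq [seq (p.1, c) | c <- W p.2] | p <- nblocks].

Lemma omP q : reflect (exists2 p, p \in nblocks & q.1 = p.1 /\ q.2 \in W p.2) (q \in om).
Proof.
apply: (iffP flatten_mapP) => [[p Hp /mapP[c Hc ->]]|[p Hp [E Hq]]]; first by exists p.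
by exists p => //; apply/mapP; exists q.2 => //; rewrite -E; case: (q).
Qed.

Lemma om_size q : q \in om -> size q.2 = 6.
Proof. by move/omP => [p _ [_ /mapP[env _ ->]]]; exact: size_tup. Qed.

Lemma om_uniq : uniq om.
Proof.
have : uniq (unzip1 nblocks) by [].
have := nblocks_valid; rewrite /om; elim: nblocks => //= p ps IH V /andP[N Hu].
rewrite cat_uniq IH //; last by move=> q Hq; apply: V; rewrite inE Hq orbT.
rewrite map_inj_uniq ?W_uniq //= ?andbT; [|by apply: V; rewrite mem_head|by move=> c c' []].
apply/hasPn => q /flatten_mapP[p' Hp' /mapP[c _ ->]]; apply/negP => /mapP[c' _ [E _]].
by case/negP: N; rewrite -E; apply/mapP; exists p'.
Qed.

(** * The marks and the output *)

(** Compares tags only, so that the rules which may contribute to a key are found by computation;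
    for the empty key these are the output rules. *)
Definition hits (key : seq nat) (a : act) : bool :=
  match a.1, key with
  | [::], [::] => true
  | AC t' :: _, t :: _ => t' == t
  | AV _ :: _, _ :: _ => true
  | _, _ => false
  end.

Lemma no_hits key r : ~~ has (hits key) r.2 -> at_key key (rule_events inp L r) = [::].
Proof.
move=> N; rewrite /rule_events /ctx_events /at_key.
elim: (envs _ _ _ _) => //= env l IH; rewrite filter_cat map_cat IH cats0.
elim: (r.2) N => //= a acts IHa; rewrite negb_or => /andP[Na /IHa <-].
case: eqP => // E; move: Na; rewrite /hits -E.
by case: (a.1) => // -[c|x] k //=; rewrite eqxx.
Qed.

Lemma L_hits key : L key =
  flatten [seq at_key key (rule_events inp L r) | r <- [seq r <- rules | has (hits key) r.2]].
Proof.
rewrite L_eq /rules_events at_key_flatten; elim: rules => //= r rs ->.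
by case: ifP => //= /negbT/no_hits->.
Qed.

Arguments rot6 : simpl never.

Lemma size_bvars b : size (bvars b) = 6.
Proof. by rewrite /bvars; case: ifP. Qed.

Lemma vk_kK env vs : vk env (kK vs) = 8 :: [seq nth 0 env x | x <- vs].
Proof. by rewrite /vk /kK /= -map_comp. Qed.

Lemma marks_of_run p env c :
  at_key (8 :: c) (acts_events (rK p).2 env) = mk c (p.1, tup p.2 env).
Proof.
rewrite /mk /acts_events /at_key /rK; move: (iota 0 12) => l.
cbn [fst snd].
rewrite -map_comp filter_map -map_comp.
rewrite (eq_filter (a2 := fun r => rot6 r (tup p.2 env) == c)); first exact: eq_map.
move=> r; rewrite -[LHS]/(vk env (kK (rot6 r (bvars p.2))) == 8 :: c) vk_kK.
by rewrite eqseq_cons eqxx andTb /tup rot6_map ?size_bvars.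
Qed.

Lemma L_marks c : L (8 :: c) = marks om c.
Proof.
rewrite L_hits [filter _ _](_ : _ = [seq rK p | p <- nblocks]); last by [].
rewrite /marks /om flatten_flatten -map_comp; congr flatten; apply: eq_map => p.
rewrite /comp /rule_events /ctx_events at_key_flatten /W -!map_comp; congr flatten; apply: eq_map => env.
exact: marks_of_run.
Qed.

Lemma L_out : L [::] = flatten [seq q.2 | q <- kept om].
Proof.
rewrite L_hits [filter _ _](_ : _ = [seq rO p | p <- nblocks]); last by [].
have -> : flatten [seq q.2 | q <- kept om] = flatten [seq if head 0 (marks om q.2) == 12 * q.1
   then q.2 else [::] | q <- om].
  by rewrite /kept; elim: {2 4}om => //= q l <-; case: ifP.
rewrite {2}/om flatten_flatten -map_comp; congr flatten; apply: eq_map => p /=.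
rewrite /rule_events /ctx_events at_key_flatten /= envs_cat /W -!map_comp flatten_flatten.
congr flatten; apply: eq_map => env /=.
rewrite -L_marks (_ : vk env [seq AV x | x <- bvars p.2] = tup p.2 env); last by rewrite /vk -map_comp.
case: (head 0 _ == _) => //=; rewrite cats0 /at_key /acts_events -map_comp filter_map -map_comp /=.
by rewrite /tup; elim: (bvars _) => //= x l ->.
Qed.

(** A symmetry is invertible and a block generates each tuple once, so each of the [27 * 12]
    combinations of block and symmetry leaves at most one mark at a key. *)
Lemma size_marks c : size (L (8 :: c)) <= 324.
Proof.
rewrite L_marks /marks size_flatten /shape -map_comp sumnE big_map /om big_flatten big_map /=.
have -> : 324 = \sum_(p <- nblocks) 12 by rewrite big_const_seq count_predT /=.
rewrite big_seq [leqRHS]big_seq; apply: leq_sum => p Hp; rewrite big_map /= /mk.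
under eq_bigr do rewrite size_map size_filter -sum1_count big_mkcond.
rewrite exchange_big /=.
have -> : 12 = \sum_(r <- iota 0 12) 1 by rewrite sum1_size.
rewrite big_seq [leqRHS]big_seq; apply: leq_sum => r Hr0.
have Hr : r < 12 by rewrite -[r < 12]/((0 <= r) && (r < 0 + 12)) -mem_iota.
have [r' _ E] := rot6_inv Hr.
rewrite -big_mkcond sum1_count -size_filter.
apply: (@uniq_leq_size _ _ [:: rot6 r' c]); first by rewrite filter_uniq // W_uniq // nblocks_valid.
move=> c'; rewrite mem_filter inE => /andP[/eqP<-] /mapP[env _ ->].
by rewrite E // size_tup.
Qed.
End Blocks.

Lemma sum_seq_const (A : Type) (l : seq A) c : \sum_(i <- l) c = size l * c.
Proof. by rewrite big_const_seq count_predT iter_addn_0 mulnC. Qed.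

(** * Table sizes and total cost *)

Section Bounds.
Variables (n : nat) (G : sgraph 'I_n) (s : seq ('I_n * 'I_n)) (L : table).
Hypothesis s_edges : is_edge_list G s.
Notation inp := (encode_input s).
Hypothesis L_eq : forall k, L k = at_key k (rules_events inp L rules).
Notation e := (adj G : rel 'I_n).
Notation D := (size (L [:: 0])).
Notation esum := (esum inp L).
Notation vis := (vis inp L).
Notation U := (U e D).
Notation Yt := (Yt e D).
Notation Et := (Et e D).
Notation Gt := (Gt e D).
Notation Vc := (Vc e).
Notation MM := (MM e D).
Let e_sym : symmetric e := adj_sym G.
Let e_irr : irreflexive e := adj_irrefl G.

(** A simple graph has [2 * m <= n * (n - 1)], which together with [n <= m] excludes n = 1 and n =
    2. This provides [3 ^ 6 <= n ^ 6] for the constants of the program. *)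
Lemma n_gt2 : 0 < n <= size s -> 2 < n.
Proof.
move=> /andP[n0 n_le]; have H := sum_dg2 s_edges.
have : \sum_(x : 'I_n) dg e x <= \sum_(x : 'I_n) n.-1.
  apply: leq_sum => x _; rewrite /dg sum1_card.
  have <- : #|[set~ x]| = n.-1 by rewrite cardsC1 card_ord.
  apply: subset_leq_card; apply/subsetP => y; rewrite !inE => A.
  by have A' : e x y := A; apply: contraTneq A' => ->; rewrite e_irr.
rewrite H sum_nat_const card_ord; move: n_le n0; move: (size s) => z; case: (n) => [|[|[|m]]] //=; lia.
Qed.

Lemma size_le_sq : size s <= n ^ 2.
Proof.
have H := sum_dg2 s_edges.
have : \sum_(x : 'I_n) dg e x <= \sum_(x : 'I_n) n.
  by apply: leq_sum => x _; rewrite /dg sum1_card -[leqRHS]card_ord max_card.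
by rewrite H sum_nat_const card_ord expnS expn1; lia.
Qed.

Lemma sum_le_n (P : pred 'I_n) (F : 'I_n -> nat) B : (forall x, F x <= B) -> \sum_(x | P x) F x <= n * B.
Proof.
move=> H; apply: leq_trans (leq_sum _ (fun x _ => H x)) _.
by rewrite sum_nat_const leq_mul2r -[X in _ <= X]card_ord max_card orbT.
Qed.

Lemma esum_ifs_le c env : all is_if c -> esum c env (fun=> 1) <= 1.
Proof.
elim: c => [|[x|x y|x y|x y] c IH] //= H; first by rewrite esum_nil.
by rewrite esum_if; case: ifP => // _; exact: IH.
Qed.

Lemma size_rules (rs : seq rule) t key B : [seq r <- rules | writes t r] = rs ->
  all (fun r : rule => size r.2 <= 2) rs ->
  (forall r, List.In r rs -> esum r.1 env0 (fun=> 1) <= B) ->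
  size (L (t :: key)) <= size rs * (2 * B).
Proof.
move=> E HA HB; rewrite -sum1_size (key_sum_tag L_eq) E.
elim: rs HA HB {E} => [|r rs IH] /=; first by rewrite big_nil.
move=> /andP[H2 HA] HB; rewrite big_cons mulSn leq_add //; last by apply: IH => // r' Hr'; apply: HB; right.
apply: leq_trans (_ : 2 * esum r.1 env0 (fun=> 1) <= _); last by rewrite leq_mul2l HB //; left.
rewrite /rsum /Rules.esum big_distrr /=; apply: leq_sum => env _.
apply: leq_trans (_ : \sum_(a <- r.2) 1 <= _); last by rewrite sum1_size muln1.
by apply: leq_sum => a _; rewrite muln1; case: (_ == _).
Qed.

Lemma esum2_le k f B : k < 3 -> (forall env, f env <= B) -> esum (ctx2 k) env0 f <= n * (n * (n * B)).
Proof.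
move=> k3 H; rewrite (esum_ctx2 s_edges L_eq) //.
by apply: sum_le_n => x0; apply: sum_le_n => x1; apply: sum_le_n.
Qed.

Lemma esumY_le k : k < 3 -> esum (ctxY k) env0 (fun=> 1) <= n * (n * (n * 1)).
Proof.
move=> k3; rewrite (esum_ctxY s_edges L_eq) //.
by apply: sum_le_n => x0; apply: sum_le_n => x1; apply: sum_le_n.
Qed.

Lemma esumE_le k f : k < 3 -> (forall env, f env <= 1) -> esum (ctxE k) env0 f <= n * (n * (n * (n * 1))).
Proof.
move=> k3 H; rewrite (esum_ctxE s_edges L_eq) //.
by apply: sum_le_n => x0; apply: sum_le_n => x1; apply: sum_le_n => x2; apply: sum_le_n.
Qed.

(** List lengths are stored as words and must be below [q = n ^ 6]. Crude counts suffice: a tag is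
    written by at most three rules, with at most two actions and [n ^ 4] runs each, and
    [9 * n ^ 4 <= n ^ 6]. The marks need the separate bound [size_marks], as their rules have twelve
    actions and many runs. *)
Lemma table_sizes k : 2 < n -> k != [::] -> (size (L k)).+1 < n ^ 6.
Proof.
case: k => // t key n2 _.
have n6 : 9 * n ^ 4 <= n ^ 6 by rewrite (expnD n 2 4) leq_mul2r -[9]/(3 ^ 2) leq_exp2r // n2 orbT.
have n4 : 81 <= n ^ 4 by rewrite -[81]/(3 ^ 4) leq_exp2r.
have n34 : n * (n * (n * 1)) <= n ^ 4 by rewrite (_ : n * (n * (n * 1)) = n ^ 3) ?leq_pexp2l ?(leq_trans _ n2) // !expnS expn0.
have n44 : n * (n * (n * (n * 1))) <= n ^ 4 by rewrite !expnS expn0.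
have n24 : n ^ 2 <= n ^ 4 by rewrite leq_pexp2l //; lia.
have sz := size_le_sq.
suff : size (L (t :: key)) <= 6 * n ^ 4 + 2 by clear -n6 n4; lia.
case: t => [|[|[|[|[|[|[|[|[|t]]]]]]]]].
- apply: leq_trans (@size_rules [:: rD] 0 key (n ^ 4) erefl isT _) _; last by clear; rewrite /=; lia.
  move=> r [<-|//]; rewrite /rD /= esum_BR /= /blt.
  apply: leq_trans (_ : \sum_(v <- iota 0 (size s)) 1 <= _); last by rewrite sum1_size size_iota; lia.
  by apply: leq_sum => v _; rewrite esum_if esum_nil; case: ifP.
- apply: leq_trans (@size_rules [:: rA] 1 key (n ^ 4) erefl isT _) _; last by clear; rewrite /=; lia.
  move=> r [<-|//]; rewrite /rA /= esum_BR /=.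
  apply: leq_trans (_ : \sum_(v <- iota 0 (size s)) 1 <= _); last by rewrite sum1_size size_iota; lia.
  by apply: leq_sum => v _; rewrite !esum_BLet esum_nil.
- apply: leq_trans (@size_rules [:: rS] 2 key (n ^ 4) erefl isT _) _; last by clear; rewrite /=; lia.
  move=> r [<-|//]; rewrite /rS /= (esum_range s).
  apply: leq_trans (_ : n * (n * 1) <= _); last by move: n24; rewrite !expnS expn0 muln1; lia.
  apply: sum_le_n => x; rewrite esum_BL /= (HA s_edges L_eq); apply: sum_le_n => y.
  exact: esum_ifs_le.
- apply: leq_trans (@size_rules [seq rM k | k <- iota 0 3] 3 key (n ^ 4) erefl isT _) _; last by clear; rewrite /=; lia.
  by move=> r [<-|[<-|[<-|//]]]; apply: leq_trans (esum2_le _ _) n34.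
- apply: leq_trans (@size_rules [:: rL] 4 key (n ^ 4) erefl isT _) _; last by clear; rewrite /=; lia.
  move=> r [<-|//]; rewrite /rL esum_cat; apply: leq_trans (esum2_le (B := 1) _ _) n34 => // env.
  exact: esum_ifs_le.
- apply: leq_trans (@size_rules [seq rY k | k <- iota 0 3] 5 key (n ^ 4) erefl isT _) _; last by clear; rewrite /=; lia.
  by move=> r [<-|[<-|[<-|//]]]; apply: leq_trans (esumY_le _) n34.
- apply: leq_trans (@size_rules [seq rE k | k <- iota 0 3] 6 key (n ^ 4) erefl isT _) _; last by clear; rewrite /=; lia.
  by move=> r [<-|[<-|[<-|//]]]; apply: leq_trans (esumE_le _ _) n44.
- apply: leq_trans (@size_rules [seq rG k | k <- iota 0 3] 7 key (n ^ 4) erefl isT _) _; last by clear; rewrite /=; lia.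
  by move=> r [<-|[<-|[<-|//]]]; rewrite /rG esum_cat; apply: leq_trans (esumE_le _ _) n44 => // env;
    exact: esum_ifs_le.
- by apply: leq_trans (size_marks s_edges L_eq key) _; clear -n4; lia.
- apply: leq_trans (@size_rules [::] t.+4.+4.+1 key 0 _ isT _) _ => //.
Qed.

Hypothesis n_le : n <= size s.
Hypothesis s_gt0 : 0 < size s.

Lemma vis_bctx p gs : p \in nblocks -> all is_if gs -> size gs <= 1 ->
  vis (bctx p.2 ++ gs) env0 (fun=> 1) <= 99 * (1000 * MM).
Proof.
case: p => i [[t k] k'] /nblocks_lt[/= t3 k3 k3'] Hi Hs.
have I : all is_if (guards (bvars (t, k, k')) ++ gs) by rewrite all_cat Hi.
have S : size (guards (bvars (t, k, k')) ++ gs) <= 10 by rewrite size_cat (leq_add (n1 := 9)).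
case: t t3 I S => [|[|[|]]] // _ I S.
- have := vis_YY s_edges L_eq n_le s_gt0 I S k3 k3'; rewrite !catA => H.
  by apply: leq_trans H _; clear; lia.
- have := vis_YE s_edges L_eq n_le s_gt0 I S k3 k3'; rewrite !catA => H.
  by apply: leq_trans H _; clear; lia.
- by have := vis_EE s_edges L_eq n_le s_gt0 I S k3 k3'; rewrite !catA => H; apply: leq_trans H _.
Qed.

Lemma cost_vis r B : vis r.1 env0 (fun=> 1) <= B -> rule_cost inp L r <= 4 * B.
Proof. by move=> H; have := gcost_vis inp L r.1 env0; rewrite /rule_cost; lia. Qed.

(** There are 16 rules for the tables and 54 for marks and output; the factor [280 = 4 * 70]
    includes the 4 of [gcost_vis]. *)
Lemma total_cost : \sum_(r <- rules) rule_cost inp L r <= 280 * (99 * (1000 * MM)).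
Proof.
have [D0 mD _] := D_root L_eq s_gt0.
have mM : size s <= MM by rewrite /Walks.MM (leq_trans mD) // (leq_trans _ (leq_addr _ _)) // leq_pexp2l.
set B := 99 * (1000 * MM).
have B1 : 99 * (100 * MM) <= B by apply: leq_mul => //; apply: leq_mul.
have b3 c F : (forall k, k < 3 -> rule_cost inp L (F k) <= c) -> \sum_(k <- iota 0 3) rule_cost inp L (F k) <= 3 * c.
  move=> H; rewrite big_seq (leq_trans (_ : _ <= \sum_(k <- iota 0 3) c)) //.
    by rewrite [leqRHS]big_seq; apply: leq_sum => k; rewrite mem_iota => /H.
  by rewrite sum_seq_const.
have b27 F : (forall p, p \in nblocks -> rule_cost inp L (F p) <= 4 * B) ->
    \sum_(p <- nblocks) rule_cost inp L (F p) <= 27 * (4 * B).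
  move=> H; rewrite big_seq (leq_trans (_ : _ <= \sum_(p <- nblocks) 4 * B)) //.
    by rewrite [leqRHS]big_seq; apply: leq_sum => k; exact: H.
  by rewrite sum_seq_const.
have cat l l' : \sum_(r <- l ++ l') rule_cost inp L r =
    \sum_(r <- l) rule_cost inp L r + \sum_(r <- l') rule_cost inp L r by exact: big_cat.
have c3 : \sum_(r <- [:: rD; rA; rS]) rule_cost inp L r =
    rule_cost inp L rD + (rule_cost inp L rA + rule_cost inp L rS).
  by rewrite !big_cons big_nil addn0.
have c1 : \sum_(r <- [:: rL]) rule_cost inp L r = rule_cost inp L rL by exact: big_seq1.
rewrite /rules !cat c3 c1 !big_map.
have cD : rule_cost inp L rD <= 4 * B.
  apply: cost_vis; rewrite /rD /=; apply: leq_trans (_ : 1 + \sum_(i <- iota 0 (size s)) 2 <= _).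
    by rewrite leq_add2l; apply: leq_sum => i _; case: ifP.
  by rewrite sum_seq_const size_iota; move: mM s_gt0 B1; clear; lia.
have cA : rule_cost inp L rA <= 4 * B.
  apply: cost_vis; rewrite /rA /=; apply: leq_trans (_ : 1 + \sum_(i <- iota 0 (size s)) 3 <= _).
    by rewrite leq_add2l; apply: leq_sum => i _.
  by rewrite sum_seq_const size_iota; move: mM s_gt0 B1; clear; lia.
have cS : rule_cost inp L rS <= 4 * B.
  apply: cost_vis; rewrite /rS vis_range.
  apply: leq_trans (_ : 1 + \sum_(x : 'I_n) (1 + 3 * dg e x) <= _).
    rewrite leq_add2l; apply: leq_sum => x _; rewrite /= -(dgE_dg s_edges L_eq) mulnC -sum_seq_const leq_add2l.
    by apply: leq_sum => y _; do 2 case: ifP => //.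
  rewrite big_split /= -big_distrr /= (sum_dg2 s_edges) sum_n; move: mM s_gt0 n_le B1; clear; lia.
have cM k : k < 3 -> rule_cost inp L (rM k) <= 4 * B.
  move=> k3; apply: cost_vis; rewrite /rM; cbn [fst]; rewrite vis_split (esum2_1 s_edges L_eq) //.
  have := vis2 s_edges L_eq n_le s_gt0 k3; have := HUT s_edges L_eq s_gt0 k3; move: B1; clear; lia.
have cL : rule_cost inp L rL <= 4 * B.
  apply: cost_vis; rewrite /rL; cbn [fst]; rewrite vis_cat_split.
  have := vis2 s_edges L_eq n_le s_gt0 (isT : 2 < 3); have := HUT s_edges L_eq s_gt0 (isT : 2 < 3).
  have : esum (ctx2 2) env0 (fun env => vis [:: blt (ELen (kM 2 0 2)) (EC thr)] env (fun=> 1))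
     <= 2 * UT e D 2.
    rewrite -(esum2_1 s_edges L_eq) // /Rules.esum big_distrr; apply: leq_sum => env _.
    exact: (@vis_ifs _ _ [:: _]).
  move: B1; clear; lia.
have cY k : k < 3 -> rule_cost inp L (rY k) <= 4 * B.
  move=> k3; apply: cost_vis; rewrite /rY; cbn [fst]; rewrite vis_split.
  have := visY s_edges L_eq n_le s_gt0 k3; have := esumY_1 s_edges L_eq s_gt0 k3.
  move: B1; clear; lia.
have cE k : k < 3 -> rule_cost inp L (rE k) <= 4 * B.
  move=> k3; apply: cost_vis; rewrite /rE; cbn [fst]; rewrite vis_split.
  have := visE s_edges L_eq n_le s_gt0 k3; have := esumE_1 s_edges L_eq s_gt0 k3.
  move: B1; clear; lia.
have cG k : k < 3 -> rule_cost inp L (rG k) <= 4 * B.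
  move=> k3; apply: cost_vis; rewrite /rG; cbn [fst]; rewrite vis_cat_split.
  have := visE s_edges L_eq n_le s_gt0 k3; have := esumE_1 s_edges L_eq s_gt0 k3.
  have : esum (ctxE k) env0 (fun env => vis [:: BIf (EOp OEq (EHd (kE k 0 3 1)) (EV 2))] env (fun=> 1))
     <= 2 * esum (ctxE k) env0 (fun=> 1).
    by rewrite /Rules.esum big_distrr; apply: leq_sum => env _; apply: (@vis_ifs _ _ [:: _]).
  move: B1; clear; lia.
have cK := b27 rK. have cO := b27 rO.
have {}cK : \sum_(p <- nblocks) rule_cost inp L (rK p) <= 27 * (4 * B).
  by apply: cK => p Hp; apply: cost_vis; have := @vis_bctx p [::] Hp; rewrite cats0; exact.
have {}cO : \sum_(p <- nblocks) rule_cost inp L (rO p) <= 27 * (4 * B).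
  by apply: cO => p Hp; apply: cost_vis; exact: vis_bctx.
apply: leq_trans (leq_add (leq_add cD (leq_add cA cS)) (leq_add (b3 _ _ cM) (leq_add cL
  (leq_add (b3 _ _ cY) (leq_add (b3 _ _ cE) (leq_add (b3 _ _ cG) (leq_add cK cO))))))) _.
by generalize B; clear; lia.
Qed.
End Bounds.

(** * Correctness of the output *)

Section Output.
Variables (n : nat) (G : sgraph 'I_n) (s : seq ('I_n * 'I_n)) (L : table).
Hypothesis s_edges : is_edge_list G s.
Notation inp := (encode_input s).
Hypothesis L_eq : forall k, L k = at_key k (rules_events inp L rules).
Notation e := (adj G : rel 'I_n).
Notation D := (size (L [:: 0])).
Notation esum := (esum inp L).
Notation vis := (vis inp L).
Notation U := (U e D).
Notation Yt := (Yt e D).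
Notation Et := (Et e D).
Notation Gt := (Gt e D).
Notation Vc := (Vc e).
Notation MM := (MM e D).
Let e_sym : symmetric e := adj_sym G.
Let e_irr : irreflexive e := adj_irrefl G.

Hypothesis n_gt0 : 0 < n.
Notation om := (om s L).

(** Left inverse of listing the values of a tuple; the default tuple is irrelevant for generated
    lists, which always come from six vertices. *)
Definition dec (c : seq nat) : 6.-tuple 'I_n :=
  insubd [tuple of nseq 6 (Ordinal n_gt0)] (pmap insub c).

Lemma decK (t : 6.-tuple 'I_n) : dec [seq val x | x <- t] = t.
Proof. by rewrite /dec (map_pK valK) valKd. Qed.

Lemma om_cycle q : q \in om -> [/\ vcyc G (tnth (dec q.2)), vals (tnth (dec q.2)) = q.2 &
  [seq val x | x <- dec q.2] = q.2].
Proof.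
move/omP => [p /nblocks_valid Hp [_ /(W_BP s_edges L_eq Hp)[x0 [x1 [x2 [x3 [x4 [x5 [H ->]]]]]]]]].
have V : Vc x0 x1 x2 x3 x4 x5 by move: H; rewrite /BP; case: (p.2) => [[t k] k'] /and3P[].
have E : six x0 x1 x2 x3 x4 x5 = [seq val x | x <- [tuple x0; x1; x2; x3; x4; x5]] by [].
by rewrite E decK -E; split=> //; [exact: Vc_vcyc | exact: vals_tup6].
Qed.

Lemma block_in t k k' : t < 3 -> k < 3 -> k' < 3 -> exists i, (i, (t, k, k')) \in nblocks.
Proof.
by move=> t3 k3 k3'; exists (9 * t + 3 * k + k');
  case: t t3 => [|[|[|]]] // _; case: k k3 => [|[|[|]]] // _; case: k' k3' => [|[|[|]]].
Qed.

Lemma BP_om t k k' x0 x1 x2 x3 x4 x5 : t < 3 -> k < 3 -> k' < 3 ->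
  BP G L (t, k, k') x0 x1 x2 x3 x4 x5 -> exists2 q, q \in om & q.2 = six x0 x1 x2 x3 x4 x5.
Proof.
move=> t3 k3 k3' H; have [i Hi] := block_in t3 k3 k3'.
exists (i, six x0 x1 x2 x3 x4 x5) => //; apply/omP; exists (i, (t, k, k')) => //; split=> //.
by apply: (BP_W s_edges L_eq) => //; rewrite /valid /= t3 k3.
Qed.

Lemma Vc_rev x0 x1 x2 x3 x4 x5 : Vc x0 x1 x2 x3 x4 x5 -> Vc x0 x5 x4 x3 x2 x1.
Proof.
rewrite /Walks.Vc => /and3P[/and3P[a01 a12 /and4P[a23 a34 a45 a50]] /and5P[n02 n03 n04 n13 n14] /and4P[n15 n24 n25 n35]].
rewrite (e_sym x0) a50 (e_sym x5) a45 (e_sym x4) a34 (e_sym x3) a23 (e_sym x2) a12 (e_sym x1) a01.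
rewrite n02 n03 n04 (eq_sym x5) n35 (eq_sym x5) n25 (eq_sym x5) n15 (eq_sym x4) n24 (eq_sym x4) n14.
by rewrite (eq_sym x3) n13.
Qed.

(** There is no block for a thin first half with a fat second half: the cycle is then generated
    backwards, which symmetry 6, the reflection fixing position 0, undoes. *)
Lemma Cov_om x0 x1 x2 x3 x4 x5 : Vc x0 x1 x2 x3 x4 x5 -> Cov e D x0 x1 x2 x3 x4 x5 ->
  exists2 q, q \in om & related q.2 (six x0 x1 x2 x3 x4 x5).
Proof.
move=> V [k [k' [k3 k3' /orP[/andP[Y H]|E] /orP[/andP[Y' H']|E']]]].
- have [|q Hq Eq] := @BP_om 0 k k' x0 x1 x2 x3 x4 x5 isT k3 k3'; first by rewrite /= Y H Y' H'.
  by exists q => //; rewrite Eq; exists 0.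
- have [|q Hq Eq] := @BP_om 1 k k' x0 x1 x2 x3 x4 x5 isT k3 k3'; first by rewrite /= Y H E'.
  by exists q => //; rewrite Eq; exists 0.
- have [|q Hq Eq] := @BP_om 1 k' k x0 x5 x4 x3 x2 x1 isT k3' k3; first by rewrite /= Y' H' E Vc_rev.
  by exists q => //; rewrite Eq; exists 6.
- have [|q Hq Eq] := @BP_om 2 k k' x0 x1 x2 x3 x4 x5 isT k3 k3'; first by rewrite /= E E'.
  by exists q => //; rewrite Eq; exists 0.
Qed.

Lemma Vc_om x0 x1 x2 x3 x4 x5 : Vc x0 x1 x2 x3 x4 x5 ->
  exists2 q, q \in om & related q.2 (six x0 x1 x2 x3 x4 x5).
Proof.
move=> V; have V1 := Vc_rot V; have V2 := Vc_rot V1; have V3 := Vc_rot V2.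
have V4 := Vc_rot V3; have V5 := Vc_rot V4.
have T y0 y1 y2 y3 y4 y5 r : r < 12 -> Vc y0 y1 y2 y3 y4 y5 -> Cov e D y0 y1 y2 y3 y4 y5 ->
    rot6 r (six y0 y1 y2 y3 y4 y5) = six x0 x1 x2 x3 x4 x5 ->
    exists2 q, q \in om & related q.2 (six x0 x1 x2 x3 x4 x5).
  by move=> Hr Vy /(Cov_om Vy)[q Hq R] E; exists q => //; apply: related_trans R _; exists r.
have [C|[C|[C|[C|[C|C]]]]] : AnyCov e D x0 x1 x2 x3 x4 x5 by exact: coverage.
- exact: (T _ _ _ _ _ _ 0 _ V C).
- exact: (T _ _ _ _ _ _ 5 _ V1 C).
- exact: (T _ _ _ _ _ _ 4 _ V2 C).
- exact: (T _ _ _ _ _ _ 3 _ V3 C).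
- exact: (T _ _ _ _ _ _ 2 _ V4 C).
- exact: (T _ _ _ _ _ _ 1 _ V5 C).
Qed.

Lemma output_ok : lists_six_cycles G (L [::]).
Proof.
have S := @om_size n s L.
exists [seq dec q.2 | q <- kept om]; split.
  rewrite (L_out L_eq) -map_comp; congr flatten; apply/eq_in_map => q.
  by rewrite mem_filter => /andP[_ /om_cycle[_ _ E]]; rewrite /= E.
rewrite -map_comp; apply: uniq_perm; [|exact: enum_uniq|].
  rewrite map_inj_in_uniq; first by rewrite filter_uniq // (om_uniq s_edges L_eq).
  move=> q q' Hq Hq' /= E; apply: (kept_inj S) => //.
  move: Hq Hq'; rewrite !mem_filter => /andP[_ /om_cycle[V1 E1 _]] /andP[_ /om_cycle[V2 E2 _]].
  by rewrite -E1 -E2; exact: (image_related V1 V2).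
move=> H; rewrite mem_enum; apply/mapP/idP => [[q Hq ->]|].
  by move: Hq; rewrite mem_filter => /andP[_ /om_cycle[V _ _]]; exact: image_six_cycle.
move/six_cycle_image => [f [V ->]].
have /= [V' Ef] := vcyc_Vc V; have [q Hq R] := Vc_om V'.
have [q' Hq' R'] := kept_repr S Hq; exists q' => //=.
have [_ E _] : [/\ vcyc G (tnth (dec q'.2)), vals (tnth (dec q'.2)) = q'.2 &
  [seq val x | x <- dec q'.2] = q'.2].
  by apply: om_cycle; move: Hq'; rewrite mem_filter => /andP[].
symmetry; apply: related_image; rewrite E; apply: related_trans R' _.
suff -> : vals f = six (f (inord 0)) (f (inord 1)) (f (inord 2)) (f (inord 3)) (f (inord 4)) (f (inord 5)) by [].
rewrite /six -vals_tup6; apply: eq_map => i; congr val; exact: Ef.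
Qed.
End Output.

(** * Assembling the algorithm *)

Lemma size_encode n (s : seq ('I_n * 'I_n)) : size (encode_input s) = 2 + 2 * size s.
Proof. by rewrite /=; elim: s => //= p s IH; lia. Qed.

Lemma encode_lt n (s : seq ('I_n * 'I_n)) a B : 0 < B -> n < B -> size s < B ->
  nth 0 (encode_input s) a < B.
Proof.
move=> B0 nB sB; case: a => [|[|a]] //=.
have [H|H] := ltnP a (size (flatten [seq [:: val p.1; val p.2] | p <- s])); last by rewrite nth_default.
have /flatten_mapP[p _] := mem_nth 0 H; rewrite !inE => /orP[]/eqP->; exact: ltn_trans (ltn_ord _) nB.
Qed.

Lemma cost_arith p b1 b2 b3 c X T t S : 0 < X -> 0 < c -> T <= c * t ->
  S <= b1 * (b2 * (b3 * (X + T))) ->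
  p * (1 + S) <= p * (1 + b1 * (b2 * b3)) * c * (X + t).
Proof.
move=> X0 c0 H; rewrite !mulnA -!(mulnA p) leq_mul2l; move: (b1 * b2 * b3) => B HS.
apply/orP; right; rewrite -mulnA; apply: leq_trans (_ : (1 + B) * (X + T) <= _).
  by rewrite mulnDl mul1n leq_add // (leq_trans X0) // leq_addr.
by rewrite leq_mul2l; apply/orP; right; rewrite mulnDr leq_add // leq_pmull.
Qed.

(** The running time is kept in natural numbers, with [D ^ 8] and the relation [D ^ 5 <= 32 * m] in
    place of a fractional power of m. *)
Lemma algorithm : exists K : nat, forall n (G : sgraph 'I_n) (s : seq ('I_n * 'I_n)) w,
  0 < n <= #|edges G| -> is_edge_list G s -> n ^ 241 <= 2 ^ w ->
  exists time D : nat, let final := run w (compile rules) time (init w (encode_input s)) in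
    [/\ halted (compile rules) final, lists_six_cycles G (out final),
        time <= K * (D ^ 8 + #|six_cycles G|) & D ^ 5 <= 32 * #|edges G|].
Proof.
exists (size (compile rules) * (1 + 280 * (99 * 1000)) * 6 ^ 6) => n G s w Hn Hs Hw.
have sz : size s = #|edges G| by rewrite cardE -(perm_size Hs) size_map.
rewrite -sz in Hn *; have n2 := n_gt2 Hs Hn; have /andP[n0 n_le] := Hn.
have s_gt0 : 0 < size s by exact: leq_trans n0 n_le.
have [L L_eq'] := final_table (encode_input s) (fun=> [::]) chk_rules_rules.
have L_eq k : L k = at_key k (rules_events (encode_input s) L rules) by exact: L_eq'.
have sn := size_le_sq Hs.
have n26 : n ^ 2 < n ^ 6 by rewrite ltn_exp2l //; exact: ltnW.
have n16 : n < n ^ 6 by rewrite -{1}[n]expn1 ltn_exp2l //; exact: ltnW.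
have szi : size (encode_input s) <= n ^ 24.
  rewrite size_encode (leq_trans (_ : _ <= n ^ 3)) //; last by rewrite leq_pexp2l // (leq_trans _ n0).
  have : 9 <= n ^ 2 by rewrite -[9]/(3 ^ 2) leq_exp2r.
  have : 3 * n ^ 2 <= n ^ 3 by rewrite (expnS n 2) leq_mul2r n2 orbT.
  by move: sn; clear; move: (n ^ 2) (n ^ 3) => a b; lia.
have iB a : nth 0 (encode_input s) a < n ^ 6.
  by apply: encode_lt => //; [exact: leq_ltn_trans (leq0n _) n16 | exact: leq_ltn_trans sn n26].
have tB k : k != [::] -> (size (L k)).+1 < n ^ 6 by move=> Hk; exact: (table_sizes Hs L_eq n2 Hk).
have [time [H1 H2 H3]] := @compile_ok w n (encode_input s) rules L n2 erefl szi iB Hw chk_rules_rules L_eq tB.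
clear Hw; exists time, (size (L [:: 0])); have [D0 _ D5] := D_root L_eq s_gt0.
split=> //; first by rewrite H2; exact: (output_ok Hs L_eq n0).
have c0 : 0 < 6 ^ 6 by rewrite expn_gt0.
have X0 : 0 < size (L [:: 0]) ^ 8 by rewrite expn_gt0 D0.
exact: leq_trans H3 (cost_arith _ X0 c0 (TT_le G) (total_cost Hs L_eq n_le s_gt0)).
Qed.

(** * From fifth roots to real powers *)

Import Order.TTheory GRing.Theory Num.Theory.
Local Open Scope ring_scope.

(** Raise [D ^ 5 <= 32 * m] to the power 8/5, which is written 16/10. *)
Lemma power_bound (R : realType) (D m : nat) : (D ^ 5 <= 32 * m)%N ->
  (D ^ 8)%:R <= (32 `^ (16 / 10) : R) * m%:R `^ (16 / 10).
Proof.
move=> H; rewrite -powRM ?ler0n //.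
have -> : (D ^ 8)%:R = ((D ^ 5)%N%:R : R) `^ (16 / 10).
  rewrite !natrX -!powR_mulrn ?ler0n // -powRrM; congr (_ `^ _).
  lra.
apply: ge0_ler_powR; rewrite ?nnegrE ?ler0n ?divr_ge0 ?mulr_ge0 ?ler0n //.
by rewrite -natrM ler_nat.
Qed.

Theorem theorem1p1 (R : realType) :
  exists (P : program) (K d : nat) (C : R),
    forall (n : nat) (G : sgraph 'I_n) (s : seq ('I_n * 'I_n)) (w : nat),
      let m := #|edges G| in
      let t := #|six_cycles G| in
      (0 < n <= m)%N ->
      is_edge_list G s ->
      (n ^ K <= 2 ^ w)%N ->
      exists time : nat,
        let final := run w P time (init w (encode_input s)) in
        [/\ halted P final,
            lists_six_cycles G (out final) &
            time%:R <= C * ln (n%:R : R) ^+ d * (m%:R `^ (16 / 10) + t%:R)].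
Proof.
have [K HK] := algorithm.
(* The logarithm gets exponent 0, since table access by address takes constant time; the constant
   absorbs the power of 32 from rounding the fifth root. *)
exists (compile rules), 241%N, 0%N, (K%:R * (32 `^ (16 / 10) + 1)) => n G s w m t Hn Hs Hw.
have [time [D [H1 H2 H3 H4]]] := HK n G s w Hn Hs Hw; clear Hw HK.
exists time; split=> //; rewrite expr0 mulr1.
have H5 := power_bound R H4; rewrite -/m -/t in H3 H5 *.
apply: (@le_trans _ _ (K%:R * ((D ^ 8)%:R + t%:R))); first by rewrite -natrD -natrM ler_nat.
rewrite -mulrA ler_wpM2l ?ler0n // (le_trans (lerD H5 (lexx _))) //.
move: (powR_ge0 32 (16 / 10) : 0 <= _ :> R) (powR_ge0 m%:R (16 / 10) : 0 <= _ :> R) (ler0n R t).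
move: (32 `^ (16 / 10)) (m%:R `^ (16 / 10)) (t%:R) => a A u a0 A0 u0.
have : 0 <= a * u by rewrite mulr_ge0.
lra.
Qed.
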